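(* Let $\gamma\in\left(0,\frac n2\right)\setminus\mathbb{N}$, $a=1-2\gamma$, $s=\frac n2+\gamma$, $m=[\gamma]$ (integer part), $\gamma_0=\gamma-m\in(0,1)$, $a_0=1-2\gamma_0$. Let $f$ be a smooth (Schwartz) function on $\mathbb{R}^n$, and let $U=U(x,y)$ be the (bounded) solution of the boundary value problem $$\Delta_xU+\frac ay\partial_yU+\partial_{yy}U=0\ \text{ in }\mathbb{R}^{n+1}_+,\qquad U(x,0)=f(x)\ \text{ for all }x\in\mathbb{R}^n.$$ Then the function $u:=y^{n-s}U$ is the solution of the Poisson equation on hyperbolic space $\mathbb{H}^{n+1}$ $$-\Delta_{g_{\mathbb{H}}}u-s(n-s)u=0\ \text{ in }\mathbb{H}^{n+1},\qquad u=Fy^{n-s}+Hy^s,\qquad F(x,0)=f(x).$$ Moreover, the following limit exists and $$P_\gamma f=\frac{d_\gamma}{2\gamma_0}A_m^{-1}\lim_{y\to0}\,y^{a_0}\,\partial_y\left[\left(y^{-1}\partial_y\right)^mU\right]$$ (a total of $m+1$ derivatives in $y$), where $$A_m=2^m\gamma(\gamma-1)\cdots(\gamma-m+1)\ \text{ if } m>0,\qquad A_0=1.$$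
   Context: $\mathbb{R}^{n+1}_+=\{(x,y):x\in\mathbb{R}^n,\,y>0\}$, and $\mathbb{H}^{n+1}$ is $\mathbb{R}^{n+1}_+$ with the metric $g_{\mathbb{H}}=\frac{dy^2+|dx|^2}{y^2}$. $\Delta_{g_{\mathbb H}}$ is its Laplace–Beltrami operator, with the sign convention that $-\Delta$ is nonnegative. $\Delta_x$ is the Euclidean Laplacian in $x\in\mathbb{R}^n$. The solution $U$ of the boundary value problem is the Poisson extension $U=K_\gamma*_xf$, with $K_\gamma(x,y)=c_{n,\gamma}\,y^{1-a}(|x|^2+y^2)^{-\frac{n+1-a}{2}}$ and $c_{n,\gamma}$ such that $\int_{\mathbb{R}^n}K_\gamma(x,y)\,dx=1$. (The bounded solution is unique.) Definition of $P_\gamma=P_\gamma[g_{\mathbb{H}},|dx|^2]$: for $s=\frac n2+\gamma$, let $u$ be the solution of $-\Delta_{g_{\mathbb H}}u-s(n-s)u=0$ in $\mathbb{H}^{n+1}$ of the form $u=Fy^{n-s}+Hy^s$, with $F,H$ smooth up to $y=0$, $F$ and $H$ having only even powers of $y$ in their Taylor expansions at $y=0$, $F|_{y=0}=f$, and $y^{s-n}u$ bounded (this is ''the solution of the Poisson equation''). The scattering operator is $S(s)f=H|_{y=0}$, and $P_\gamma f:=d_\gamma S\left(\frac n2+\gamma\right)f$, where $d_\gamma=2^{2\gamma}\frac{\Gamma(\gamma)}{\Gamma(-\gamma)}$. *)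

(* Defs.v *)
From mathcomp Require Import all_boot all_order all_algebra.
From mathcomp Require Import all_classical all_reals all_analysis.
Set Implicit Arguments.
Unset Strict Implicit.
Unset Printing Implicit Defensive.
Import Order.TTheory GRing.Theory Num.Theory.
Import numFieldNormedType.Exports.
Local Open Scope classical_set_scope.
Local Open Scope ring_scope.

Section Smoothness.
Variables (R : realType) (V : normedModType R).

Definition iter_derive (vs : seq V) (f : V -> R) : V -> R :=
  foldr (fun v g => 'D_v g) f vs.

(* Meant for open D: iterated directional derivatives up to order k exist and
   are continuous at every point of D. *)
Definition Ck_on (k : nat) (D : set V) (f : V -> R) : Prop :=
  forall (vs : seq V) (p : V), (size vs <= k)%N -> D p ->
    {for p, continuous (iter_derive vs f)} /\
    ((size vs < k)%N -> forall v, derivable (iter_derive vs f) p v).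

Definition smooth_on (D : set V) (f : V -> R) : Prop :=
  forall k, Ck_on k D f.

(* The norm on row vectors is the max norm, which is equivalent to the
   Euclidean one and so gives the same rapidly decreasing functions. *)
Definition schwartz (f : V -> R) : Prop :=
  smooth_on setT f /\
  forall (vs : seq V) (k : nat), exists M : R,
    forall x, (1 + `|x|) ^+ k * `|iter_derive vs f x| <= M.

(* Laplace-Beltrami operator |g|^(-1/2) d_i (|g|^(1/2) g^(ij) d_j u) in a global
   chart with coordinate directions e and metric matrix g. *)
Definition laplace_beltrami (N : nat) (e : 'I_N -> V) (g : V -> 'M[R]_N)
    (u : V -> R) : V -> R := fun p =>
  (Num.sqrt (\det (g p)))^-1 *
  \sum_i 'D_(e i) (fun q => Num.sqrt (\det (g q)) *
                            \sum_j invmx (g q) i j * 'D_(e j) u q) p.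

End Smoothness.

Section GammaFunction.
Variable R : realType.

Definition euler_integral (z : R) : R :=
  Rintegral lebesgue_measure `]0, +oo[
    (fun t : R => t `^ (z - 1) * expR (- t)).

(* Continuation to negative non-integers by
   Gamma (z + k) = z (z + 1) ... (z + k - 1) Gamma z with z + k > 0;
   the values at 0, -1, -2, ... are meaningless. *)
Definition Gamma (z : R) : R :=
  if 0 < z then euler_integral z else
  let k := `|Num.floor z|%N in
  euler_integral (z + k%:R) / \prod_(i < k) (z + i%:R).

End GammaFunction.

Section HalfSpace.
Variables (R : realType) (n : nat).

(* A point of the half-space is p = (x, y) with x = p.1 and y = p.2. *)
Local Notation V := ('rV[R]_n * R)%type.

Definition half_space : set V := [set p | 0 < p.2].
Definition closed_half_space : set V := [set p | 0 <= p.2].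

Definition ex (i : 'I_n) : V := (delta_mx 0 i, 0).
Definition ey : V := (0, 1).

Definition dy (U : V -> R) : V -> R := 'D_ey U.
Definition laplace_x (U : V -> R) : V -> R :=
  fun p => \sum_(i < n) 'D_(ex i) ('D_(ex i) U) p.

Definition coord_dir (i : 'I_(n + 1)) : V :=
  match fintype.split i with inl j => ex j | inr _ => ey end.

Definition hyperbolic_metric (p : V) : 'M[R]_(n + 1) := (p.2 ^- 2)%:M.

Definition laplace_hyperbolic : (V -> R) -> V -> R :=
  laplace_beltrami coord_dir hyperbolic_metric.

Definition bounded_bvp_solution (a : R) (f : 'rV[R]_n -> R) (U : V -> R) : Prop :=
  [/\ Ck_on 2 half_space U,
      forall p, 0 < p.2 -> laplace_x U p + a / p.2 * dy U p + dy (dy U) p = 0,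
      {within closed_half_space, continuous U},
      forall x, U (x, 0) = f x
    & exists M : R, forall p, 0 < p.2 -> `|U p| <= M].

Definition smooth_up_to_boundary (F : V -> R) : Prop :=
  [/\ smooth_on half_space F,
      {within closed_half_space, continuous F}
    & forall vs : seq V, exists2 G : V -> R,
        {within closed_half_space, continuous G}
        & forall p, 0 < p.2 -> G p = iter_derive vs F p].

(* The odd Taylor coefficients in y at y = 0 vanish. *)
Definition even_in_y (F : V -> R) : Prop :=
  forall (x : 'rV[R]_n) (k : nat),
    iter_derive (nseq k.*2.+1 ey) F (x, y) @[y --> 0^'+] --> (0 : R).

(* "u is the solution of the Poisson equation with datum f", together with the
   functions F, H of its expansion at y = 0. *)
Definition poisson_solution (s : R) (f : 'rV[R]_n -> R) (u F H : V -> R) : Prop :=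
  [/\ Ck_on 2 half_space u /\
      (forall p, 0 < p.2 ->
        - laplace_hyperbolic u p - s * (n%:R - s) * u p = 0),
      forall p, 0 < p.2 -> u p = F p * p.2 `^ (n%:R - s) + H p * p.2 `^ s,
      [/\ smooth_up_to_boundary F, smooth_up_to_boundary H,
          even_in_y F & even_in_y H],
      forall x, F (x, 0) = f x
    & exists M : R, forall p, 0 < p.2 -> `|p.2 `^ (s - n%:R) * u p| <= M].

(* The value of H at y = 0, picked by choice among all solutions. *)
Definition scattering (s : R) (f : 'rV[R]_n -> R) : 'rV[R]_n -> R :=
  get [set h | exists u F H, poisson_solution s f u F H /\
                             h = (fun x => H (x, 0))].

Definition d_const (gamma : R) : R :=
  2 `^ (2 * gamma) * (Gamma gamma / Gamma (- gamma)).

Definition P_op (gamma : R) (f : 'rV[R]_n -> R) : 'rV[R]_n -> R :=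
  fun x => d_const gamma * scattering (n%:R / 2 + gamma) f x.

Definition A_const (gamma : R) (m : nat) : R :=
  2 ^+ m * \prod_(i < m) (gamma - i%:R).

(* (y^-1 d/dy)^m U *)
Definition weighted_dy (m : nat) (U : V -> R) : V -> R :=
  iter m (fun W p => p.2^-1 * dy W p) U.

End HalfSpace.

(* Main.v *)
Require Import Defs.
From mathcomp Require Import all_boot all_order all_algebra.
From mathcomp Require Import all_classical all_reals all_analysis.
From mathcomp Require Import ring lra.
Set Implicit Arguments.
Unset Strict Implicit.
Unset Printing Implicit Defensive.
Import Order.TTheory GRing.Theory Num.Theory.
Import numFieldNormedType.Exports.
Local Open Scope classical_set_scope.
Local Open Scope ring_scope.

(** The solution [U] is given, but only as a bounded function of class C^2 in the
   open half-space that is continuous up to the boundary. What has to be found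
   is its full expansion U = F + y^(2 gamma) H, where [F] and [H] are smooth up
   to the boundary and even in y. Everything else follows from the expansion.

   Regularity. A maximum principle holds for bounded solutions
   ([maximum_principle]); its barrier combines |x|^2 - D y^2 with the homogeneous
   solution y^(2 gamma). Applied to difference quotients of [U] in x it shows
   that all tangential derivatives of [U] exist, are bounded and are continuous
   up to the boundary ([limit_solution_deriv], [x_derivs_limit]). The equation,
   an ordinary differential equation in y for each such derivative, then gives
   the normal derivatives in the interior ([interpolation], [solution_jetP]).

   Expansion. With L = y^-1 d/dy the equation reads
   y^2 L^2 U + (2 - 2 gamma) L U = - Delta_x U; it prescribes L^j F at y = 0 for
   all j, because gamma is not an integer. Borel's theorem ([borel]) produces
   such an [F], smooth in x and y^2. The difference E = U - F vanishes at y = 0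
   and solves the equation up to a right-hand side that is flat at y = 0, so that
   integrating the equation gains two powers of y at a time until
   |E| <= C y^(2 gamma) ([sharp_growth]). The function H = y^(-2 gamma) E
   solves the same kind of equation with gamma replaced by - gamma, whose
   integration from y = 0 bounds one more normal derivative at each step
   ([second_jet_bounds]); hence [H] is smooth up to the boundary
   ([jet_extend], [expansion]).

   Conclusions. Conjugation by y^(n-s) turns the hyperbolic equation into the
   equation of [U] ([hyperbolic_conjugation]). So u = y^(n-s) U solves the
   Poisson equation, and any other solution divided by y^(n-s) equals [U] by the
   maximum principle ([bvp_unique], [poisson_bvp]). The boundary value of [H]
   does not depend on the expansion: otherwise y^(2 gamma) times a function that
   does not vanish at the boundary would be smooth and even
   ([even_pow_leading0]). Hence the scattering operator maps [f] to this
   boundary value. Finally y^(a_0) d/dy L^m = y^(2 - 2 gamma_0) L^(m+1) sends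
   [F] to 0 as y tends to 0, and sends y^(2 gamma) H to the product of the
   2 (gamma - i), i = 0, ..., m, times the value of [H] ([weighted_limit]);
   this product is 2 gamma_0 A_m. *)

(** * Calculus along lines *)

Section Directional.
Variables (R : realType) (V : normedModType R).
Implicit Types (f g : V -> R) (p v : V) (d e c : R).

Lemma isdD f g p v d e : is_derive p v f d -> is_derive p v g e ->
  is_derive p v (fun q => f q + g q) (d + e).
Proof. by move=> fd gd; exact: (@is_deriveD _ _ _ f g). Qed.

Lemma isdB f g p v d e : is_derive p v f d -> is_derive p v g e ->
  is_derive p v (fun q => f q - g q) (d - e).
Proof. by move=> fd gd; exact: (@is_deriveB _ _ _ f g). Qed.

Lemma isdN f p v d : is_derive p v f d -> is_derive p v (fun q => - f q) (- d).
Proof. by move=> fd; exact: (@is_deriveN _ _ _ f). Qed.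

Lemma isdZ f c p v d : is_derive p v f d ->
  is_derive p v (fun q => c * f q) (c * d).
Proof. by move=> fd; exact: (@is_deriveZ _ _ _ f c). Qed.

Lemma isdM f g p v d e : is_derive p v f d -> is_derive p v g e ->
  is_derive p v (fun q => f q * g q) (f p * e + g p * d).
Proof. by move=> fd gd; exact: (@is_deriveM _ _ f g). Qed.

Lemma isd_sum (I : Type) (r : seq I) (h : I -> V -> R) (dh : I -> R) p v :
  (forall i, is_derive p v (h i) (dh i)) ->
  is_derive p v (fun q => \sum_(i <- r) h i q) (\sum_(i <- r) dh i).
Proof.
move=> hd; elim: r => [|i r ih].
  rewrite big_nil (_ : (fun _ => _) = cst 0) ?funeqE => [|q]; last by rewrite big_nil.
  exact: is_derive_cst.
rewrite big_cons.
rewrite (_ : (fun _ => _) = (fun q => h i q + \sum_(i <- r) h i q)); last first.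
  by rewrite funeqE => q; rewrite big_cons.
exact: isdD.
Qed.

Lemma isd_eq f p v d e : is_derive p v f d -> d = e -> is_derive p v f e.
Proof. by move=> ? <-. Qed.

Lemma isd_val f p v d : is_derive p v f d -> 'D_v f p = d.
Proof. by move=> fd; exact: derive_val. Qed.

Lemma isd_derivable f p v d : is_derive p v f d -> derivable f p v.
Proof. by case. Qed.

Lemma isd_near f g p v d : (\near p, f p = g p) ->
  is_derive p v f d -> is_derive p v g d.
Proof. exact: near_eq_is_derive. Qed.

Lemma isd_uniq f p v d e : is_derive p v f d -> is_derive p v f e -> d = e.
Proof. by move=> /isd_val <- /isd_val <-. Qed.

Lemma isd_line f p v (t : R) d :
  is_derive t (1 : R) (fun s => f (p + s *: v)) d <->
  is_derive (p + t *: v) v f d.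
Proof.
have E : (fun h : R => h^-1 *: ((fun s => f (p + s *: v)) (h *: 1 + t)
            - f (p + t *: v))) =
         (fun h : R => h^-1 *: (f (h *: v + (p + t *: v)) - f (p + t *: v))).
  rewrite funeqE => h /=; congr (_ *: (f _ - _)).
  by rewrite [h *: _]mulr1 scalerDl addrCA.
by split=> -[fd fv]; split; move: fd fv; rewrite /derivable /derive E.
Qed.

Lemma isd_line0 f p v d :
  is_derive p v f d -> is_derive (0 : R) (1 : R) (fun s => f (p + s *: v)) d.
Proof. by move=> fd; apply/isd_line; rewrite scale0r addr0. Qed.

Lemma isdP f p v d : is_derive p v f d <->
  h^-1 * (f (h *: v + p) - f p) @[h --> 0^'] --> d.
Proof.
split; first by move=> [fd fv]; rewrite -fv; exact: fd.
by move=> fd; split; [apply/cvg_ex; exists d|exact/cvg_lim].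
Qed.

End Directional.

Section OneVariable.
Variable R : realType.
Implicit Types (f g df dg : R -> R) (a b : R).

Lemma isd_cont f a d : is_derive a (1 : R) f d -> {for a, continuous f}.
Proof. by move=> [fd _]; apply/differentiable_continuous/derivable1_diffP. Qed.

Lemma isd_comp f g a d e : is_derive a (1 : R) g e -> is_derive (g a) (1 : R) f d ->
  is_derive a (1 : R) (fun t => f (g t)) (d * e).
Proof. by move=> gd fd; have := @is_derive1_comp R f g a d e fd gd. Qed.

Lemma isd_id a : is_derive a (1 : R) (fun t : R => t) 1.
Proof. exact: is_derive_id. Qed.

Lemma isd_cst (V : normedModType R) (p v : V) (c : R) : is_derive p v (fun=> c) 0.
Proof. exact: is_derive_cst. Qed.

Lemma isd_exprn (k : nat) a :
  is_derive a (1 : R) (fun t => t ^+ k) (k%:R * a ^+ k.-1).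
Proof.
have /derivableP := @exprn_derivable R k a 1.
by rewrite exp_derive [_ *: 1]mulr1.
Qed.

Lemma isd_powR (r a : R) : 0 < a ->
  is_derive a (1 : R) (fun t => t `^ r) (r * a `^ (r - 1)).
Proof. by move=> a0; exact: is_derive1_powR. Qed.

Lemma mvt f df a b : a < b ->
  (forall t, a <= t <= b -> is_derive t (1 : R) f (df t)) ->
  exists2 t, a < t < b & f b - f a = df t * (b - a).
Proof.
move=> ab fd; have [||t tab ->] := @MVT R f df a b ab.
- by move=> t; rewrite in_itv /= => /andP[at1 tb]; apply: fd; rewrite !ltW.
- apply: derivable_within_continuous => t; rewrite in_itv /= => tab.
  exact: isd_derivable (fd _ tab).
- by exists t; rewrite // -[_ < _ < _]/(t \in `]a, b[%R).
Qed.

Lemma mvt_le f g df dg a b : a <= b ->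
  (forall t, a <= t <= b -> is_derive t (1 : R) f (df t)) ->
  (forall t, a <= t <= b -> is_derive t (1 : R) g (dg t)) ->
  (forall t, a <= t <= b -> `|df t| <= dg t) ->
  `|f b - f a| <= g b - g a.
Proof.
move=> ab fd gd le; have [->|ab'] := eqVneq a b; first by rewrite !subrr normr0.
have {ab ab'} ab : a < b by rewrite lt_neqAle ab'.
have [s /andP[as1 sb] eqs] := mvt ab (fun t h => isdB (gd t h) (fd t h)).
have [r /andP[ar rb] eqr] := mvt ab (fun t h => isdD (gd t h) (fd t h)).
have ab0 : 0 <= b - a by rewrite subr_ge0 ltW.
have ls : `|df s| <= dg s by apply: le; rewrite !ltW.
have lr : `|df r| <= dg r by apply: le; rewrite !ltW.
move: lr ls; rewrite !ler_norml => /andP[lr _] /andP[_ ls].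
have : 0 <= (dg s - df s) * (b - a) by apply: mulr_ge0 => //; lra.
have : 0 <= (dg r + df r) * (b - a) by apply: mulr_ge0 => //; lra.
by rewrite -eqs -eqr => h1 h2; apply/andP; split; lra.
Qed.

Lemma mvt_cst f df a b (C : R) : a <= b ->
  (forall t, a <= t <= b -> is_derive t (1 : R) f (df t)) ->
  (forall t, a <= t <= b -> `|df t| <= C) ->
  `|f b - f a| <= C * (b - a).
Proof.
move=> ab fd le; rewrite mulrBr.
apply: (mvt_le ab fd (dg := fun=> C)) => // t _.
by apply: isd_eq (isdZ C (isd_id t)) _; rewrite mulr1.
Qed.

Lemma mvt_dist f df a b (C : R) :
  (forall t, Num.min a b <= t <= Num.max a b -> is_derive t (1 : R) f (df t)) ->
  (forall t, Num.min a b <= t <= Num.max a b -> `|df t| <= C) ->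
  `|f b - f a| <= C * `|b - a|.
Proof.
have [ab|ba] := leP a b => fd le.
  by rewrite [`|b - a|]ger0_norm ?subr_ge0 //; exact: mvt_cst le.
rewrite distrC [`|b - a|]distrC [`|a - b|]ger0_norm ?subr_ge0 ?(ltW ba) //.
exact: mvt_cst (ltW ba) fd le.
Qed.

(** A function that is uniformly approximated near a point, together with its
   would-be derivative, is differentiable there: the difference with one
   approximant is Lipschitz with a small constant, because the differences
   between approximants are. *)
Lemma isd_approx g (chi : R -> R) a (r : R) : 0 < r ->
  (forall e, 0 < e -> exists phi dphi : R -> R,
     forall t, `|t - a| < r ->
     [/\ is_derive t (1 : R) phi (dphi t), `|phi t - g t| <= e & `|dphi t - chi t| <= e]) ->
  is_derive a (1 : R) g (chi a).
Proof.
move=> r0 H; apply/isdP/cvgrPdist_lt => e e0.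
have e4 : 0 < e / 4 by rewrite divr_gt0.
have [phi [dphi phiP]] := H _ e4.
have aa : `|a - a| < r by rewrite subrr normr0.
have [phid _ dphia] := phiP a aa.
have lip t : `|t - a| < r -> `|(g t - phi t) - (g a - phi a)| <= e / 4 * `|t - a|.
  move=> ta; apply/ler_addgt0Pr => eta eta0.
  pose eta' := Num.min (eta / 4) (eta / (4 * r)).
  have eta'0 : 0 < eta' by rewrite lt_min !divr_gt0 ?mulr_gt0.
  have [psi [dpsi psiP]] := H _ eta'0.
  have sub s : Num.min a t <= s <= Num.max a t -> `|s - a| < r.
    move: ta; case: (leP a t) => [at1|ta1] tr /andP[h1 h2].
      rewrite ger0_norm ?subr_ge0 //; apply: le_lt_trans tr.
      by rewrite ger0_norm ?subr_ge0 // lerB.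
    rewrite distrC ger0_norm ?subr_ge0 //; apply: le_lt_trans tr.
    by rewrite distrC ger0_norm ?subr_ge0 ?(ltW ta1) // lerB.
  have L : `|(psi t - phi t) - (psi a - phi a)| <= (e / 4 + eta') * `|t - a|.
    apply: (mvt_dist (f := fun s => psi s - phi s) (df := fun s => dpsi s - dphi s)).
      by move=> s /sub sr; apply: isdB; [case: (psiP _ sr)|case: (phiP _ sr)].
    move=> s /sub sr; have [_ _ h1] := psiP _ sr; have [_ _ h2] := phiP _ sr.
    have -> : dpsi s - dphi s = (dpsi s - chi s) - (dphi s - chi s) by ring.
    by rewrite (le_trans (ler_normB _ _)) // addrC lerD.
  have [_ h1 _] := psiP t ta; have [_ h2 _] := psiP a aa.
  have -> : g t - phi t - (g a - phi a) =
    (psi t - phi t - (psi a - phi a)) - (psi t - g t) + (psi a - g a) by ring.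
  apply: le_trans (ler_normD _ _) _; apply: le_trans (lerD (ler_normB _ _) h2) _.
  apply: le_trans (lerD (lerD L h1) (lexx _)) _.
  have : eta' <= eta / 4 by rewrite ge_min lexx.
  have : eta' * `|t - a| <= eta / 4.
    apply: le_trans (ler_wpM2l (ltW eta'0) (ltW ta)) _.
    apply: (@le_trans _ _ (eta / (4 * r) * r)).
      by apply: ler_wpM2r; [exact: ltW|rewrite ge_min lexx orbT].
    by rewrite invfM mulrA mulfVK // gt_eqF.
  by rewrite mulrDl; lra.
have phil : \forall h \near 0^', `|dphi a - h^-1 * (phi (h *: 1 + a) - phi a)| < e / 4.
  by move/isdP : phid => /cvgrPdist_lt; apply.
near=> h.
have h0 : h != 0 by near: h; exact: nbhs_dnbhs_neq.
have hr : `|h| < r.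
  near: h; apply: dnbhs0_lt; exact: r0.
have := lip (h *: 1 + a); rewrite addrK [h *: 1]mulr1 => /(_ hr) L.
have : `|h^-1 * ((g (h + a) - phi (h + a)) - (g a - phi a))| <= e / 4.
  by rewrite normrM normfV mulrC ler_pdivrMr ?normr_gt0.
have : `|dphi a - h^-1 * (phi (h *: 1 + a) - phi a)| < e / 4 by near: h.
rewrite [h *: 1]mulr1 => h1 h2.
have -> : chi a - h^-1 * (g (h + a) - g a) =
  - (dphi a - chi a) + (dphi a - h^-1 * (phi (h + a) - phi a))
   - h^-1 * ((g (h + a) - phi (h + a)) - (g a - phi a)) by ring.
apply: le_lt_trans (ler_normB _ _) _.
apply: le_lt_trans (lerD (ler_normD _ _) h2) _.
rewrite normrN; move: h1 dphia; lra.
Unshelve. all: by end_near. Qed.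

Lemma lim_lin_rate (phi : R -> R) (C : R) :
  (forall h k, h != 0 -> k != 0 -> `|phi h - phi k| <= C * (`|h| + `|k|)) ->
  exists l, forall h, h != 0 -> `|phi h - l| <= C * `|h|.
Proof.
move=> H.
have C0 : 0 <= C.
  have := H 1 1 (oner_neq0 _) (oner_neq0 _); rewrite subrr normr0 normr1.
  by rewrite pmulr_lge0 // addr_gt0.
have cau : cauchy (phi @ 0^').
  apply/cauchy_ballP => e e0; rewrite /= near_map2.
  pose r := e / (2 * (C + 1)).
  have r0 : 0 < r by rewrite divr_gt0 // mulr_gt0 // ltr_wpDl.
  have D : \forall h \near (0 : R)^', h != 0 /\ `|h| < r.
    near=> h; split; first by near: h; exact: nbhs_dnbhs_neq.
    by near: h; exact: dnbhs0_lt.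
  exists (fun h => h != 0 /\ `|h| < r, fun h => h != 0 /\ `|h| < r) => //=.
  move=> [h k] /= [[h0 hr] [k0 kr]]; rewrite /ball /=.
  apply: le_lt_trans (H _ _ h0 k0) _.
  apply: le_lt_trans (ler_wpM2l C0 (ltW (ltrD hr kr))) _.
  rewrite /r; have -> : C * (e / (2 * (C + 1)) + e / (2 * (C + 1))) = e * (C / (C + 1)).
    by field; rewrite gt_eqF // ltr_wpDl.
  by rewrite gtr_pMr // ltr_pdivrMr ?mul1r ?ltrDl // ltr_wpDl.
have /cvg_ex[l hl] : cvg (phi @ 0^') by exact: cauchy_cvg.
exists l => h h0; apply/ler_addgt0Pr => e e0.
have e2 : 0 < e / 2 by rewrite divr_gt0.
have : \forall k \near (0 : R)^', `|phi h - l| <= C * `|h| + e.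
  near=> k.
  have k0 : k != 0 by near: k; exact: nbhs_dnbhs_neq.
  have : `|l - phi k| < e / 2 by near: k; move/cvgrPdist_lt : hl; apply.
  have : `|k| < e / (2 * (C + 1)).
    by near: k; apply: dnbhs0_lt; rewrite divr_gt0 // mulr_gt0 // ltr_wpDl.
  rewrite ltr_pdivlMr ?mulr_gt0 // ?ltr_wpDl // => h1 h2.
  have := H h k h0 k0; rewrite mulrDr => h3.
  have -> : phi h - l = (phi h - phi k) - (l - phi k) by ring.
  apply: le_trans (ler_normB _ _) _.
  have : C * `|k| <= e / 2.
    have := normr_ge0 k; nra.
  by move: h3 h2; lra.
move=> /filter_ex [_]; exact.
Unshelve. all: by end_near. Qed.

End OneVariable.

Lemma cvg_sumr (R : realType) (T I : Type) (F : set_system T) {FF : Filter F}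
    (r : seq I) (f : I -> T -> R) (a : I -> R) :
  (forall i, f i x @[x --> F] --> a i) ->
  \sum_(i <- r) f i x @[x --> F] --> \sum_(i <- r) a i.
Proof. by move=> fa; apply: cvg_big => // p; exact: add_continuous. Qed.

Lemma powR_step (R : realType) (y q : R) : 0 < y -> y `^ q = y * y `^ (q - 1).
Proof.
move=> y0; rewrite -{2}[y]powRr1 ?ltW // -powRD; first by congr powR; ring.
by rewrite (gt_eqF y0) implybT.
Qed.

Section DirectionLinear.
Variables (R : realType) (V : normedModType R).
Implicit Types (f : V -> R) (p u v : V).

Lemma isd_scale_dir f p v (c d : R) : is_derive p v f d ->
  is_derive p (c *: v) f (c * d).
Proof.
move=> fd; rewrite -[p]addr0 -(scale0r (c *: v)); apply/isd_line.
under eq_fun do rewrite scalerA.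
rewrite mulrC; apply: (@isd_comp _ (fun s => f (p + s *: v)) (fun t => t * c)).
  by apply: isd_eq (isdM (isd_id 0) (isd_cst _ _ c)) _; rewrite mul0r add0r mulr1.
by apply/isd_line; rewrite mul0r scale0r addr0.
Qed.

(** Continuity of one of the two derivatives makes the directional derivative
   additive: the increment along [u] is compared with its linear part by the
   mean value theorem on the segment starting at the point displaced along
   [v]. *)
Lemma isd_add_dir f p u v (fu : V -> R) (d : R) :
  (\forall q \near p, is_derive q u f (fu q)) -> {for p, continuous fu} ->
  is_derive p v f d -> is_derive p (u + v) f (fu p + d).
Proof.
move=> fud fuc fv; apply/isdP/cvgrPdist_lt => e e0.
have e4 : 0 < e / 4 by rewrite divr_gt0.
have : \forall q \near p, is_derive q u f (fu q) /\ `|fu p - fu q| < e / 4.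
  near=> q; split; first by near: q.
  by near: q; move/cvgrPdist_lt : fuc; apply.
move=> /nbhs_normP[r /= r0 H].
near=> h.
have h0 : h != 0 by near: h; exact: nbhs_dnbhs_neq.
have hr : `|h| < r / (`|u| + `|v| + 1).
  by near: h; apply: dnbhs0_lt; rewrite divr_gt0 // ltr_wpDl // addr_ge0.
have {}hr : `|h| * (`|u| + `|v|) < r.
  move: hr; rewrite ltr_pdivlMr ?ltr_wpDl ?addr_ge0 //.
  by apply: le_lt_trans; rewrite ler_wpM2l // lerDl.
have fvh : `|d - h^-1 * (f (h *: v + p) - f p)| < e / 4.
  by near: h; move/isdP/cvgrPdist_lt : fv; apply.
have B s : Num.min 0 h <= s <= Num.max 0 h ->
    is_derive (h *: v + p + s *: u) u f (fu (h *: v + p + s *: u)) /\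
    `|fu p - fu (h *: v + p + s *: u)| < e / 4.
  move=> sh; apply: H => /=.
  have -> : p - (h *: v + p + s *: u) = - (h *: v + s *: u).
    by rewrite [h *: v + p]addrC -addrA opprD addrA subrr add0r.
  rewrite normrN; apply: le_lt_trans hr; apply: le_trans (ler_normD _ _) _.
  rewrite !normrZ addrC mulrDr lerD // ler_wpM2r //.
  move: sh; case: (leP 0 h) => hh /andP[s1 s2].
    by rewrite !ger0_norm.
  by rewrite !ler0_norm ?(ltW hh) // lerN2.
have M : `|(f (h *: v + p + h *: u) - h * fu p) - (f (h *: v + p + 0 *: u) - 0 * fu p)|
     <= e / 4 * `|h - 0|.
  apply: (mvt_dist (f := fun s => f (h *: v + p + s *: u) - s * fu p)
     (df := fun s => fu (h *: v + p + s *: u) - (s * 0 + fu p * 1))).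
    move=> s /B[sd _]; apply: isdB; first exact/isd_line.
    exact: (isdM (isd_id s) (isd_cst _ _ _)).
  by move=> s /B[_ /ltW]; rewrite mulr0 add0r mulr1 distrC.
have -> : h *: (u + v) + p = h *: v + p + h *: u.
  by rewrite scalerDr -addrA addrC.
move: M; rewrite subr0 scale0r addr0 mul0r subr0 => M.
have {M} : `|h^-1 * (f (h *: v + p + h *: u) - h * fu p - f (h *: v + p))| <= e / 4.
  by rewrite normrM normfV mulrC ler_pdivrMr ?normr_gt0.
rewrite !mulrBr mulKf //.
move: fvh; rewrite mulrBr !ltr_norml ler_norml.
move: (h^-1 * f (h *: v + p + h *: u)) (h^-1 * f (h *: v + p)) (h^-1 * f p) => A B' C.
move=> /andP[? ?] /andP[? ?]; apply/andP; split; lra.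
Unshelve. all: by end_near. Qed.

Lemma isd_comb_dir (I : Type) (r : seq I) f p (e : I -> V) (c : I -> R)
    (df : I -> V -> R) :
  (forall i, \forall q \near p, is_derive q (e i) f (df i q)) ->
  (forall i, {for p, continuous (df i)}) ->
  is_derive p (\sum_(i <- r) c i *: e i) f (\sum_(i <- r) c i * df i p).
Proof.
move=> fd fc; elim: r => [|i r ih].
  by rewrite !big_nil; exact: is_derive0.
rewrite !big_cons; apply: (isd_add_dir (fu := fun q => c i * df i q)) ih.
  by near=> q; apply: isd_scale_dir; near: q; exact: fd.
by apply: cvgM; [exact: cvg_cst|exact: fc].
Unshelve. all: by end_near. Qed.

End DirectionLinear.

Section HalfSpaceBasics.
Variables (R : realType) (n : nat).
Local Notation V := ('rV[R]_n * R)%type.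
Local Notation ex := (@ex R n).
Local Notation ey := (@ey R n).
Implicit Types (f g : V -> R) (p q : V).

Lemma isd_ey f (x : 'rV[R]_n) (t d : R) :
  is_derive t (1 : R) (fun s => f (x, s)) d <-> is_derive (x, t) ey f d.
Proof.
have E s : (x, 0) + s *: ey = (x, s).
  by congr pair; rewrite /= ?scaler0 ?addr0 // add0r [_ *: _]mulr1.
have := isd_line f (x, 0) ey t d; rewrite E.
by under eq_fun do rewrite E.
Qed.

Lemma near_half_space p : 0 < p.2 -> \forall q \near p, 0 < q.2.
Proof.
move=> p0; have c : (fun q : V => q.2) @ p --> p.2 by exact: cvg_snd.
by move/cvgr_gt : c; apply.
Qed.

Lemma closed_contP f : {within @closed_half_space R n, continuous f} <->
  forall p, 0 <= p.2 -> forall e : R, 0 < e ->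
    \forall q \near p, 0 <= q.2 -> `|f p - f q| < e.
Proof.
split.
  move=> /subspace_continuousP fc p p0 e e0.
  by have /cvgrPdist_lt /(_ _ e0) := fc p p0; rewrite near_withinE.
move=> H; apply/subspace_continuousP => p p0; apply/cvgrPdist_lt => e e0.
by rewrite near_withinE; exact: H.
Qed.

Lemma closed_cont_interior f p : {within @closed_half_space R n, continuous f} ->
  0 < p.2 -> {for p, continuous f}.
Proof.
move=> /closed_contP fc p0; apply/cvgrPdist_lt => e e0.
near=> q; have q0 : 0 <= q.2 by rewrite ltW //; near: q; exact: near_half_space.
by move: q0; near: q; apply: fc => //; exact: ltW.
Unshelve. all: by end_near. Qed.

Lemma closed_cont_approx f :
  (forall p (e : R), 0 <= p.2 -> 0 < e -> exists g,
     {within @closed_half_space R n, continuous g} /\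
     \forall q \near p, 0 <= q.2 -> `|f q - g q| <= e) ->
  {within @closed_half_space R n, continuous f}.
Proof.
move=> H; apply/closed_contP => p p0 e e0.
have e4 : 0 < e / 4 by rewrite divr_gt0.
have [g [/closed_contP gc fg]] := H p _ p0 e4.
near=> q => q0.
have h1 : `|f p - g p| <= e / 4 by exact: (nbhs_singleton fg).
have h2 : `|f q - g q| <= e / 4 by move: q0; near: q.
have h3 : `|g p - g q| < e / 4 by move: q0; near: q; exact: gc.
have -> : f p - f q = (f p - g p) + (g p - g q) - (f q - g q) by ring.
apply: le_lt_trans (ler_normB _ _) _.
apply: le_lt_trans (lerD (ler_normD _ _) (lexx _)) _; lra.
Unshelve. all: by end_near. Qed.

Lemma cont_closed f : continuous f -> {within @closed_half_space R n, continuous f}.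
Proof. exact: continuous_subspaceT. Qed.

Lemma closed_contD f g : {within @closed_half_space R n, continuous f} ->
  {within @closed_half_space R n, continuous g} ->
  {within @closed_half_space R n, continuous (fun q => f q + g q)}.
Proof. by move=> fc gc p; exact: (continuousD (fc p) (gc p)). Qed.

Lemma closed_contM f g : {within @closed_half_space R n, continuous f} ->
  {within @closed_half_space R n, continuous g} ->
  {within @closed_half_space R n, continuous (fun q => f q * g q)}.
Proof. by move=> fc gc p; exact: (continuousM (fc p) (gc p)). Qed.

Lemma closed_contZ f (c : R) : {within @closed_half_space R n, continuous f} ->
  {within @closed_half_space R n, continuous (fun q => c * f q)}.
Proof. by apply: closed_contM; apply: cont_closed; exact: cst_continuous. Qed.

Lemma cont_snd_exp (k : nat) : continuous (fun q : V => q.2 ^+ k).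
Proof.
by move=> q; apply: (@continuous_comp _ _ _ snd (fun t : R => t ^+ k));
  [exact: cvg_snd|exact: exprn_continuous].
Qed.

Lemma isd_coord p (v : V) j : is_derive p v (fun q : V => q.1 ord0 j) (v.1 ord0 j).
Proof.
apply/isdP; apply: cvg_near_cst; near=> h.
have h0 : h != 0 by near: h; exact: nbhs_dnbhs_neq.
by rewrite /= !mxE addrK mulKf.
Unshelve. all: by end_near. Qed.

Lemma isd_snd p (v : V) : is_derive p v (fun q : V => q.2) v.2.
Proof.
apply/isdP; apply: cvg_near_cst; near=> h.
have h0 : h != 0 by near: h; exact: nbhs_dnbhs_neq.
by rewrite /= addrK [_ *: _]/(_ * _) mulKf.
Unshelve. all: by end_near. Qed.

Lemma isd_snd_comp (phi : R -> R) p (v : V) (d : R) : is_derive p.2 (1 : R) phi d ->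
  is_derive p v (fun q : V => phi q.2) (d * v.2).
Proof.
move=> phid; rewrite -[p]addr0 -(scale0r v); apply/isd_line.
apply: (@isd_comp _ phi (fun t : R => (p + t *: v).2)).
  have := isd_snd p v; rewrite -{1}[p]addr0 -(scale0r v) => /isd_line; exact.
by rewrite scale0r addr0.
Qed.

Lemma closed_cont_powR (r : R) : 0 < r ->
  {within @closed_half_space R n, continuous (fun q : V => q.2 `^ r)}.
Proof.
move=> r0; apply/closed_contP => p; rewrite le_eqVlt => /predU1P[p0|p0] e e0.
  rewrite -p0 powR0 ?gt_eqF //; near=> q => q0.
  rewrite sub0r normrN ger0_norm ?powR_ge0 //.
  have -> : e = (e `^ r^-1) `^ r by rewrite -powRrM mulVf ?gt_eqF // powRr1 // ltW.
  apply: gt0_ltr_powR => //; rewrite ?nnegrE ?powR_ge0 //.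
  near: q; have c : (fun q : V => q.2) @ p --> p.2 by exact: cvg_snd.
  by move/cvgr_lt : c; apply; rewrite -p0 powR_gt0.
have : (fun q : V => q.2 `^ r) @ p --> p.2 `^ r.
  apply: (@continuous_comp _ _ _ snd (fun t : R => t `^ r)); first exact: cvg_snd.
  exact: isd_cont (isd_powR r p0).
by move=> /cvgrPdist_lt /(_ _ e0); apply: filterS.
Unshelve. all: by end_near. Qed.

Lemma shift_exE p (h : R) i : (h *: ex i + p).2 = p.2.
Proof. by rewrite /= scaler0 add0r. Qed.

Lemma shift_exE' p (h : R) i : (p + h *: ex i).2 = p.2.
Proof. by rewrite /= scaler0 addr0. Qed.

(** A direction is a combination of the axes, which are added one at a time; each
   addition uses the continuity of the partial derivative that is added. *)
Lemma isd_all_dir f (fx : 'I_n -> V -> R) (fy : V -> R) :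
  (forall i p, 0 < p.2 -> is_derive p (ex i) f (fx i p)) ->
  (forall p, 0 < p.2 -> is_derive p ey f (fy p)) ->
  (forall i p, 0 < p.2 -> {for p, continuous (fx i)}) ->
  forall p (v : V), 0 < p.2 ->
  is_derive p v f (\sum_i v.1 ord0 i * fx i p + v.2 * fy p).
Proof.
move=> dx dy cx p v p0.
have E : v = \sum_i v.1 ord0 i *: ex i + v.2 *: ey.
  case: v => w c /=; have -> : \sum_i w ord0 i *: ex i = (w, 0).
    rewrite [in RHS](row_sum_delta w).
    elim/big_ind2 : _ => // [a b c' d -> ->|i _]; last first.
      by congr pair; rewrite /= scaler0.
    by congr pair; rewrite /= addr0.
  by congr pair; rewrite /= ?scaler0 ?addr0 // add0r [_ *: _]mulr1.
rewrite {1}E; apply: (@isd_add_dir _ _ _ _ _ _ (fun q => \sum_i v.1 ord0 i * fx i q)).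
- near=> q; have q0 : 0 < q.2 by near: q; exact: near_half_space.
  apply: isd_comb_dir => i; last exact: cx.
  by near=> q'; apply: dx; near: q'; exact: near_half_space.
- by apply: cvg_sumr => i; apply: cvgM; [exact: cvg_cst|exact: cx].
- exact/isd_scale_dir/dy.
Unshelve. all: by end_near. Qed.

End HalfSpaceBasics.

(** * The maximum principle *)

Lemma second_derivative_at_max (R : realType) (phi dphi : R -> R) (r d : R) :
  0 < r -> (forall t, `|t| < r -> is_derive t (1 : R) phi (dphi t)) ->
  is_derive (0 : R) (1 : R) dphi d -> (forall t, `|t| < r -> phi t <= phi 0) ->
  dphi 0 = 0 /\ d <= 0.
Proof.
move=> r0 phid dphid mx.
have in_r t : t \in `](- r), r[%R -> `|t| < r.
  by rewrite in_itv /= ltr_norml.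
have d0 : dphi 0 = 0.
  apply: (isd_uniq (phid 0 _)); first by rewrite normr0.
  apply: (@derive1_at_max _ phi (- r) r).
  - lra.
  - by move=> t /in_r /phid /isd_derivable.
  - by rewrite in_itv /=; lra.
  - by move=> t /in_r; exact: mx.
split=> //; rewrite leNgt; apply/negP => dgt0.
have pos : \forall h \near (0 : R)^', 0 < h^-1 * (dphi h).
  move/isdP : dphid => /cvgr_gt /(_ _ dgt0); apply: filterS => h.
  by rewrite addr0 [h *: 1]mulr1 d0 subr0.
have : \forall h \near (0 : R)^', `|h| < r -> 0 < h^-1 * (dphi h).
  by apply: filterS pos.
rewrite near_withinE => /nbhs_ballP[s /= s0 H].
pose h := Num.min s r / 2.
have sr : 0 < Num.min s r by rewrite lt_min s0 r0.
have h0 : 0 < h by rewrite divr_gt0.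
have ms : Num.min s r <= s by rewrite ge_min lexx.
have mr : Num.min s r <= r by rewrite ge_min lexx orbT.
have hs : h < s by rewrite /h; lra.
have hr : h < r by rewrite /h; lra.
have [|c /andP[c0 ch] eqc] := @mvt R phi dphi 0 h h0.
  by move=> t /andP[t0 th]; apply: phid; rewrite ger0_norm //; exact: le_lt_trans hr.
have cr : `|c| < r by rewrite gtr0_norm //; exact: lt_trans hr.
have dc : 0 < dphi c.
  have : 0 < c^-1 * dphi c.
    apply: H => //=; last by rewrite gt_eqF.
    by rewrite /ball /= sub0r normrN gtr0_norm //; exact: lt_trans hs.
  by rewrite pmulr_rgt0 // invr_gt0.
have : phi h <= phi 0 by apply: mx; rewrite gtr0_norm.
rewrite -subr_le0 eqc subr0 leNgt mulr_gt0 //.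
Qed.

Section MaximumPrinciple.
Variables (R : realType) (n : nat) (gamma : R).
Local Notation V := ('rV[R]_n * R)%type.
Local Notation ex := (@ex R n).
Local Notation ey := (@ey R n).
Local Notation a := (1 - 2 * gamma).
Implicit Types (p q : V) (W : V -> R).

(** Bounded solutions of the degenerate equation, with no joint regularity in
   the interior: the second derivatives along the axes suffice for the maximum
   principle, and this class is closed under translations and differences. *)
Definition bounded_solution (W : V -> R) : Prop :=
  [/\ {within @closed_half_space R n, continuous W},
      exists M, forall p, 0 <= p.2 -> `|W p| <= M
    & exists (Wx Wxx : 'I_n -> V -> R) (Wy Wyy : V -> R),
      forall p, 0 < p.2 ->
      [/\ forall i, is_derive p (ex i) W (Wx i p) /\
                    is_derive p (ex i) (Wx i) (Wxx i p),
          is_derive p ey W (Wy p), is_derive p ey Wy (Wyy p)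
        & \sum_i Wxx i p + a / p.2 * Wy p + Wyy p = 0]].

Lemma isd_shift (f : V -> R) p v w d :
  is_derive (p + w) v f d -> is_derive p v (fun q => f (q + w)) d.
Proof. by move=> /isdP H; apply/isdP; under eq_fun do rewrite -addrA. Qed.

Lemma closed_cont_shift (f : V -> R) (w : 'rV[R]_n) :
  {within @closed_half_space R n, continuous f} ->
  {within @closed_half_space R n, continuous (fun q => f (q + (w, 0)))}.
Proof.
move=> /closed_contP fc; apply/closed_contP => p p0 e e0.
have pw0 : 0 <= (p + (w, 0)).2 by rewrite /= addr0.
have E : p + (w, 0) - p = (w, 0) by rewrite addrC addKr.
have := fc _ pw0 _ e0; rewrite (near_shift p) E.
by apply: filterS => q /= H q0; apply: H; rewrite addr0.
Qed.

Lemma bounded_solution_lin (c : R) W1 W2 :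
  bounded_solution W1 -> bounded_solution W2 ->
  bounded_solution (fun p => c * W1 p + W2 p).
Proof.
move=> [c1 [M1 b1] [X1 [XX1 [Y1 [YY1 s1]]]]] [c2 [M2 b2] [X2 [XX2 [Y2 [YY2 s2]]]]].
split; first by apply: closed_contD => //; exact: closed_contZ.
  exists (`|c| * M1 + M2) => p p0; apply: le_trans (ler_normD _ _) _.
  by rewrite lerD ?b2 // normrM ler_wpM2l ?b1.
exists (fun i p => c * X1 i p + X2 i p), (fun i p => c * XX1 i p + XX2 i p),
  (fun p => c * Y1 p + Y2 p), (fun p => c * YY1 p + YY2 p) => p p0.
have [x1 y1 yy1 e1] := s1 p p0; have [x2 y2 yy2 e2] := s2 p p0.
split.
- move=> i; have [? ?] := x1 i; have [? ?] := x2 i.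
  by split; apply: isdD => //; exact: isdZ.
- by apply: isdD => //; exact: isdZ.
- by apply: isdD => //; exact: isdZ.
- rewrite big_split /= -mulr_sumr; transitivity
    (c * (\sum_i XX1 i p + a / p.2 * Y1 p + YY1 p) +
     (\sum_i XX2 i p + a / p.2 * Y2 p + YY2 p)); first by ring.
  by rewrite e1 e2 mulr0 addr0.
Qed.

Lemma bounded_solutionZ (c : R) W :
  bounded_solution W -> bounded_solution (fun p => c * W p).
Proof.
move=> sW; have := bounded_solution_lin (c - 1) sW sW.
by congr bounded_solution; apply/funext => p; ring.
Qed.

Lemma bounded_solution_shift (w : 'rV[R]_n) W :
  bounded_solution W -> bounded_solution (fun p => W (p + (w, 0))).
Proof.
move=> [c1 [M1 b1] [X1 [XX1 [Y1 [YY1 s1]]]]].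
split; first exact: closed_cont_shift.
  by exists M1 => p p0; apply: b1; rewrite /= addr0.
exists (fun i p => X1 i (p + (w, 0))), (fun i p => XX1 i (p + (w, 0))),
  (fun p => Y1 (p + (w, 0))), (fun p => YY1 (p + (w, 0))) => p p0.
have pw0 : 0 < (p + (w, 0)).2 by rewrite /= addr0.
have [x1 y1 yy1 e1] := s1 _ pw0.
split.
- by move=> i; have [? ?] := x1 i; split; exact: isd_shift.
- exact: isd_shift.
- exact: isd_shift.
- by rewrite -[RHS]e1 /= addr0.
Qed.

Section Barrier.
Hypotheses (gamma_gt0 : 0 < gamma) (gamma_neq1 : gamma != 1).

(* Chosen so that the barrier below is a strict supersolution; it is negative
   when gamma > 1. *)
Local Notation D := ((2 * n%:R + 1) / (4 - 4 * gamma)).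

(* Nonnegative where |x_i| and y are at most 1/r: the homogeneous solution y^(2 gamma)
   compensates the term in [D] when gamma < 1. *)
Let barrier (r : R) (p : V) : R :=
  r ^+ 2 * (\sum_i p.1 ord0 i ^+ 2 - D * p.2 ^+ 2) +
  (1 + `|D|) * (r `^ (2 * gamma) * p.2 `^ (2 * gamma)).

Local Lemma barrier_ge (r : R) p : 0 < r -> 0 <= p.2 -> r * p.2 <= 1 ->
  r ^+ 2 * (\sum_i p.1 ord0 i ^+ 2) + (r * p.2) `^ (2 * gamma) <= barrier r p.
Proof.
move=> r0 p0 rp1; rewrite /barrier -powRM ?(ltW r0) //.
have rp0 : 0 <= r * p.2 by rewrite mulr_ge0 ?(ltW r0).
set Y := (r * p.2) `^ _; have Y0 : 0 <= Y by rewrite powR_ge0.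
have : D * (r * p.2) ^+ 2 <= `|D| * Y.
  have [g1|g1] := ltP gamma 1.
    have D0 : 0 <= D by apply: divr_ge0; [rewrite addr_ge0 ?mulr_ge0|lra].
    rewrite ger0_norm //; apply: ler_wpM2l => //.
    rewrite /Y -powR_mulrn //.
    have [->|/eqP rpn0] := eqVneq (r * p.2) 0.
      by rewrite !powR0 // mulf_neq0 // gt_eqF.
    by apply: ger_powR; rewrite ?rp1 ?andbT ?lt_neqAle ?rp0 ?andbT; [rewrite eq_sym; apply/eqP|lra].
  apply: (@le_trans _ _ 0); last by rewrite mulr_ge0.
  apply: mulr_le0_ge0; last exact: sqr_ge0.
  apply: mulr_ge0_le0; [by rewrite addr_ge0 ?mulr_ge0|].
  by rewrite invr_le0 subr_le0 ler_pMr.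
rewrite exprMn; move: D => d H; rewrite mulrBr mulrDl mul1r; move: H.
by rewrite mulrCA; lra.
Qed.

(** On the faces |x_i| = 1/r and y = 1/r the barrier is at least 1, and [M] times
   it dominates [W] there. *)
Local Lemma cube_bound W (M r eps : R) : bounded_solution W ->
  (forall p, 0 <= p.2 -> `|W p| <= M) -> 0 < M -> 0 < r -> 0 <= eps ->
  (forall x, W (x, 0) <= eps) ->
  forall p, (forall i, r * `|p.1 ord0 i| <= 1) -> 0 <= p.2 -> r * p.2 <= 1 ->
  W p <= eps + M * barrier r p.
Proof.
move=> [Wc _ [Wx [Wxx [Wy [Wyy Ws]]]]] WM M0 r0 eps0 Wb p px py pry.
pose K : set V := [set v : 'rV[R]_n | forall i, `[- r^-1, r^-1]%classic (v ord0 i)]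
  `*` `[0, r^-1]%classic.
have KP (q : V) : K q <-> (forall i, r * `|q.1 ord0 i| <= 1) /\ 0 <= q.2 /\ r * q.2 <= 1.
  rewrite /K /=; split.
    move=> [q1 q2]; split.
      move=> i; have := q1 i; rewrite /= in_itv /= => qi.
      by rewrite mulrC -ler_pdivlMr // mul1r ler_norml.
    move: q2; rewrite in_itv /= => /andP[-> q2]; split=> //.
    by rewrite mulrC -ler_pdivlMr // mul1r.
  move=> [q1 [q2 q3]]; split.
    move=> i; rewrite /= in_itv /= -ler_norml.
    by have := q1 i; rewrite mulrC -ler_pdivlMr // mul1r.
  by rewrite /= in_itv /= q2 /= -[r^-1]mul1r ler_pdivlMr // mulrC.
have Kp : K p by apply/KP.
have Kc : compact K.
  apply: compact_setX; last exact: segment_compact.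
  apply: (@rV_compact _ _ (fun=> `[- r^-1, r^-1]%classic)) => i.
  exact: segment_compact.
pose w q := W q - M * barrier r q.
have sqc i : continuous (fun q : V => q.1 ord0 i ^+ 2).
  move=> q; apply: (@continuous_comp _ _ _ (fun q : V => q.1 ord0 i) (fun t : R => t ^+ 2)).
    apply: (@continuous_comp _ _ _ fst (fun v : 'rV[R]_n => v ord0 i)).
      exact: cvg_fst.
    exact: coord_continuous.
  exact: exprn_continuous.
have wc : {within @closed_half_space R n, continuous w}.
  have -> : w = (fun q => W q + (- M) * barrier r q).
    by apply/funext => q; rewrite /w mulNr.
  apply: closed_contD => //; apply: closed_contZ; apply: closed_contD.
    apply: closed_contZ; apply: cont_closed => q; apply: cvgB.
      by apply: cvg_sumr => i; exact: sqc.
    by apply: cvgM; [exact: cvg_cst|exact: cont_snd_exp].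
  by apply: closed_contZ; apply: closed_contZ; apply: closed_cont_powR; rewrite mulr_gt0.
have wK : {within K, continuous w}.
  by apply: continuous_subspaceW wc => q /KP[_ []].
have [c /set_mem Kc0 cmax] := compact_EVT_max (ex_intro _ p Kp) Kc wK.
rewrite -lerBlDr; apply: (@le_trans _ _ (w c)); first exact/cmax/mem_set.
move/KP : Kc0 => [c1 [c2 c3]].
have bge := barrier_ge r0 c2 c3.
have S0 : 0 <= r ^+ 2 * \sum_i c.1 ord0 i ^+ 2.
  by rewrite mulr_ge0 ?sqr_ge0 // sumr_ge0 // => i _; exact: sqr_ge0.
have Y0 : 0 <= (r * c.2) `^ (2 * gamma) by exact: powR_ge0.
have lateral : 1 <= barrier r c -> w c <= eps.
  move=> b1; rewrite /w; apply: le_trans eps0.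
  rewrite subr_le0; apply: (@le_trans _ _ M).
    by apply: le_trans (ler_norm _) _; exact: WM.
  by rewrite ler_peMr // ltW.
have [c20|c2n0] := eqVneq c.2 0.
  have -> : w c = W (c.1, 0) - M * barrier r c by rewrite /w -c20; case: (c).
  apply: (le_trans _ (Wb c.1)); rewrite lerBlDr lerDl mulr_ge0 ?(ltW M0) //.
  by apply: le_trans bge; rewrite addr_ge0.
have {c2n0}c20 : 0 < c.2 by rewrite lt_neqAle eq_sym c2n0.
have [rc21|rc2n1] := eqVneq (r * c.2) 1.
  by apply: lateral; apply: le_trans bge; rewrite rc21 powR1 lerDr.
have {c3 rc2n1}c3 : r * c.2 < 1 by rewrite lt_neqAle rc2n1.
have [/existsP[i /eqP ci]|/existsPn cn] :=
    boolP [exists i, r * `|c.1 ord0 i| == 1].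
  apply: lateral; apply: le_trans bge; rewrite (bigD1 i) //= mulrDr.
  rewrite -addrA -(real_normK (num_real (c.1 ord0 i))) -exprMn ci expr1n lerDl.
  by rewrite addr_ge0 // mulr_ge0 ?sqr_ge0 // sumr_ge0 // => j _; exact: sqr_ge0.
have {cn}c1' i : r * `|c.1 ord0 i| < 1 by rewrite lt_neqAle cn c1.
pose s := r `^ (2 * gamma).
(* At an interior maximum the second derivatives along the axes are bounded by
   those of the barrier, a strict supersolution. *)
have xx i : Wxx i c <= M * (r ^+ 2 * 2).
  have rho0 : 0 < r^-1 - `|c.1 ord0 i|.
    by rewrite subr_gt0 -[r^-1]mul1r ltr_pdivlMr // mulrC.
  have dB q : 0 < q.2 -> is_derive q (ex i) (barrier r) (r ^+ 2 * (2 * q.1 ord0 i)).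
    move=> q0.
    have dS := isd_sum (index_enum _) (fun j => isdM (isd_coord q (ex i) j) (isd_coord q (ex i) j)).
    have dP := isd_snd_comp (ex i) (isd_powR (2 * gamma) q0).
    have dY := isd_snd_comp (ex i) (isd_exprn 2 q.2).
    apply: isd_eq (isdD (isdZ (r ^+ 2) (isdB dS (isdZ D dY)))
      (isdZ (1 + `|D|) (isdZ (r `^ (2 * gamma)) dP))) _.
    rewrite /= !mulr0 subr0 addr0 (bigD1 i) //= mxE !eqxx big1 => [|j ji].
      by rewrite /=; ring.
    by rewrite mxE eqxx (negbTE ji) !mulr0 addr0.
  have [] // := @second_derivative_at_max R (fun t => w (c + t *: ex i))
    (fun t => Wx i (c + t *: ex i) - M * (r ^+ 2 * (2 * (c + t *: ex i).1 ord0 i)))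
    (r^-1 - `|c.1 ord0 i|) (Wxx i c - M * (r ^+ 2 * (2 * 1))) rho0.
  - move=> t _; apply/isd_line.
    have ct0 : 0 < (c + t *: ex i).2 by rewrite shift_exE'.
    have [/(_ i)[Wd _] _ _ _] := Ws _ ct0.
    by apply: isdB => //; apply: isdZ; exact: dB.
  - have Wd2 : is_derive c (ex i) (Wx i) (Wxx i c).
      by have [/(_ i)[_ Wd] _ _ _] := Ws _ c20.
    have cd : is_derive c (ex i) (fun q : V => q.1 ord0 i) 1.
      by apply: isd_eq (isd_coord c (ex i) i) _; rewrite mxE !eqxx.
    apply: isdB; first exact: isd_line0.
    by apply: isdZ; apply: isdZ; apply: isdZ; exact: isd_line0.
  - move=> t ht; rewrite scale0r addr0; apply: cmax; apply/mem_set/KP.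
    split=> [j|]; last by rewrite shift_exE' ltW // ltW.
    rewrite !mxE eqxx /= eq_sym; have [->|ji] := eqVneq j i; last first.
      by rewrite mulr0 addr0 ltW.
    rewrite mulr1 mulrC -ler_pdivlMr // mul1r (le_trans (ler_normD _ _)) //.
    by move: ht; lra.
  - by move=> _; rewrite mulr1 subr_le0.
have [yeq yy] : Wy c = M * (r ^+ 2 * - (D * (2 * c.2)) +
       (1 + `|D|) * (s * (2 * gamma * c.2 `^ (2 * gamma - 1)))) /\
    Wyy c <= M * (r ^+ 2 * - (D * 2) +
       (1 + `|D|) * (s * (2 * gamma * ((2 * gamma - 1) * c.2 `^ (2 * gamma - 1 - 1))))).
  pose E := fun (y : R) => r ^+ 2 * - (D * (2 * y)) +
       (1 + `|D|) * (s * (2 * gamma * y `^ (2 * gamma - 1))).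
  have dB q : 0 < q.2 -> is_derive q ey (barrier r) (E q.2).
    move=> q0.
    have dS := isd_sum (index_enum _) (fun j => isdM (isd_coord q ey j) (isd_coord q ey j)).
    have dP := isd_snd_comp ey (isd_powR (2 * gamma) q0).
    have dY := isd_snd_comp ey (isd_exprn 2 q.2).
    apply: isd_eq (isdD (isdZ (r ^+ 2) (isdB dS (isdZ D dY)))
      (isdZ (1 + `|D|) (isdZ (r `^ (2 * gamma)) dP))) _.
    rewrite /= big1 => [|j _]; last by rewrite !mxE !mulr0 addr0.
    by rewrite !mulr1 sub0r /E /s.
  have dE : is_derive c ey (fun q => E q.2) (r ^+ 2 * - (D * 2) +
       (1 + `|D|) * (s * (2 * gamma * ((2 * gamma - 1) * c.2 `^ (2 * gamma - 1 - 1))))).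
    apply: isd_eq (isd_snd_comp ey (isdD (isdZ (r ^+ 2) (isdN (isdZ D (isdZ 2 (isd_id c.2)))))
      (isdZ (1 + `|D|) (isdZ s (isdZ (2 * gamma) (isd_powR (2 * gamma - 1) c20)))))) _.
    by rewrite /= !mulr1.
  pose rho := Num.min c.2 (r^-1 - c.2).
  have rho0 : 0 < rho.
    by rewrite lt_min c20 subr_gt0 -[r^-1]mul1r ltr_pdivlMr // mulrC.
  have rho1 : rho <= c.2 by rewrite ge_min lexx.
  have rho2 : rho <= r^-1 - c.2 by rewrite ge_min lexx orbT.
  have ct t : (c + t *: ey).2 = c.2 + t by rewrite /= [_ *: _]mulr1.
  have [] // := @second_derivative_at_max R (fun t => w (c + t *: ey))
    (fun t => Wy (c + t *: ey) - M * E (c + t *: ey).2) rho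
    (Wyy c - M * (r ^+ 2 * - (D * 2) +
       (1 + `|D|) * (s * (2 * gamma * ((2 * gamma - 1) * c.2 `^ (2 * gamma - 1 - 1)))))) rho0.
  - move=> t ht; apply/isd_line.
    have ct0 : 0 < (c + t *: ey).2 by rewrite ct; move: ht; rewrite ltr_norml; lra.
    have [_ Wd _ _] := Ws _ ct0.
    by apply: isdB => //; apply: isdZ; exact: dB.
  - have [_ _ Wd2 _] := Ws _ c20.
    apply: isdB; first exact: isd_line0.
    by apply: isdZ; exact: isd_line0 dE.
  - move=> t ht; rewrite scale0r addr0; apply: cmax; apply/mem_set/KP.
    split=> [j|]; first by rewrite !mxE mulr0 addr0 ltW.
    move: ht; rewrite ct ltr_norml => ht; split; first by lra.
    by rewrite mulrC -ler_pdivlMr // mul1r; lra.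
  - rewrite scale0r addr0 => /eqP; rewrite subr_eq0 => /eqP -> h2.
    by split=> //; rewrite -subr_le0.
have [_ _ _ eqc] := Ws _ c20.
have : \sum_i Wxx i c <= \sum_(i < n) (M * (r ^+ 2 * 2)) by apply: ler_sum => i _.
rewrite sumr_const card_ord -(mulr_natr _ n) => sx.
move: eqc yy sx; rewrite yeq => eqc yy sx.
have c2n0 : c.2 != 0 by rewrite gt_eqF.
have g4 : 4 - 4 * gamma != 0.
  by rewrite subr_eq0 -{1}[4]mulr1 (inj_eq (mulfI _)) // eq_sym.
have : 0 <= M * (r ^+ 2 * 2) * n%:R + a / c.2 * (M * (r ^+ 2 * - (D * (2 * c.2)) +
    (1 + `|D|) * (s * (2 * gamma * (c.2 * c.2 `^ (2 * gamma - 1 - 1)))))) +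
  M * (r ^+ 2 * - (D * 2) + (1 + `|D|) *
    (s * (2 * gamma * ((2 * gamma - 1) * c.2 `^ (2 * gamma - 1 - 1))))).
  rewrite -powR_step //; apply: le_trans (lerD (lerD sx (lexx _)) yy).
  by rewrite eqc.
have -> : M * (r ^+ 2 * 2) * n%:R + a / c.2 * (M * (r ^+ 2 * - (D * (2 * c.2)) +
    (1 + `|D|) * (s * (2 * gamma * (c.2 * c.2 `^ (2 * gamma - 1 - 1)))))) +
  M * (r ^+ 2 * - (D * 2) + (1 + `|D|) *
    (s * (2 * gamma * ((2 * gamma - 1) * c.2 `^ (2 * gamma - 1 - 1))))) =
  - (M * r ^+ 2).
  by move: (c.2 `^ _) (`|D|) => Z d; field; rewrite c2n0 g4.
by rewrite oppr_ge0 leNgt mulr_gt0 // exprn_gt0.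
Qed.

(** On ever larger cubes the barrier tends to zero at a fixed point. *)
Lemma bounded_solution_le W (eps : R) : bounded_solution W -> 0 <= eps ->
  (forall x, W (x, 0) <= eps) -> forall p, 0 <= p.2 -> W p <= eps.
Proof.
move=> sW eps0 Wb p p0.
have [p20|p2n0] := eqVneq p.2 0.
  by rewrite [p]surjective_pairing p20.
have {}p0 : 0 < p.2 by rewrite lt_neqAle eq_sym p2n0.
have [_ [M0 WM0] _] := sW.
pose M := `|M0| + 1.
have M_gt0 : 0 < M by rewrite ltr_wpDl.
have WM q : 0 <= q.2 -> `|W q| <= M.
  by move=> /WM0 H; apply: le_trans H _; rewrite (le_trans (ler_norm _)) // lerDl.
pose T := \sum_i `|p.1 ord0 i| + p.2 + 1.
have S0 : 0 <= \sum_i `|p.1 ord0 i| by apply: sumr_ge0.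
have T0 : 0 < T by rewrite ltr_wpDl // addr_ge0 // ltW.
pose b (r : R) := r ^+ 2 * (\sum_i p.1 ord0 i ^+ 2 - D * p.2 ^+ 2) +
  (1 + `|D|) * (r `^ (2 * gamma) * p.2 `^ (2 * gamma)).
have blim : eps + M * b r @[r --> (0 : R)^'+] -->
    eps + M * (0 ^+ 2 * (\sum_i p.1 ord0 i ^+ 2 - D * p.2 ^+ 2) +
     (1 + `|D|) * (0 * p.2 `^ (2 * gamma))).
  apply: cvgD; first exact: cvg_cst.
  apply: cvgM; first exact: cvg_cst.
  apply: cvgD; apply: cvgM; do ?exact: cvg_cst.
    by apply: cvg_at_right_filter; exact: exprn_continuous.
  apply: cvgM; last exact: cvg_cst.
  by apply: powR_cvg0; rewrite mulr_gt0.
rewrite expr0n /= !mul0r mulr0 addr0 mulr0 addr0 in blim.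
apply: (cvgr_to_ge blim).
near=> r.
have r0 : 0 < r by near: r; exact: nbhs_right_gt.
have rT : r * T <= 1.
  rewrite -ler_pdivlMr // mul1r; near: r; apply: nbhs_right_le.
  by rewrite invr_gt0.
apply: (cube_bound sW WM M_gt0 r0 eps0 Wb); last 2 first.
- exact: ltW.
- apply: le_trans rT; rewrite ler_pM2l // /T; lra.
- move=> i; apply: le_trans rT; rewrite ler_pM2l // /T (bigD1 i) //=.
  have : 0 <= \sum_(j | j != i) `|p.1 ord0 j| by apply: sumr_ge0.
  by lra.
Unshelve. all: by end_near. Qed.

Theorem maximum_principle W (eps : R) : bounded_solution W ->
  (forall x, `|W (x, 0)| <= eps) -> forall p, 0 <= p.2 -> `|W p| <= eps.
Proof.
move=> sW Wb p p0; have eps0 : 0 <= eps by apply: le_trans (Wb 0).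
rewrite ler_norml; apply/andP; split; last first.
  by apply: bounded_solution_le => // x; exact: le_trans (ler_norm _) (Wb x).
rewrite lerNl -mulN1r; apply: (bounded_solution_le (bounded_solutionZ (- 1) sW)) => // x.
by rewrite mulN1r; apply: le_trans (Wb x); rewrite -normrN; exact: ler_norm.
Qed.

End Barrier.

End MaximumPrinciple.

(** * Tangential regularity *)

Lemma taylor1 (R : realType) (phi phi1 phi2 : R -> R) (M : R) :
  (forall t, is_derive t (1 : R) phi (phi1 t)) ->
  (forall t, is_derive t (1 : R) phi1 (phi2 t)) ->
  (forall t, `|phi2 t| <= M) ->
  forall h, h != 0 -> `|h^-1 * (phi h - phi 0) - phi1 0| <= M * `|h|.
Proof.
move=> d1 d2 b h h0.
have M0 : 0 <= M by apply: le_trans (b 0).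
have b1 t : `|phi1 t - phi1 0| <= M * `|t|.
  by rewrite -{2}[t]subr0; apply: (mvt_dist (df := phi2)) => s _; do ?[exact: d2|exact: b].
have : `|(phi h - h * phi1 0) - (phi 0 - 0 * phi1 0)| <= M * `|h| * `|h - 0|.
  apply: (mvt_dist (f := fun t => phi t - t * phi1 0)
    (df := fun t => phi1 t - (t * 0 + phi1 0 * 1))) => t ht.
    by apply: isdB => //; exact: (isdM (isd_id t) (isd_cst _ _ _)).
  rewrite mulr0 add0r mulr1; apply: le_trans (b1 t) _; apply: ler_wpM2l => //.
  move: ht; case: (leP 0 h) => hh /andP[s1 s2].
    by rewrite !ger0_norm.
  by rewrite !ler0_norm ?(ltW hh) // lerN2.
rewrite mul0r !subr0 => H.
have -> : h^-1 * (phi h - phi 0) - phi1 0 = h^-1 * (phi h - h * phi1 0 - phi 0).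
  by field.
by rewrite normrM normfV mulrC ler_pdivrMr ?normr_gt0.
Qed.

Section Tangential.
Variables (R : realType) (n : nat) (gamma : R).
Local Notation V := ('rV[R]_n * R)%type.
Local Notation ex := (@ex R n).
Local Notation ey := (@ey R n).
Local Notation bounded_solution := (@bounded_solution R n gamma).
Implicit Types (p q : V) (W : V -> R) (ws : seq 'I_n) (i : 'I_n).
Hypotheses (gamma_gt0 : 0 < gamma) (gamma_neq1 : gamma != 1).

(** Families indexed by lists of coordinate directions, in which consing a
   direction differentiates; all members are bounded. *)
Definition x_jet (X : seq 'I_n -> 'rV[R]_n -> R) : Prop :=
  [/\ forall ws i x, is_derive x (delta_mx 0 i) (X ws) (X (i :: ws) x),
      forall ws, exists M, forall x, `|X ws x| <= M
    & forall ws, continuous (X ws)].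

Definition diff_quot i (h : R) W p : R := h^-1 * (W (h *: ex i + p) - W p).

(** The closure of bounded solutions under uniform convergence. Maximum
   principle and continuity pass to the closure, and, unlike bounded solutions
   themselves, it is visibly stable under tangential derivatives. *)
Definition limit_solution W : Prop := forall e : R, 0 < e ->
  exists W', bounded_solution W' /\ forall p, 0 <= p.2 -> `|W p - W' p| <= e.

Lemma bounded_limit W : bounded_solution W -> limit_solution W.
Proof. by move=> sW e e0; exists W; split=> // p _; rewrite subrr normr0 ltW. Qed.

Lemma limit_solution_lin (c : R) W1 W2 : limit_solution W1 -> limit_solution W2 ->
  limit_solution (fun p => c * W1 p + W2 p).
Proof.
move=> l1 l2 e e0.
have c0 : 0 < 2 * (`|c| + 1) by rewrite mulr_gt0 // ltr_wpDl.
have [W1' [s1 a1]] := l1 _ (divr_gt0 e0 c0).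
have [W2' [s2 a2]] := l2 _ (divr_gt0 e0 (ltr0n R 2)).
exists (fun p => c * W1' p + W2' p); split; first exact: bounded_solution_lin.
move=> p p0; have -> : c * W1 p + W2 p - (c * W1' p + W2' p) =
  c * (W1 p - W1' p) + (W2 p - W2' p) by ring.
apply: le_trans (ler_normD _ _) _; rewrite normrM.
have : `|c| * `|W1 p - W1' p| <= e / 2.
  apply: (@le_trans _ _ (`|c| * (e / (2 * (`|c| + 1))))); first by rewrite ler_wpM2l // a1.
  have -> : `|c| * (e / (2 * (`|c| + 1))) = e / 2 * (`|c| / (`|c| + 1)).
    by field; rewrite gt_eqF // ltr_wpDl.
  by rewrite ger_pMr ?divr_gt0 // ler_pdivrMr ?mul1r ?lerDl // ltr_wpDl.
have := a2 p p0; lra.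
Qed.

Lemma limit_solution_shift (w : 'rV[R]_n) W :
  limit_solution W -> limit_solution (fun p => W (p + (w, 0))).
Proof.
move=> lW e e0; have [W' [s a]] := lW _ e0.
exists (fun p => W' (p + (w, 0))); split; first exact: bounded_solution_shift.
by move=> p p0; apply: a; rewrite /= addr0.
Qed.

Lemma limit_solution_diff_quot i h W :
  limit_solution W -> limit_solution (diff_quot i h W).
Proof.
move=> lW; have ls := limit_solution_shift (h *: delta_mx 0 i) lW.
have l1 : limit_solution (fun p => -1 * W p + W (p + (h *: delta_mx 0 i, 0))).
  exact: limit_solution_lin.
have -> : diff_quot i h W = (fun p => (h^-1 - 1) *
   (-1 * W p + W (p + (h *: delta_mx 0 i, 0)))
    + (-1 * W p + W (p + (h *: delta_mx 0 i, 0)))).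
  apply/funext => p; rewrite /diff_quot.
  have -> : h *: ex i + p = p + (h *: delta_mx 0 i, 0).
    by rewrite addrC; congr (_ + _); congr pair; rewrite scaler0.
  by ring.
exact: limit_solution_lin.
Qed.

Lemma limit_solution_lim W :
  (forall e : R, 0 < e -> exists W', limit_solution W' /\
     forall p, 0 <= p.2 -> `|W p - W' p| <= e) -> limit_solution W.
Proof.
move=> H e e0; have e2 : 0 < e / 2 by rewrite divr_gt0.
have [W' [lW a]] := H _ e2; have [W'' [s b]] := lW _ e2.
exists W''; split=> // p p0.
have -> : W p - W'' p = (W p - W' p) + (W' p - W'' p) by ring.
by apply: le_trans (ler_normD _ _) _; rewrite [e]splitr lerD ?a ?b.
Qed.

Lemma limit_solution_cont W : limit_solution W ->
  {within @closed_half_space R n, continuous W}.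
Proof.
move=> lW; apply: closed_cont_approx => p e p0 e0.
have [W' [[c _ _] a]] := lW _ e0.
by exists W'; split=> //; near=> q; exact: a.
Unshelve. all: by end_near. Qed.

Lemma limit_solution_max W (eps : R) : limit_solution W ->
  (forall x, `|W (x, 0)| <= eps) -> forall p, 0 <= p.2 -> `|W p| <= eps.
Proof.
move=> lW Wb p p0; apply/ler_addgt0Pr => e e0.
have e2 : 0 < e / 2 by rewrite divr_gt0.
have [W' [s a]] := lW _ e2.
have W'b x : `|W' (x, 0)| <= eps + e / 2.
  have -> : W' (x, 0) = W (x, 0) - (W (x, 0) - W' (x, 0)) by ring.
  by apply: le_trans (ler_normB _ _) _; rewrite lerD // a.
have := maximum_principle gamma_gt0 gamma_neq1 s W'b p0.
have -> : W p = W' p + (W p - W' p) by ring.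
by have := a p p0; have := ler_normD (W' p) (W p - W' p); lra.
Qed.

(** By the maximum principle the difference quotients of a solution converge
   uniformly up to the boundary at the rate observed on the boundary. *)
Lemma limit_solution_deriv i W (gi : 'rV[R]_n -> R) (C : R) : limit_solution W ->
  (forall x h, h != 0 -> `|diff_quot i h W (x, 0) - gi x| <= C * `|h|) ->
  [/\ limit_solution ('D_(ex i) W),
      forall p, 0 <= p.2 -> is_derive p (ex i) W ('D_(ex i) W p),
      forall p h, 0 <= p.2 -> h != 0 ->
        `|diff_quot i h W p - 'D_(ex i) W p| <= C * `|h|
    & forall x, 'D_(ex i) W (x, 0) = gi x].
Proof.
move=> lW rate.
have C0 : 0 <= C.
  have := rate 0 1 (oner_neq0 _); rewrite normr1 mulr1.
  exact: le_trans.
have cau p h k : 0 <= p.2 -> h != 0 -> k != 0 ->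
    `|diff_quot i h W p - diff_quot i k W p| <= C * (`|h| + `|k|).
  move=> p0 h0 k0.
  have l2 : limit_solution (fun p => -1 * diff_quot i k W p + diff_quot i h W p).
    by apply: limit_solution_lin; exact: limit_solution_diff_quot.
  have -> : diff_quot i h W p - diff_quot i k W p =
    -1 * diff_quot i k W p + diff_quot i h W p by ring.
  apply: (limit_solution_max l2) => // x.
  have -> : -1 * diff_quot i k W (x, 0) + diff_quot i h W (x, 0) =
    (diff_quot i h W (x, 0) - gi x) - (diff_quot i k W (x, 0) - gi x) by ring.
  by apply: le_trans (ler_normB _ _) _; rewrite mulrDr lerD // rate.
have lim_of_rate p l : (forall h, h != 0 -> `|diff_quot i h W p - l| <= C * `|h|) ->
    is_derive p (ex i) W l.
  move=> H; apply/isdP/cvgrPdist_le => e e0; near=> h.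
  have h0 : h != 0 by near: h; exact: nbhs_dnbhs_neq.
  rewrite distrC; apply: le_trans (H h h0) _.
  have : `|h| < e / (C + 1).
    by near: h; apply: dnbhs0_lt; rewrite divr_gt0 // ltr_wpDl.
  rewrite ltr_pdivlMr ?ltr_wpDl //; have := normr_ge0 h; nra.
have key p : 0 <= p.2 -> is_derive p (ex i) W ('D_(ex i) W p) /\
    forall h, h != 0 -> `|diff_quot i h W p - 'D_(ex i) W p| <= C * `|h|.
  move=> p0; have [l Hl] := lim_lin_rate (fun h k h0 k0 => cau p h k p0 h0 k0).
  by have Wd := lim_of_rate _ _ Hl; rewrite (isd_val Wd).
have bd x : 'D_(ex i) W (x, 0) = gi x.
  apply: isd_val; apply: lim_of_rate => h h0; exact: rate.
split=> //; [|by move=> p /key[]|by move=> p h /key[_ H] /H].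
apply: limit_solution_lim => e e0.
pose h := e / (C + 1); have h0 : 0 < h by rewrite divr_gt0 // ltr_wpDl.
exists (diff_quot i h W); split; first exact: limit_solution_diff_quot.
move=> p /key[_ /(_ h)]; rewrite gt_eqF // => /(_ isT) H.
rewrite distrC; apply: le_trans H _; rewrite gtr0_norm // /h.
by rewrite mulrCA ger_pMr // ler_pdivrMr ?mul1r ?lerDl // ltr_wpDl.
Unshelve. all: by end_near. Qed.

Section Derivatives.
Variables (U : V -> R) (X : seq 'I_n -> 'rV[R]_n -> R).
Hypotheses (sU : bounded_solution U) (jX : x_jet X)
  (UX : forall x, U (x, 0) = X [::] x).

Definition x_derivs ws : V -> R := iter_derive (map ex ws) U.

Lemma x_jet_rate ws i : exists M, forall x h, h != 0 ->
  `|h^-1 * (X ws (h *: delta_mx 0 i + x) - X ws x) - X (i :: ws) x| <= M * `|h|.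
Proof.
have [dX bX _] := jX; have [M bM] := bX (i :: i :: ws).
exists M => x h h0.
have d ws' t : is_derive t (1 : R) (fun t => X ws' (x + t *: delta_mx 0 i))
    (X (i :: ws') (x + t *: delta_mx 0 i)) by exact/isd_line.
have := taylor1 (d ws) (d (i :: ws)) (fun t => bM _) h0.
by rewrite scale0r addr0 [x + _]addrC.
Qed.

Lemma x_derivs_limit ws :
  limit_solution (x_derivs ws) /\ forall x, x_derivs ws (x, 0) = X ws x.
Proof.
elim: ws => [|i ws [l b]]; first by split; [exact: bounded_limit|].
have [M rate] := x_jet_rate ws i.
have [|l' _ _ b'] := @limit_solution_deriv i _ (X (i :: ws)) M l; last by split.
move=> x h h0; rewrite /diff_quot b.
have -> : h *: ex i + (x, 0) = (h *: delta_mx 0 i + x, 0).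
  by congr pair; rewrite /= scaler0 addr0.
by rewrite b; exact: rate.
Qed.

Lemma x_derivs_rate ws i :
  (forall p, 0 <= p.2 -> is_derive p (ex i) (x_derivs ws) (x_derivs (i :: ws) p)) /\
  exists M, forall p h, 0 <= p.2 -> h != 0 ->
    `|diff_quot i h (x_derivs ws) p - x_derivs (i :: ws) p| <= M * `|h|.
Proof.
have [l b] := x_derivs_limit ws.
have [M rate] := x_jet_rate ws i.
have [|_ d r _] := @limit_solution_deriv i _ (X (i :: ws)) M l; last first.
  by split=> //; exists M.
move=> x h h0; rewrite /diff_quot b.
have -> : h *: ex i + (x, 0) = (h *: delta_mx 0 i + x, 0).
  by congr pair; rewrite /= scaler0 addr0.
by rewrite b; exact: rate.
Qed.

Lemma x_derivs_bounded ws : exists M, forall p, 0 <= p.2 -> `|x_derivs ws p| <= M.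
Proof.
have [l b] := x_derivs_limit ws; have [_ /(_ ws)[M bM] _] := jX.
by exists M; apply: limit_solution_max => // x; rewrite b.
Qed.

Lemma x_derivs_cont ws : {within @closed_half_space R n, continuous (x_derivs ws)}.
Proof. by have [l _] := x_derivs_limit ws; exact: limit_solution_cont. Qed.

End Derivatives.

End Tangential.

(** * Interior regularity *)

(** Interpolation for the singular ordinary differential equation: the mean
   value theorem gives a point of [[y, 2y]] with small derivative, and the
   equation, in the form that the weighted derivative [t^a phi'] has derivative
   [t^a psi], carries the bound back to [y]. *)
Lemma interpolation (R : realType) (a : R) (phi phi1 psi : R -> R) (y eps : R) :
  0 < y ->
  (forall t, y <= t <= 2 * y -> is_derive t (1 : R) phi (phi1 t)) ->
  (forall t, y <= t <= 2 * y -> is_derive t (1 : R) phi1 (psi t - a / t * phi1 t)) ->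
  (forall t, y <= t <= 2 * y -> `|phi t| <= eps) ->
  (forall t, y <= t <= 2 * y -> `|psi t| <= eps) ->
  `|phi1 y| <= 2 `^ `|a| * (2 / y + y) * eps.
Proof.
move=> y0 d1 d2 b1 b2; set A := 2 `^ `|a|.
have A0 : 0 <= A by exact: powR_ge0.
have y2 : y < 2 * y by lra.
have [th /andP[yth thy] eqth] := mvt y2 d1.
have yy : y <= y <= 2 * y by rewrite lexx ltW.
have eps0 : 0 <= eps by apply: le_trans (b1 _ yy).
have hth : `|phi1 th| <= 2 / y * eps.
  have : `|phi (2 * y) - phi y| <= 2 * eps.
    apply: le_trans (ler_normB _ _) _.
    have := b1 _ yy; have := b1 (2 * y); rewrite lexx ltW //= => /(_ isT).
    lra.
  rewrite eqth (_ : 2 * y - y = y); last by ring.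
  by rewrite normrM (gtr0_norm y0) -ler_pdivlMr // mulrAC.
have wt t : y <= t <= 2 * y -> t `^ a <= A * y `^ a.
  move=> /andP[t1 t2]; have ty : t = t / y * y by field; rewrite gt_eqF.
  have ty1 : 1 <= t / y by rewrite ler_pdivlMr // mul1r.
  rewrite ty powRM ?(ltW y0) //; last exact: le_trans ty1.
  rewrite ler_wpM2r ?powR_ge0 //; apply: (@le_trans _ _ ((t / y) `^ `|a|)).
    by apply: ler_powR => //; exact: ler_norm.
  by apply: ge0_ler_powR; rewrite ?nnegrE ?ler_pdivrMr // (le_trans _ ty1).
pose P t := t `^ a * phi1 t.
have dP t : y <= t <= 2 * y -> is_derive t (1 : R) P (t `^ a * psi t).
  move=> ht; have t0 : 0 < t by apply: lt_le_trans y0 _; case/andP: ht.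
  apply: isd_eq (isdM (isd_powR a t0) (d2 t ht)) _.
  by rewrite (powR_step a t0); field; rewrite gt_eqF.
have Pb : `|P th - P y| <= A * y `^ a * eps * (th - y).
  apply: (mvt_cst (ltW yth)) => t /andP[t1 t2].
    by apply: dP; rewrite t1 (le_trans t2 (ltW thy)).
  have ht : y <= t <= 2 * y by rewrite t1 (le_trans t2 (ltW thy)).
  by rewrite normrM ger0_norm ?powR_ge0 // ler_pM ?powR_ge0 ?wt ?b2.
have ya0 : 0 < y `^ a by rewrite powR_gt0.
have : `|P y| <= A * y `^ a * (2 / y + y) * eps.
  have -> : P y = P th - (P th - P y) by ring.
  apply: le_trans (ler_normB _ _) _.
  have h1 : `|P th| <= A * y `^ a * (2 / y * eps).
    rewrite normrM ger0_norm ?powR_ge0 // ler_pM ?powR_ge0 //.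
    by apply: wt; rewrite !ltW.
  have h2 : A * y `^ a * eps * (th - y) <= A * y `^ a * eps * y.
    by apply: ler_wpM2l; [rewrite !mulr_ge0 // ltW|lra].
  have -> : A * y `^ a * (2 / y + y) * eps =
    A * y `^ a * (2 / y * eps) + A * y `^ a * eps * y by ring.
  lra.
rewrite normrM gtr0_norm // [A * _]mulrC -!mulrA ler_pM2l // !mulrA.
Qed.

Section Interior.
Variables (R : realType) (n : nat) (gamma : R).
Local Notation V := ('rV[R]_n * R)%type.
Local Notation ex := (@ex R n).
Local Notation ey := (@ey R n).
Local Notation a := (1 - 2 * gamma).
Implicit Types (p q : V) (W : V -> R) (ws : seq 'I_n) (i : 'I_n).
Hypotheses (gamma_gt0 : 0 < gamma) (gamma_neq1 : gamma != 1).

Lemma isd_of_rate i W p (l C : R) :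
  (forall h, h != 0 -> `|diff_quot i h W p - l| <= C * `|h|) ->
  is_derive p (ex i) W l.
Proof.
move=> H.
have C0 : 0 <= C.
  by have := H 1 (oner_neq0 _); rewrite normr1 mulr1; exact: le_trans.
apply/isdP/cvgrPdist_le => e e0; near=> h.
have h0 : h != 0 by near: h; exact: nbhs_dnbhs_neq.
rewrite distrC; apply: le_trans (H h h0) _.
have : `|h| < e / (C + 1).
  by near: h; apply: dnbhs0_lt; rewrite divr_gt0 // ltr_wpDl.
rewrite ltr_pdivlMr ?ltr_wpDl //; have := normr_ge0 h; nra.
Unshelve. all: by end_near. Qed.

Lemma isd_diff_quot i h W W' v : (forall p, 0 < p.2 -> is_derive p v W (W' p)) ->
  forall p, 0 < p.2 -> is_derive p v (diff_quot i h W) (diff_quot i h W' p).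
Proof.
move=> d p p0; apply: isdZ; apply: isdB; last exact: d.
have -> : (fun q => W (h *: ex i + q)) = (fun q => W (q + h *: ex i)).
  by apply/funext => q; rewrite addrC.
by rewrite addrC; apply: isd_shift; apply: d; rewrite shift_exE'.
Qed.

(** One tangential derivative at a time: uniform convergence of the difference
   quotients of [v] and of the right-hand side forces, by interpolation,
   convergence of the difference quotients of the normal derivative [dv]. *)
Lemma tangential_step i (v v1 dv Q Q1 : V -> R) (C : R) :
  (forall p, 0 < p.2 -> is_derive p ey v (dv p)) ->
  (forall p, 0 < p.2 -> is_derive p ey dv (Q p - a / p.2 * dv p)) ->
  (forall p, 0 < p.2 -> {for p, continuous dv}) ->
  (forall p h, 0 < p.2 -> h != 0 -> `|diff_quot i h v p - v1 p| <= C * `|h|) ->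
  (forall p h, 0 < p.2 -> h != 0 -> `|diff_quot i h Q p - Q1 p| <= C * `|h|) ->
  exists dv1 : V -> R,
  [/\ forall p, 0 < p.2 -> is_derive p (ex i) dv (dv1 p),
      forall p, 0 < p.2 -> is_derive p ey v1 (dv1 p),
      forall p, 0 < p.2 -> is_derive p ey dv1 (Q1 p - a / p.2 * dv1 p)
    & forall p, 0 < p.2 -> {for p, continuous dv1}].
Proof.
move=> d1 d2 dvc r1 r2.
pose K (y : R) := 2 `^ `|a| * (2 / y + y).
have dG h := isd_diff_quot i h d1.
have dG' h p : 0 < p.2 -> is_derive p ey (diff_quot i h dv)
    (diff_quot i h Q p - a / p.2 * diff_quot i h dv p).
  move=> p0; apply: isd_eq (isd_diff_quot i h d2 p0) _.
  by rewrite /diff_quot shift_exE; ring.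
have C0 : 0 <= C.
  have := r1 (0, 1) 1 ltr01 (oner_neq0 _); rewrite normr1 mulr1; exact: le_trans.
have cau p h k : 0 < p.2 -> h != 0 -> k != 0 ->
    `|diff_quot i h dv p - diff_quot i k dv p| <= K p.2 * C * (`|h| + `|k|).
  case: p => x y /= y0 h0 k0; rewrite -mulrA.
  apply: (interpolation (a := a)
    (phi := fun t => diff_quot i h v (x, t) - diff_quot i k v (x, t))
    (phi1 := fun t => diff_quot i h dv (x, t) - diff_quot i k dv (x, t))
    (psi := fun t => diff_quot i h Q (x, t) - diff_quot i k Q (x, t)) y0)
    => t /andP[ty _]; have t0 : 0 < (x, t).2 by exact: lt_le_trans ty.
  - by apply: isdB; apply/isd_ey; exact: dG.
  - apply: isd_eq (isdB (iffRL (isd_ey _ _ _ _) (dG' h _ t0))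
      (iffRL (isd_ey _ _ _ _) (dG' k _ t0))) _.
    by rewrite /=; ring.
  - have -> : diff_quot i h v (x, t) - diff_quot i k v (x, t) =
      (diff_quot i h v (x, t) - v1 (x, t)) - (diff_quot i k v (x, t) - v1 (x, t)) by ring.
    by apply: le_trans (ler_normB _ _) _; rewrite mulrDr lerD // r1.
  - have -> : diff_quot i h Q (x, t) - diff_quot i k Q (x, t) =
      (diff_quot i h Q (x, t) - Q1 (x, t)) - (diff_quot i k Q (x, t) - Q1 (x, t)) by ring.
    by apply: le_trans (ler_normB _ _) _; rewrite mulrDr lerD // r2.
have lims p : exists l, 0 < p.2 ->
    forall h, h != 0 -> `|diff_quot i h dv p - l| <= K p.2 * C * `|h|.
  have [p0|p0] := pselect (0 < p.2); last by exists 0.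
  have [l Hl] := lim_lin_rate (fun h k h0 k0 => cau p h k p0 h0 k0).
  by exists l.
have [dv1 r3] := choice lims.
have KK (y t : R) : 0 < y -> `|t - y| < y / 2 -> 0 < t /\ 0 <= K t <= 2 * K y.
  move=> y0; rewrite ltr_norml => /andP[t1 t2]; have t0 : 0 < t by lra.
  split=> //; rewrite /K mulr_ge0 ?powR_ge0 ?addr_ge0 ?divr_ge0 ?(ltW t0) //=.
  rewrite [2 * (_ * _)]mulrCA ler_wpM2l ?powR_ge0 // mulrDr lerD //; last by lra.
  rewrite ler_pdivrMr //; have -> : 2 * (2 / y) * t = 4 * t / y by ring.
  by rewrite ler_pdivlMr //; lra.
have near2 p : 0 < p.2 -> \forall q \near p, `|q.2 - p.2| < p.2 / 2.
  move=> p0; have c : (fun q : V => q.2) @ p --> p.2 by exact: cvg_snd.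
  by move/cvgrPdistC_lt : c; apply; rewrite divr_gt0.
(* a step for which all three errors are below e, uniformly near height y *)
pose step (y e : R) := e / ((C + 1) * (1 + 2 * K y + `|a| / (y / 2) * (2 * K y) + 1)).
have stepP (y e : R) : 0 < y -> 0 < e -> [/\ 0 < step y e, C * step y e <= e,
     2 * K y * C * step y e <= e
   & C * step y e + `|a| / (y / 2) * (2 * K y * C * step y e) <= e].
  move=> y0 e0; rewrite /step.
  have Ky : 0 <= 2 * K y.
    by rewrite !mulr_ge0 ?powR_ge0 // addr_ge0 ?divr_ge0 ?(ltW y0).
  have B0 : 0 <= `|a| / (y / 2) * (2 * K y).
    by rewrite mulr_ge0 // divr_ge0 // divr_ge0 // ltW.
  move: (2 * K y) (`|a| / (y / 2)) Ky B0 => k b Ky B0.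
  set N := 1 + k + b * k + 1.
  have N0 : 0 < N by rewrite /N; lra.
  have s0 : 0 < e / ((C + 1) * N) by rewrite divr_gt0 // mulr_gt0 // ltr_wpDl.
  have Cs : C * (e / ((C + 1) * N)) <= e / N.
    have -> : C * (e / ((C + 1) * N)) = e / N * (C / (C + 1)).
      by field; rewrite !gt_eqF // ltr_wpDl.
    by rewrite ger_pMr ?divr_gt0 // ler_pdivrMr ?mul1r ?lerDl // ltr_wpDl.
  move: Cs; rewrite -[k * C * _]mulrA; set s := C * _ => Cs.
  have s_ge0 : 0 <= s by rewrite mulr_ge0 // ltW.
  have : s * N <= e by rewrite -ler_pdivlMr.
  have sk : 0 <= s * k by rewrite mulr_ge0.
  have sbk : 0 <= s * (b * k) by rewrite mulr_ge0.
  by rewrite /N => H; split=> //; nra.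
exists dv1.
have D1 p : 0 < p.2 -> is_derive p (ex i) dv (dv1 p).
  by move=> p0; apply: isd_of_rate; exact: r3.
have D2 p : 0 < p.2 -> is_derive p ey v1 (dv1 p).
  case: p => x y /= y0; apply/isd_ey.
  have y20 : 0 < y / 2 by rewrite divr_gt0.
  apply: (isd_approx (chi := fun t => dv1 (x, t)) y20) => e e0.
  have [s0 s1 s2 _] := stepP y e y0 e0.
  exists (fun t => diff_quot i (step y e) v (x, t)),
    (fun t => diff_quot i (step y e) dv (x, t)) => t ty.
  have [t0 /andP[Kt0 Kt]] := KK _ _ y0 ty.
  have sn0 : step y e != 0 by rewrite gt_eqF.
  split; first exact/isd_ey/dG.
    by apply: le_trans (r1 _ _ _ _) _ => //; rewrite gtr0_norm.
  apply: le_trans (r3 _ _ _ _) _ => //=; apply: le_trans s2.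
  by rewrite gtr0_norm // !ler_wpM2r // ltW.
have D3 p : 0 < p.2 -> is_derive p ey dv1 (Q1 p - a / p.2 * dv1 p).
  case: p => x y /= y0; apply/isd_ey.
  have y20 : 0 < y / 2 by rewrite divr_gt0.
  apply: (isd_approx (chi := fun t => Q1 (x, t) - a / t * dv1 (x, t)) y20) => e e0.
  have [s0 s1 s2 s3] := stepP y e y0 e0.
  exists (fun t => diff_quot i (step y e) dv (x, t)),
    (fun t => diff_quot i (step y e) Q (x, t) -
              a / t * diff_quot i (step y e) dv (x, t)) => t ty.
  have [t0 /andP[Kt0 Kt]] := KK _ _ y0 ty.
  have sn0 : step y e != 0 by rewrite gt_eqF.
  have e3 : `|diff_quot i (step y e) dv (x, t) - dv1 (x, t)| <= 2 * K y * C * step y e.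
    apply: le_trans (r3 _ _ _ _) _ => //=.
    by rewrite gtr0_norm // !ler_wpM2r // ltW.
  split; [apply/isd_ey; exact: dG'|exact: le_trans s2|].
  apply: le_trans s3.
  have -> : diff_quot i (step y e) Q (x, t) - a / t * diff_quot i (step y e) dv (x, t) -
     (Q1 (x, t) - a / t * dv1 (x, t)) =
     (diff_quot i (step y e) Q (x, t) - Q1 (x, t)) -
     a / t * (diff_quot i (step y e) dv (x, t) - dv1 (x, t)) by ring.
  apply: le_trans (ler_normB _ _) _; apply: lerD.
    by apply: le_trans (r2 _ _ _ _) _ => //; rewrite gtr0_norm.
  rewrite normrM; apply: ler_pM => //.
  rewrite normrM normfV (gtr0_norm t0) ler_wpM2l // lef_pV2 ?posrE ?divr_gt0 //.
  by move: ty; rewrite ltr_norml; lra.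
split=> // p p0; apply/cvgrPdist_le => e e0.
have e3 : 0 < e / 3 by rewrite divr_gt0.
have [s0 _ s2 _] := stepP p.2 _ p0 e3.
set s := step _ _ in s0 s2.
have sn0 : s != 0 by rewrite gt_eqF.
have Gc : {for p, continuous (diff_quot i s dv)}.
  apply: cvgM; first exact: cvg_cst.
  apply: cvgB; last exact: dvc.
  apply: (@continuous_comp _ _ _ (fun q : V => s *: ex i + q) dv).
    by apply: cvgD; [exact: cvg_cst|exact: cvg_id].
  by apply: dvc; rewrite shift_exE.
have err q : `|q.2 - p.2| < p.2 / 2 -> `|diff_quot i s dv q - dv1 q| <= e / 3.
  move=> qp; have [q0 /andP[Kt0 Kt]] := KK _ _ p0 qp.
  apply: le_trans (r3 _ _ _ _) _ => //=; apply: le_trans s2.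
  by rewrite gtr0_norm // !ler_wpM2r // ltW.
near=> q.
have h1 : `|diff_quot i s dv p - dv1 p| <= e / 3.
  by apply: err; rewrite subrr normr0 divr_gt0.
have h2 : `|diff_quot i s dv q - dv1 q| <= e / 3 by apply: err; near: q; exact: near2.
have h3 : `|diff_quot i s dv p - diff_quot i s dv q| <= e / 3.
  by near: q; move/cvgrPdist_le : Gc; apply.
have -> : dv1 p - dv1 q = - (diff_quot i s dv p - dv1 p) +
  (diff_quot i s dv p - diff_quot i s dv q) + (diff_quot i s dv q - dv1 q) by ring.
apply: le_trans (ler_normD _ _) _.
apply: le_trans (lerD (ler_normD _ _) (lexx _)) _; rewrite normrN; lra.
Unshelve. all: by end_near. Qed.

End Interior.

Section Jets.
Variables (R : realType) (n : nat).
Local Notation V := ('rV[R]_n * R)%type.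
Local Notation ex := (@ex R n).
Local Notation ey := (@ey R n).
Implicit Types (p q : V) (W : V -> R) (ws : seq 'I_n) (i : 'I_n).

(** All derivatives of a function at once: [J ws j] stands for the tangential
   derivative along [ws] of the [j]-th power of the operator y^-1 d/dy. That
   operator, rather than d/dy, is used since it maps smooth functions of
   y^2 to smooth functions of y^2. *)
Definition interior_jet (J : seq 'I_n -> nat -> V -> R) : Prop :=
  forall ws j p, 0 < p.2 ->
  [/\ {for p, continuous (J ws j)},
      forall i, is_derive p (ex i) (J ws j) (J (i :: ws) j p)
    & is_derive p ey (J ws j) (p.2 * J ws j.+1 p)].

Lemma isd_half_space_eq W W' p v d : (forall q, 0 < q.2 -> W q = W' q) ->
  0 < p.2 -> is_derive p v W d -> is_derive p v W' d.
Proof.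
by move=> e p0; apply: isd_near; apply: filterS (near_half_space p0) => q; exact: e.
Qed.

Lemma cont_half_space_eq W W' p : (forall q, 0 < q.2 -> W q = W' q) ->
  0 < p.2 -> {for p, continuous W} -> {for p, continuous W'}.
Proof.
move=> e p0; rewrite /prop_for /continuous_at -(e p p0) => c.
apply: cvg_trans c; apply: near_eq_cvg; apply: filterS (near_half_space p0) => q q0.
by rewrite e.
Qed.

End Jets.

Section SolutionJets.
Variables (R : realType) (n : nat) (gamma : R).
Local Notation V := ('rV[R]_n * R)%type.
Local Notation ex := (@ex R n).
Local Notation ey := (@ey R n).
Local Notation a := (1 - 2 * gamma).
Implicit Types (p q : V) (W : V -> R) (ws : seq 'I_n) (i : 'I_n).
Hypotheses (gamma_gt0 : 0 < gamma) (gamma_neq1 : gamma != 1).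

Lemma schwartz_x_jet (f : 'rV[R]_n -> R) : schwartz f ->
  x_jet (fun ws => iter_derive (map (delta_mx 0) ws) f).
Proof.
move=> [sf bf]; split=> [ws i x|ws|ws x].
- have [//|_ d] := sf (size ws).+1 (map (delta_mx 0) ws) x _ I.
    by rewrite size_map.
  by apply: derivableP; apply: d; rewrite size_map.
- have [M bM] := bf (map (delta_mx 0) ws) 0.
  by exists M => x; have := bM x; rewrite expr0 mul1r.
- by have [] := sf (size ws) (map (delta_mx 0) ws) x; rewrite ?size_map.
Qed.

Lemma bvp_bounded_solution (f : 'rV[R]_n -> R) (U : V -> R) (M0 : R) :
  (forall x, `|f x| <= M0) -> bounded_bvp_solution a f U ->
  @bounded_solution R n gamma U.
Proof.
move=> bf [cU eqU contU bdU [M bM]]; split=> //.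
  exists (`|M| + `|M0|) => p; rewrite le_eqVlt => /predU1P[p0|p0].
    have -> : p = (p.1, 0) by rewrite p0; case: (p).
    by rewrite bdU (le_trans (bf _)) // (le_trans (ler_norm _)) // lerDr.
  by rewrite (le_trans (bM _ p0)) // (le_trans (ler_norm _)) // lerDl.
exists (fun i => 'D_(ex i) U), (fun i => 'D_(ex i) ('D_(ex i) U)),
  ('D_ey U), ('D_ey ('D_ey U)) => p p0.
have d1 v : derivable U p v.
  by have [_ d] := cU [::] p isT p0; exact: d.
have d2 v : derivable ('D_v U) p v.
  by have [_ d] := cU [:: v] p isT p0; exact: d.
split.
- by move=> i; split; apply: derivableP.
- exact: derivableP.
- exact: derivableP.
- exact: eqU.
Qed.

Variables (U : V -> R) (X : seq 'I_n -> 'rV[R]_n -> R).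
Hypotheses (jX : x_jet X) (U_sol : bounded_bvp_solution a (X [::]) U).

Let sU : @bounded_solution R n gamma U.
Proof. by have [_ /(_ [::])[M bM] _] := jX; exact: bvp_bounded_solution U_sol. Qed.

Let UX x : U (x, 0) = X [::] x.
Proof. by have [_ _ _ ->] := U_sol. Qed.

Local Notation u := (x_derivs U).
Local Notation du := (fun ws => 'D_ey (u ws)).
Local Notation Q := (fun ws p => - \sum_i u (ws ++ [:: i; i]) p).

Lemma x_derivs_ode ws :
  [/\ forall p, 0 < p.2 -> is_derive p ey (u ws) (du ws p),
      forall p, 0 < p.2 -> is_derive p ey (du ws) (Q ws p - a / p.2 * du ws p),
      forall p, 0 < p.2 -> {for p, continuous (du ws)}
    & forall i p, 0 < p.2 -> is_derive p (ex i) (du ws) (du (i :: ws) p)].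
Proof.
have step i v : [/\ forall p, 0 < p.2 -> is_derive p ey (u v) (du v p),
      forall p, 0 < p.2 -> is_derive p ey (du v) (Q v p - a / p.2 * du v p)
    & forall p, 0 < p.2 -> {for p, continuous (du v)}] ->
   [/\ forall p, 0 < p.2 -> is_derive p ey (u (i :: v)) (du (i :: v) p),
      forall p, 0 < p.2 -> is_derive p ey (du (i :: v))
        (Q (i :: v) p - a / p.2 * du (i :: v) p),
      forall p, 0 < p.2 -> {for p, continuous (du (i :: v))}
    & forall p, 0 < p.2 -> is_derive p (ex i) (du v) (du (i :: v) p)].
  move=> [d1 d2 dc].
  have rate w := (x_derivs_rate gamma_gt0 gamma_neq1 sU jX UX w i).2.
  have [M r1] := rate v.
  have /choice[N r2] : forall j, exists N, forall p h, 0 <= p.2 -> h != 0 ->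
      `|diff_quot i h (u (v ++ [:: j; j])) p - u (i :: v ++ [:: j; j]) p| <= N * `|h|.
    by move=> j; exact: rate.
  have N0 j : 0 <= N j.
    have := r2 j 0 1 (lexx _) (oner_neq0 _); rewrite normr1 mulr1; exact: le_trans.
  have M0 : 0 <= M.
    have := r1 0 1 (lexx _) (oner_neq0 _); rewrite normr1 mulr1; exact: le_trans.
  have S0 : 0 <= \sum_j N j by apply: sumr_ge0.
  have [||dv1 [e1 e2 e3 e4]] := @tangential_step R n gamma i (u v) (u (i :: v)) (du v)
    (Q v) (Q (i :: v)) (M + \sum_j N j) d1 d2 dc.
  - move=> p h p0 h0; apply: le_trans (r1 _ _ (ltW p0) h0) _.
    by rewrite ler_wpM2r // lerDl.
  - move=> p h p0 h0.
    have -> : diff_quot i h (Q v) p - Q (i :: v) p =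
      - \sum_j (diff_quot i h (u (v ++ [:: j; j])) p - u (i :: v ++ [:: j; j]) p).
      rewrite /diff_quot sumrB -mulr_sumr sumrB; ring.
    rewrite normrN; apply: le_trans (ler_norm_sum _ _ _) _.
    apply: (@le_trans _ _ ((\sum_j N j) * `|h|)); last by rewrite ler_wpM2r // lerDr.
    by rewrite mulr_suml; apply: ler_sum => j _; exact: r2 (ltW p0) h0.
  have E p : 0 < p.2 -> dv1 p = du (i :: v) p by move=> p0; rewrite (isd_val (e2 _ p0)).
  split=> p p0.
  - by have := e2 p p0; rewrite (E p p0).
  - by apply: (isd_half_space_eq E p0); have := e3 p p0; rewrite (E p p0).
  - by apply: (cont_half_space_eq E p0); exact: e4.
  - by have := e1 p p0; rewrite (E p p0).
have Y : [/\ forall p, 0 < p.2 -> is_derive p ey (u ws) (du ws p),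
      forall p, 0 < p.2 -> is_derive p ey (du ws) (Q ws p - a / p.2 * du ws p)
    & forall p, 0 < p.2 -> {for p, continuous (du ws)}].
  elim: ws => [|i v /(step i)[d1 d2 d3 _]]; last by split.
  have [cU eqU _ _ _] := U_sol; split=> p p0.
  - by have [_ d] := cU [::] p isT p0; exact: (derivableP (d isT ey)).
  - have -> : Q [::] p - a / p.2 * du [::] p = 'D_ey ('D_ey U) p.
      move: (eqU p p0); rewrite /laplace_x /dy /=.
      by move: (\sum_i _) (a / p.2 * _) ('D_ey ('D_ey U) p) => A B D'; lra.
    by have [_ d] := cU [:: ey] p isT p0; exact: (derivableP (d isT ey)).
  - by have [c _] := cU [:: ey] p isT p0.
case: (Y) => d1 d2 d3; split; [exact: d1|exact: d2|exact: d3|].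
by move=> i p p0; case: (step i ws Y) => _ _ _ d; exact: d.
Qed.

(** The equation, applied repeatedly, expresses every normal derivative through
   tangential ones; the shift of the coefficient by [2j] comes from commuting
   y^2 with powers of y^-1 d/dy. *)
Fixpoint solution_jet_rec (j : nat) ws p : R :=
  match j with
  | 0 => u ws p
  | j1.+1 => match j1 with
    | 0 => p.2^-1 * du ws p
    | j2.+1 => p.2 ^- 2 * (- \sum_i solution_jet_rec j2 (ws ++ [:: i; i]) p
                 - (2 - 2 * gamma + 2 * j2%:R) * solution_jet_rec j1 ws p)
    end
  end.

Definition solution_jet ws j p := solution_jet_rec j ws p.

Lemma solution_jet_ode ws j p : 0 < p.2 ->
  p.2 ^+ 2 * solution_jet ws j.+2 p +
  (2 - 2 * gamma + 2 * j%:R) * solution_jet ws j.+1 p =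
  - \sum_i solution_jet (ws ++ [:: i; i]) j p.
Proof.
move=> p0; rewrite {1}/solution_jet [solution_jet_rec j.+2 ws p]/=.
rewrite mulrA divff ?mul1r ?expf_neq0 ?gt_eqF // -/(solution_jet ws j.+1 p).
by rewrite subrK.
Qed.

Lemma isd_inv_snd k p : 0 < p.2 ->
  is_derive p ey (fun q : V => q.2 ^- k) (- k%:R * p.2 ^- k.+1).
Proof.
move=> p0; have pn0 : p.2 != 0 by rewrite gt_eqF.
have pk0 : p.2 ^+ k != 0 by rewrite expf_neq0.
have d : is_derive p.2 (1 : R) (fun t : R => t ^- k) _ :=
  @is_deriveV R (fun t => t ^+ k) p.2 _ 1 pk0 (isd_exprn k p.2).
apply: isd_eq (isd_snd_comp ey d) _.
rewrite /= mulr1 {d}; case: k pk0 => [|k] pk0; first by rewrite mulr0n mul0r scaler0 oppr0 mul0r.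
have scaleM (c d : R) : c *: (d : R^o) = c * d by [].
rewrite scaleM /= !exprS expr0; move: (p.2 ^+ k) (expf_neq0 k pn0) => z z0.
by field; rewrite pn0 z0.
Qed.

Lemma cont_inv_snd k p : 0 < p.2 -> {for p, continuous (fun q : V => q.2 ^- k)}.
Proof.
move=> p0; apply: cvgV; first by rewrite expf_neq0 ?gt_eqF.
exact: cont_snd_exp.
Qed.

Lemma solution_jetP : interior_jet solution_jet.
Proof.
have X1 ws j p : 0 < p.2 -> {for p, continuous (solution_jet ws j)} /\
   forall i, is_derive p (ex i) (solution_jet ws j) (solution_jet (i :: ws) j p).
  move=> p0; have pn0 : p.2 != 0 by rewrite gt_eqF.
  have [k] := ubnP j; elim: k j ws => // k ih [|[|j]] ws jk.
  - split=> [|i].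
      change {for p, continuous (u ws)}; apply: closed_cont_interior p0.
      exact: (x_derivs_cont gamma_gt0 gamma_neq1 sU jX UX).
    by have [d _] := x_derivs_rate gamma_gt0 gamma_neq1 sU jX UX ws i; exact/d/ltW.
  - have [d1 d2 dc dx] := x_derivs_ode ws; split=> [|i].
      by apply: cvgM; [exact: (@cont_inv_snd 1)|exact: dc].
    apply: isd_eq (isdM (isd_snd_comp (ex i) (@is_deriveV R (fun t => t) p.2 _ 1 pn0 (isd_id p.2))) (dx i p p0)) _.
    by rewrite /= mulr0 mulr0 addr0.
  - have i1 ws' := ih j.+1 ws' jk; have i0 ws' := ih j ws' (ltnW jk).
    split=> [|i].
      apply: cvgM; first exact: cont_inv_snd.
      apply: cvgB; first by apply: cvgN; apply: cvg_sumr => l; exact: (i0 _).1.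
      by apply: cvgM; [exact: cvg_cst|exact: (i1 _).1].
    have p2n0 : p.2 ^+ 2 != 0 by rewrite expf_neq0.
    have dI := isd_snd_comp (ex i) (@is_deriveV R (fun t => t ^+ 2) p.2 _ 1 p2n0 (isd_exprn 2 p.2)).
    have dS := isd_sum (index_enum _) (fun l => (i0 (ws ++ [:: l; l])).2 i).
    apply: isd_eq (isdM dI (isdB (isdN dS) (isdZ (2 - 2 * gamma + 2 * j%:R) ((i1 ws).2 i)))) _.
    by rewrite /= mulr0 mulr0 addr0.
have X2 ws j p : 0 < p.2 ->
    is_derive p ey (solution_jet ws j) (p.2 * solution_jet ws j.+1 p).
  move=> p0; have pn0 : p.2 != 0 by rewrite gt_eqF.
  have [k] := ubnP j; elim: k j ws => // k ih [|[|j]] ws jk.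
  - have [d1 _ _ _] := x_derivs_ode ws; apply: isd_eq (d1 p p0) _.
    by rewrite /solution_jet /= mulVKf.
  - have [d1 d2 _ _] := x_derivs_ode ws.
    apply: isd_eq (isdM (@isd_inv_snd 1 p p0) (d2 p p0)) _.
    rewrite /solution_jet /= mulr0 addr0.
    by move: (\sum_i _) ('D_ey _ _) => S D; field.
  - have i1 ws' := ih j.+1 ws' jk; have i0 ws' := ih j ws' (ltnW jk).
    have dS := isd_sum (index_enum _) (fun l => i0 (ws ++ [:: l; l])).
    apply: isd_eq (isdM (@isd_inv_snd 2 p p0)
      (isdB (isdN dS) (isdZ (2 - 2 * gamma + 2 * j%:R) (i1 ws)))) _.
    rewrite -mulr_sumr -/(solution_jet ws j.+2 p) -/(solution_jet ws j.+3 p).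
    have e1 := solution_jet_ode ws j.+1 p0.
    have e0 := solution_jet_ode ws j p0.
    rewrite -[X in - (p.2 * X)]opprK -[\sum_(i <- _) _]opprK.
    rewrite -/(solution_jet ws j.+1 p) -e0 -e1 -[in j.+1%:R]addn1 natrD.
    by field.
by move=> ws j p p0; have [c d] := X1 ws j p p0; split=> //; exact: X2.
Qed.

Lemma solution_jet_bounded ws : exists M, forall p, 0 <= p.2 ->
  `|solution_jet ws 0 p| <= M.
Proof. exact: (x_derivs_bounded gamma_gt0 gamma_neq1 sU jX UX ws). Qed.

Lemma solution_jet_cont ws :
  {within @closed_half_space R n, continuous (solution_jet ws 0)}.
Proof.
change {within @closed_half_space R n, continuous (u ws)}.
exact: (x_derivs_cont gamma_gt0 gamma_neq1 sU jX UX).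
Qed.

Lemma solution_jet_boundary ws x : solution_jet ws 0 (x, 0) = X ws x.
Proof. by have [_] := x_derivs_limit gamma_gt0 gamma_neq1 sU jX UX ws; exact. Qed.

Lemma solution_jet1_bounded ws : exists M, forall x,
  `|solution_jet ws 1 (x, 1)| <= M.
Proof.
have [M0 b0] := solution_jet_bounded ws.
have /choice[N bN] : forall i, exists N, forall p, 0 <= p.2 ->
    `|solution_jet (ws ++ [:: i; i]) 0 p| <= N.
  by move=> i; exact: solution_jet_bounded.
have M0_ge0 : 0 <= M0 by apply: le_trans (b0 0 _).
have N_ge0 i : 0 <= N i by apply: le_trans (bN i 0 _).
have S0 : 0 <= \sum_i N i by apply: sumr_ge0.
have [d1 d2 _ _] := x_derivs_ode ws.
exists (2 `^ `|a| * (2 / 1 + 1) * (M0 + \sum_i N i)) => x.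
have -> : solution_jet ws 1 (x, 1) = du ws (x, 1).
  by rewrite /solution_jet /= invr1 mul1r.
apply: (interpolation (phi := fun t => u ws (x, t)) (phi1 := fun t => du ws (x, t))
  (psi := fun t => Q ws (x, t)) ltr01) => t /andP[t1 _];
  have t0 : 0 < (x, t).2 by exact: lt_le_trans t1.
- exact: (iffRL (isd_ey (u ws) x t _) (d1 _ t0)).
- exact: (iffRL (isd_ey (du ws) x t _) (d2 _ t0)).
- by apply: le_trans (b0 _ (ltW t0)) _; rewrite lerDl.
- rewrite normrN; apply: le_trans (ler_norm_sum _ _ _) _.
  apply: (@le_trans _ _ (\sum_i N i)); last by rewrite lerDr.
  by apply: ler_sum => i _; exact: bN (ltW t0).
Qed.

End SolutionJets.

(** * Borel's theorem *)

Section MTest.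
Variables (R : realType) (T : Type).

(** Weierstrass M-test, for domination after the first [N0] terms. *)
Lemma weierstrass_M (u : nat -> T -> R) (M : nat -> R) (N0 : nat) (D : T -> Prop) :
  cvgn (series M) -> (forall m t, D t -> `|u (m + N0)%N t| <= M m) ->
  forall e : R, 0 < e -> exists N, forall m, (N <= m)%N -> forall t, D t ->
    `|series (u^~ t) m - limn (series (u^~ t))| <= e.
Proof.
move=> cM uM e e0.
have [] := pselect (exists t, D t) => [[t0 Dt0]|noD]; last first.
  by exists 0 => m _ t Dt; case: noD; exists t.
have M0 m : 0 <= M m by apply: le_trans (uM m t0 Dt0).
have : \forall m \near \oo, limn (series M) - series M m <= e.
  move/cvgrPdist_le : (cM) => /(_ e e0); apply: filterS => m.
  by apply: le_trans; exact: ler_norm.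
move=> [N _ HN]; exists (N + N0)%N => m Nm t Dt.
have shift k : series (u^~ t) (k + N0)%N =
    series (u^~ t) N0 + series (fun i => u (i + N0)%N t) k.
  rewrite series_addn; congr (_ + _); rewrite /series /=.
  by rewrite -{1}[N0]add0n big_addn addnK.
have cv : cvgn (series (fun i => u (i + N0)%N t)).
  apply: normed_cvg; apply: (series_le_cvg (v_ := M)) => //= k; exact: (uM k t Dt).
have /cvg_ex[l cl] : cvgn (series (u^~ t)).
  apply/cvg_ex; exists (series (u^~ t) N0 + limn (series (fun i => u (i + N0)%N t))).
  rewrite -(cvg_shiftn N0).
  have -> : [sequence series (u^~ t) (k + N0)%N]_k =
      (fun k => series (u^~ t) N0 + series (fun i => u (i + N0)%N t) k).
    by apply/funext => k; exact: shift.
  by apply: cvgD => //; exact: cvg_cst.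
rewrite (cvg_lim _ cl) // distrC.
have /subnK em : (N0 <= m)%N by apply: leq_trans Nm; exact: leq_addl.
set k := (m - N0)%N in em.
have Nk : (N <= k)%N by rewrite -(leq_add2r N0) em.
apply: (@le_trans _ _ (limn (series M) - series M k)); last exact: HN.
have cl' : `|series (u^~ t) m' - series (u^~ t) m| @[m' --> \oo] --> `|l - series (u^~ t) m|.
  by apply: cvg_norm; apply: cvgB => //; exact: cvg_cst.
apply: (cvgr_to_le cl').
exists m => //= m' mm'.
have /subnK em' : (N0 <= m')%N by apply: leq_trans mm'; rewrite -em leq_addl.
set k' := (m' - N0)%N in em'.
have kk' : (k <= k')%N by rewrite -(leq_add2r N0) em em'.
rewrite -em -em' !shift opprD addrACA subrr add0r sub_series_geq //.
apply: (@le_trans _ _ (series M k' - series M k)); last first.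
  rewrite lerD2r; apply: nondecreasing_cvgn_le => //.
  by apply: nondecreasing_series => i _ _.
rewrite sub_series_geq //; apply: le_trans (ler_norm_sum _ _ _) _.
by apply: ler_sum => i _; exact: (uM i t Dt).
Qed.

End MTest.

Section TaylorKernels.
Variable R : realType.
Implicit Types (lam s : R) (i j k : nat).

(** The [i]-fold primitive of [exp (- lam s)] vanishing to order [i] at 0. For
   large [lam] it is small with its first [i - 1] derivatives on bounded sets:
   this makes the series below converge. *)
Fixpoint iter_prim lam i s : R :=
  match i with
  | 0 => expR (- (lam * s))
  | i1.+1 => (s ^+ i1 / i1`!%:R - iter_prim lam i1 s) / lam
  end.

Definition diter_prim lam k j s : R :=
  if (j <= k)%N then iter_prim lam (k - j) s else (- lam) ^+ (j - k) * iter_prim lam 0 s.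

Lemma fact_deriv i s : i.+1`!%:R^-1 * (i.+1%:R * s) = s / i`!%:R :> R.
Proof.
have f0 : i`!%:R != 0 :> R by rewrite pnatr_eq0 -lt0n fact_gt0.
have i0 : i.+1%:R != 0 :> R by rewrite pnatr_eq0.
rewrite factS natrM; move: (i.+1%:R) (i`!%:R) i0 f0 => A B A0 B0.
by field; rewrite A0 B0.
Qed.

Lemma isd_iter_prim0 lam s :
  is_derive s (1 : R) (iter_prim lam 0) (- lam * iter_prim lam 0 s).
Proof.
have d : is_derive s (1 : R) (fun t : R => - (lam * t)) (- (lam * 1)).
  exact: isdN (isdZ lam (isd_id s)).
apply: isd_eq (isd_comp d (is_derive_expR _)) _.
by rewrite /= mulr1 mulrC.
Qed.

Lemma isd_iter_prim lam i s : lam != 0 ->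
  is_derive s (1 : R) (iter_prim lam i.+1) (iter_prim lam i s).
Proof.
move=> l0; elim: i s => [|i ih] s.
  have -> : iter_prim lam 1 = (fun s => lam^-1 * (1 - iter_prim lam 0 s)).
    by apply/funext => t /=; rewrite expr0 divr1 mulrC.
  apply: isd_eq (isdZ _ (isdB (isd_cst _ _ 1) (isd_iter_prim0 lam s))) _.
  by rewrite sub0r mulNr opprK mulKf.
have -> : iter_prim lam i.+2 = (fun s => lam^-1 *
    ((i.+1`!%:R)^-1 * s ^+ i.+1 - iter_prim lam i.+1 s)).
  by apply/funext => t; rewrite [LHS]/= mulrC [t ^+ _ / _]mulrC.
apply: isd_eq (isdZ _ (isdB (isdZ _ (isd_exprn i.+1 s)) (ih s))) _.
by rewrite [i.+1.-1]/= fact_deriv mulrC.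
Qed.

Lemma isd_diter_prim lam k j s : lam != 0 ->
  is_derive s (1 : R) (diter_prim lam k j) (diter_prim lam k j.+1 s).
Proof.
move=> l0; rewrite /diter_prim.
case: (ltngtP j k) => [jk|kj|->].
- by rewrite -[(k - j)%N]prednK ?subn_gt0 // -subnS; exact: isd_iter_prim.
- have -> : (j.+1 - k)%N = (j - k).+1 by rewrite subSn // ltnW.
  apply: isd_eq (isdZ _ (isd_iter_prim0 lam s)) _.
  by rewrite exprS mulrCA mulrA.
- by rewrite ?leqnn ?ltnn subnn subSnn expr1; exact: isd_iter_prim0.
Qed.

Lemma iter_prim_bounds lam i s : 0 < lam -> 0 <= s ->
  0 <= iter_prim lam i s <= s ^+ i / i`!%:R.
Proof.
move=> l0; have ln0 : lam != 0 by rewrite gt_eqF.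
have iter_prim0 i' : iter_prim lam i'.+1 0 = 0.
  elim: i' => [|i' ih].
    by rewrite /= mulr0 oppr0 expR0 expr0 divr1 subrr mul0r.
  by rewrite [LHS]/= -/(iter_prim lam i'.+1 0) ih expr0n /= mul0r subrr mul0r.
elim: i s => [|i ih] s s0.
  rewrite /= expR_ge0 expr0 divr1 /= -expR0 ler_expR oppr_le0.
  by rewrite mulr_ge0 // ltW.
have d0 t : is_derive t (1 : R) (fun t => i.+1`!%:R^-1 * t ^+ i.+1) (t ^+ i / i`!%:R).
  apply: isd_eq (isdZ _ (isd_exprn i.+1 t)) _.
  by rewrite [i.+1.-1]/= fact_deriv.
have d1 t := @isd_iter_prim lam i t ln0.
have b t : 0 <= t <= s -> 0 <= iter_prim lam i t <= t ^+ i / i`!%:R.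
  by move=> /andP[t0 _]; exact: ih.
have H1 : `|(0 : R) - 0| <= iter_prim lam i.+1 s - iter_prim lam i.+1 0.
  apply: (mvt_le s0 (fun t _ => isd_cst t 1 0) (fun t _ => d1 t)) => t /b/andP[].
  by rewrite normr0.
have H2 : `|iter_prim lam i.+1 s - iter_prim lam i.+1 0| <=
    i.+1`!%:R^-1 * s ^+ i.+1 - i.+1`!%:R^-1 * 0 ^+ i.+1.
  apply: (mvt_le s0 (fun t _ => d1 t) (fun t _ => d0 t)) => t /b/andP[t0 t1].
  by rewrite ger0_norm.
move: H1 H2; rewrite iter_prim0 !subr0 normr0 [0 ^+ _]exprS mul0r mulr0 subr0 => -> H2.
by rewrite [s ^+ _ / _]mulrC (le_trans (ler_norm _)).
Qed.

Lemma diter_prim_small lam k j s : 0 < lam -> 0 <= s -> (j < k)%N ->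
  `|diter_prim lam k j s| <= exp_coeff s (k - j).-1 / lam.
Proof.
move=> l0 s0 jk; rewrite /diter_prim (ltnW jk).
have : (0 < k - j)%N by rewrite subn_gt0.
case: (k - j)%N => // i _.
have /andP[b1 _] := iter_prim_bounds i.+1 l0 s0.
have /andP[b2 _] := iter_prim_bounds i l0 s0.
rewrite ger0_norm // /= ler_pM2r ?invr_gt0 //.
by rewrite gerBl.
Qed.

Lemma diter_prim_bounded lam k j s : 0 < lam -> 0 <= s <= 1 ->
  `|diter_prim lam k j s| <= 1 + lam ^+ (j - k).
Proof.
move=> l0 /andP[s0 s1].
have b i : `|iter_prim lam i s| <= 1.
  have /andP[b1 b2] := iter_prim_bounds i l0 s0.
  rewrite ger0_norm //; apply: le_trans b2 _.
  rewrite ler_pdivrMr ?ltr0n ?fact_gt0 // mul1r (le_trans (exprn_ile1 _ _ _)) //.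
  by rewrite ler1n fact_gt0.
rewrite /diter_prim; case: ifP => _.
  by apply: le_trans (b _) _; rewrite lerDl exprn_ge0 // ltW.
rewrite normrM normrX normrN (gtr0_norm l0); apply: (@le_trans _ _ (lam ^+ (j - k))).
  by rewrite ler_piMr // exprn_ge0 // ltW.
by rewrite lerDr.
Qed.

Lemma diter_prim_at0 lam k j :
  diter_prim lam k j 0 = if (k <= j)%N then (- lam) ^+ (j - k) else 0.
Proof.
have e0 : iter_prim lam 0 0 = 1 by rewrite /= mulr0 oppr0 expR0.
have eS i' : iter_prim lam i'.+1 0 = 0.
  elim: i' => [|i' ih].
    by rewrite /= mulr0 oppr0 expR0 expr0 divr1 subrr mul0r.
  by rewrite [LHS]/= -/(iter_prim lam i'.+1 0) ih expr0n /= mul0r subrr mul0r.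
rewrite /diter_prim; case: (ltngtP j k) => [jk|kj|->].
- have : (0 < k - j)%N by rewrite subn_gt0.
  by case: (k - j)%N.
- by rewrite e0 mulr1.
- by rewrite !subnn e0 expr0.
Qed.

End TaylorKernels.

Section Borel.
Variables (R : realType) (n : nat).
Local Notation V := ('rV[R]_n * R)%type.
Local Notation T := (seq 'I_n -> 'rV[R]_n -> R).
Local Notation ex := (@ex R n).
Local Notation ey := (@ey R n).
Implicit Types (p q : V) (ws : seq 'I_n) (i j k : nat).

Lemma x_jet_lin (c : R) (X Y : T) : x_jet X -> x_jet Y ->
  x_jet (fun ws x => X ws x - c * Y ws x).
Proof.
move=> [dX bX cX] [dY bY cY]; split=> [ws i x|ws|ws x].
- by apply: isdB => //; exact: isdZ.
- have [M bM] := bX ws; have [N bN] := bY ws; exists (M + `|c| * N) => x.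
  by apply: le_trans (ler_normB _ _) _; rewrite lerD // normrM ler_wpM2l.
- have cc : {for x, continuous (fun=> c : R^o)} by exact: cst_continuous.
  exact: (continuousB (cX ws x) (continuousM cc (cY ws x))).
Qed.

(* Only countably many seminorms have to be controlled, and the k-th decay
   rate takes care of those numbered at most k. *)
Lemma decay_exists k (g : T) : exists l : R, 1 <= l /\
  (x_jet g -> forall ws, (pickle ws <= k)%N -> forall x, `|g ws x| <= l).
Proof.
have [[dg bg _]|ng] := pselect (x_jet g); last by exists 1.
have [N bN] := choice bg.
pose b i := if unpickle i is Some ws then `|N ws| else 0.
have b0 i : 0 <= b i by rewrite /b; case: unpickle.
have S0 : 0 <= \sum_(i < k.+1) b i by apply: sumr_ge0.
exists (1 + \sum_(i < k.+1) b i); split=> [|_ ws wsk x]; first by rewrite lerDl.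
apply: le_trans (bN ws x) _; apply: (@le_trans _ _ (b (pickle ws))).
  by rewrite /b pickleK ler_norm.
have wsk1 : (pickle ws < k.+1)%N by [].
rewrite (bigD1 (Ordinal wsk1)) //= addrCA lerDl addr_ge0 //.
by apply: sumr_ge0.
Qed.

Section Construction.
Variables (A : nat -> T) (decay : nat -> T -> R).
Hypothesis A_jet : forall j, x_jet (A j).
Hypothesis decay_ge1 : forall k g, 1 <= decay k g.
Hypothesis decayP : forall k g, x_jet g ->
  forall ws, (pickle ws <= k)%N -> forall x, `|g ws x| <= decay k g.

(** What is left to prescribe of the Taylor coefficients [A] after the first [k]
   terms of the series. *)
Fixpoint residual k : nat -> T :=
  match k with
  | 0 => A
  | k1.+1 => fun i ws x => residual k1 i ws x -
      (if (k1 <= i)%N then (- decay k1 (residual k1 k1)) ^+ (i - k1) else 0) *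
      residual k1 k1 ws x
  end.

Local Notation g := (fun k => residual k k).
Local Notation lam := (fun k => decay k (residual k k)).

Lemma residual_jet k i : x_jet (residual k i).
Proof. by elim: k i => [|k ih] i //=; exact: x_jet_lin. Qed.

Lemma lam_gt0 k : 0 < lam k.
Proof. by apply: lt_le_trans ltr01 (decay_ge1 _ _). Qed.

Lemma residualE k j ws x : residual k j ws x = A j ws x -
  \sum_(i < k) (if (i <= j)%N then (- lam i) ^+ (j - i) else 0) * g i ws x.
Proof.
elim: k => [|k ih]; first by rewrite big_ord0 subr0.
by rewrite big_ord_recr /= ih opprD addrA.
Qed.

Lemma taylor_coefE j ws x :
  \sum_(i < j.+1) (if (i <= j)%N then (- lam i) ^+ (j - i) else 0) * g i ws x = A j ws x.
Proof.
apply/eqP; rewrite eq_sym -subr_eq0 -residualE /= leqnn subnn expr0 mul1r.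
by rewrite subrr.
Qed.

Definition borel_term ws j k p : R :=
  g k ws p.1 * diter_prim (lam k) k j (p.2 ^+ 2 / 2).

Definition borel_sum ws j p : R := limn (series ((borel_term ws j)^~ p)).

Lemma borel_term_bound ws j (Y : R) k p : 0 <= Y -> `|p.2| <= Y ->
  `|borel_term ws j (k + (pickle ws + j.+1))%N p| <=
  (Y ^+ 2 / 2) ^+ pickle ws * exp_coeff (Y ^+ 2 / 2) k.
Proof.
move=> Y0 pY; rewrite /borel_term; set K := (_ + _)%N.
have l0 := lam_gt0 K.
have s0 : 0 <= p.2 ^+ 2 / 2 by rewrite divr_ge0 // sqr_ge0.
have sS : p.2 ^+ 2 / 2 <= Y ^+ 2 / 2.
  by rewrite ler_pM2r ?invr_gt0 // -real_normK ?num_real // lerXn2r // nnegrE.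
have jK : (j < K)%N by rewrite /K addnA leq_addl.
have wsK : (pickle ws <= K)%N by rewrite /K addnCA leq_addr.
rewrite normrM; apply: (@le_trans _ _ (lam K *
   (exp_coeff (p.2 ^+ 2 / 2) (K - j).-1 / lam K))).
  apply: ler_pM => //; first exact: (decayP (residual_jet _ _) wsK).
  exact: diter_prim_small.
rewrite mulrCA divff ?mulr1 ?gt_eqF //.
have -> : (K - j).-1 = (k + pickle ws)%N by rewrite /K addnA addnS subSn ?leq_addl // addnK.
move: (Y ^+ 2 / 2) (p.2 ^+ 2 / 2) s0 sS => S s s0 sS.
have S0 : 0 <= S by apply: le_trans sS.
rewrite /exp_coeff /=; apply: (@le_trans _ _ (S ^+ (k + pickle ws) / k`!%:R)).
  apply: ler_pM; rewrite ?exprn_ge0 ?invr_ge0 // ?lerXn2r ?nnegrE //.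
  by rewrite lef_pV2 ?posrE ?ltr0n ?fact_gt0 // ler_nat leq_fact // leq_addr.
by rewrite exprD [S ^+ k * _]mulrC mulrA.
Qed.

Lemma borel_approx ws j (Y e : R) : 0 <= Y -> 0 < e -> exists N, forall m, (N <= m)%N ->
  forall p, `|p.2| <= Y ->
  `|series ((borel_term ws j)^~ p) m - borel_sum ws j p| <= e.
Proof.
move=> Y0 e0.
apply: (@weierstrass_M R V (borel_term ws j)
   (fun k => (Y ^+ 2 / 2) ^+ pickle ws * exp_coeff (Y ^+ 2 / 2) k)
   (pickle ws + j.+1)%N (fun p => `|p.2| <= Y)) e0.
  have -> : (fun k => (Y ^+ 2 / 2) ^+ pickle ws * exp_coeff (Y ^+ 2 / 2) k) =
    ((Y ^+ 2 / 2) ^+ pickle ws) *: (exp_coeff (Y ^+ 2 / 2) : R^o^nat) by [].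
  by apply: is_cvg_seriesZ; exact: is_cvg_series_exp_coeff.
by move=> m p pY; exact: borel_term_bound.
Qed.

Lemma isd_borel_term_x ws j k p (i : 'I_n) :
  is_derive p (ex i) (borel_term ws j k) (borel_term (i :: ws) j k p).
Proof.
have [dg _ _] := residual_jet k k.
have dG : is_derive p (ex i) (fun q : V => g k ws q.1) (g k (i :: ws) p.1).
  rewrite -[p]addr0 -(scale0r (ex i)); apply/isd_line.
  have -> : (fun t : R => g k ws (p + t *: ex i).1) =
     (fun t : R => g k ws (p.1 + t *: delta_mx 0 i)) by [].
  by have := isd_line0 (dg ws i p.1); rewrite scale0r addr0.
have dl : lam k != 0 by rewrite gt_eqF // lam_gt0.
have dD := isd_snd_comp (ex i) (isd_comp (isdZ 2^-1 (isd_exprn 2 p.2))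
   (isd_diter_prim k j (2^-1 * p.2 ^+ 2) dl)).
have -> : borel_term ws j k = (fun q => g k ws q.1 *
    diter_prim (lam k) k j (2^-1 * q.2 ^+ 2)).
  by apply/funext => q; rewrite /borel_term mulrC [_ / 2]mulrC mulrC.
apply: isd_eq (isdM dG dD) _.
by rewrite /= mulr0 mulr0 add0r mulrC /borel_term [_ / 2]mulrC.
Qed.

Lemma isd_borel_term_y ws j k p :
  is_derive p ey (borel_term ws j k) (p.2 * borel_term ws j.+1 k p).
Proof.
have dl : lam k != 0 by rewrite gt_eqF // lam_gt0.
have dD := isd_snd_comp ey (isd_comp (isdZ 2^-1 (isd_exprn 2 p.2))
   (isd_diter_prim k j (2^-1 * p.2 ^+ 2) dl)).
have dG : is_derive p ey (fun q : V => g k ws q.1) 0.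
  rewrite -[p]addr0 -(scale0r ey); apply/isd_line.
  have -> : (fun t : R => g k ws (p + t *: ey).1) = (fun=> g k ws p.1).
    by apply/funext => t; rewrite /= scaler0 addr0.
  exact: isd_cst.
have -> : borel_term ws j k = (fun q => g k ws q.1 *
    diter_prim (lam k) k j (2^-1 * q.2 ^+ 2)).
  by apply/funext => q; rewrite /borel_term mulrC [_ / 2]mulrC mulrC.
apply: isd_eq (isdM dG dD) _.
rewrite mulr0 addr0 /borel_term [_ / 2]mulrC /= expr1 mulr1.
by move: (diter_prim _ _ _ _) => D; field.
Qed.

Lemma isd_series (u du : nat -> V -> R) p v m :
  (forall k, is_derive p v (u k) (du k p)) ->
  is_derive p v (fun q => series (u^~ q) m) (series (du^~ p) m).
Proof. by move=> ud; exact: isd_sum. Qed.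

Lemma isd_borel_x ws j p (i : 'I_n) :
  is_derive p (ex i) (borel_sum ws j) (borel_sum (i :: ws) j p).
Proof.
rewrite -[p]addr0 -(scale0r (ex i)); apply/isd_line.
apply: (@isd_approx R _ (fun t => borel_sum (i :: ws) j (p + t *: ex i)) 0 1) => // e e0.
have [N1 h1] := borel_approx ws j (normr_ge0 p.2) e0.
have [N2 h2] := borel_approx (i :: ws) j (normr_ge0 p.2) e0.
exists (fun t => series ((borel_term ws j)^~ (p + t *: ex i)) (maxn N1 N2)),
  (fun t => series ((borel_term (i :: ws) j)^~ (p + t *: ex i)) (maxn N1 N2)) => t _.
split.
- have d := @isd_series (borel_term ws j) (borel_term (i :: ws) j) (p + t *: ex i)
    (ex i) (maxn N1 N2) (fun k => isd_borel_term_x ws j k _ i).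
  exact: (iffRL (isd_line _ _ _ _ _) d).
- by apply: h1; [exact: leq_maxl|rewrite shift_exE'].
- by apply: h2; [exact: leq_maxr|rewrite shift_exE'].
Qed.

Lemma isd_borel_y ws j p :
  is_derive p ey (borel_sum ws j) (p.2 * borel_sum ws j.+1 p).
Proof.
case: p => x y /=; apply/isd_ey.
apply: (@isd_approx R _ (fun t => t * borel_sum ws j.+1 (x, t)) y 1) => // e e0.
have Y0 : 0 < `|y| + 1 by rewrite ltr_wpDl.
have [N1 h1] := borel_approx ws j (ltW Y0) e0.
have [N2 h2] := borel_approx ws j.+1 (ltW Y0) (divr_gt0 e0 Y0).
exists (fun t => series ((borel_term ws j)^~ (x, t)) (maxn N1 N2)),
  (fun t => t * series ((borel_term ws j.+1)^~ (x, t)) (maxn N1 N2)) => t ty.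
have tY : `|t| <= `|y| + 1.
  have -> : t = y + (t - y) by ring.
  by apply: le_trans (ler_normD _ _) _; rewrite lerD2l ltW.
split.
- have d := @isd_series (borel_term ws j) (fun k q => q.2 * borel_term ws j.+1 k q) (x, t)
    ey (maxn N1 N2) (fun k => isd_borel_term_y ws j k _).
  by apply: isd_eq (iffRL (isd_ey _ _ _ _) d) _; rewrite /series /= mulr_sumr.
- by apply: h1; [exact: leq_maxl|].
- rewrite -mulrBr normrM.
  have H : _ <= e / (`|y| + 1) := h2 _ (leq_maxr N1 N2) (x, t) tY.
  apply: le_trans (ler_pM _ _ tY H) _ => //.
  by rewrite mulrCA divff ?mulr1 // gt_eqF.
Qed.

Lemma borel_term_cont ws j k : continuous (borel_term ws j k).
Proof.
move=> p; apply: cvgM; last first.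
  have dl : lam k != 0 by rewrite gt_eqF // lam_gt0.
  apply: (@continuous_comp _ _ _ (fun q : V => q.2 ^+ 2 / 2) (diter_prim (lam k) k j)).
    by apply: cvgM; [exact: cont_snd_exp|exact: cvg_cst].
  exact: isd_cont (isd_diter_prim k j _ dl).
have [_ _ cg] := residual_jet k k.
by apply: (@continuous_comp _ _ _ fst (g k ws)); [exact: cvg_fst|exact: cg].
Qed.

Lemma borel_sum_cont ws j :
  {within @closed_half_space R n, continuous (borel_sum ws j)}.
Proof.
apply: closed_cont_approx => p e p0 e0.
have Y0 : 0 <= p.2 + 1 by rewrite addr_ge0.
have [N h] := borel_approx ws j Y0 e0.
exists (fun q => series ((borel_term ws j)^~ q) N); split.
  apply: cont_closed => q; apply: cvg_sumr => k; exact: borel_term_cont.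
have c : (fun q : V => q.2) @ p --> p.2 by exact: cvg_snd.
have : \forall q \near p, q.2 < p.2 + 1 by move/cvgr_lt : c; apply; rewrite ltrDl.
apply: filterS => q qp q0; rewrite distrC; apply: h => //.
by rewrite ger0_norm // ltW.
Qed.

Lemma borel_sum_bounded ws j : exists M, forall p, 0 <= p.2 <= 1 ->
  `|borel_sum ws j p| <= M.
Proof.
have [N h] := borel_approx ws j ler01 ltr01.
have /choice[G bG] : forall k, exists G, forall x, `|g k ws x| <= G.
  by move=> k; have [_ b _] := residual_jet k k; exact: b.
exists (1 + \sum_(0 <= k < N) (G k * (1 + lam k ^+ (j - k)))) => p /andP[p0 p1].
have pn : `|p.2| <= 1 by rewrite ger0_norm.
have := h N (leqnn _) p pn; set s := series _ _ => hs.
have -> : borel_sum ws j p = - (s - borel_sum ws j p) + s by ring.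
apply: le_trans (ler_normD _ _) _; rewrite normrN; apply: lerD => //.
rewrite /s /series /=; apply: le_trans (ler_norm_sum _ _ _) _; apply: ler_sum => k _.
rewrite normrM; apply: ler_pM => //; apply: diter_prim_bounded; first exact: lam_gt0.
rewrite divr_ge0 ?sqr_ge0 //= ler_pdivrMr // mul1r.
by rewrite (le_trans (exprn_ile1 _ _ _)) // ler1n.
Qed.

Lemma borel_sum_at0 ws j x : borel_sum ws j (x, 0) = A j ws x.
Proof.
apply: cvg_lim => //; apply: cvg_near_cst.
exists j.+1 => //= m jm.
rewrite /series /= -(taylor_coefE j ws x) (big_cat_nat (n := j.+1)) //=.
rewrite [X in _ + X]big_nat_cond [X in _ + X]big1 ?addr0; last first.
  move=> k /andP[/andP[jk _] _]; rewrite /borel_term /= expr0n mul0r diter_prim_at0.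
  by rewrite leqNgt jk mulr0.
rewrite big_mkord; apply: eq_bigr => k _.
by rewrite /borel_term /= expr0n mul0r diter_prim_at0 mulrC.
Qed.

End Construction.

(** The sum of the terms [borel_term]: the k-th one contributes the coefficient of
   order k that the preceding ones leave to prescribe, and its decay rate is
   large enough to make the series converge with all derivatives. *)
Theorem borel (A : nat -> T) : (forall j, x_jet (A j)) ->
  exists F : seq 'I_n -> nat -> V -> R,
  [/\ interior_jet F,
      forall ws j, {within @closed_half_space R n, continuous (F ws j)},
      forall ws j, exists M, forall p, 0 <= p.2 <= 1 -> `|F ws j p| <= M
    & forall ws j x, F ws j (x, 0) = A j ws x].
Proof.
move=> jA.
have /choice[c cP] : forall kg : nat * T, exists l : R, 1 <= l /\
  (x_jet kg.2 -> forall ws, (pickle ws <= kg.1)%N -> forall x, `|kg.2 ws x| <= l).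
  by move=> [k g]; exact: decay_exists.
pose decay k g := c (k, g).
have c1 k g : 1 <= decay k g by have [] := cP (k, g).
have c2 k g : x_jet g -> forall ws, (pickle ws <= k)%N -> forall x, `|g ws x| <= decay k g.
  by have [_] := cP (k, g).
exists (borel_sum A decay); split.
- move=> ws j p p0; split.
  + by apply: closed_cont_interior p0; exact: borel_sum_cont.
  + by move=> i; exact: isd_borel_x.
  + exact: isd_borel_y.
- exact: borel_sum_cont.
- exact: borel_sum_bounded.
- exact: borel_sum_at0.
Qed.

End Borel.

(** * Powers of the distance to the boundary *)

(** The mean value inequality on [[t, y]], with t tending to 0. *)
Lemma bound_from_zero (R : realType) (phi dphi g dg : R -> R) (y : R) : 0 < y ->
  (forall t, 0 < t <= y -> is_derive t (1 : R) phi (dphi t)) ->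
  (forall t, 0 < t <= y -> is_derive t (1 : R) g (dg t)) ->
  (forall t, 0 < t <= y -> `|dphi t| <= dg t) ->
  (forall t, 0 < t <= y -> 0 <= g t) ->
  phi t @[t --> (0 : R)^'+] --> (0 : R) -> `|phi y| <= g y.
Proof.
move=> y0 d1 d2 le g0 lim0; apply/ler_addgt0Pr => e e0.
have : \forall t \near (0 : R)^'+, `|phi y| <= g y + e.
  near=> t.
  have t0 : 0 < t by near: t; exact: nbhs_right_gt.
  have ty : t <= y by near: t; exact: nbhs_right_le.
  have pt : `|phi t| <= e.
    by near: t; move/cvgr0Pnorm_le : lim0; apply.
  have sub s : t <= s <= y -> 0 < s <= y.
    by move=> /andP[s1 s2]; rewrite s2 (lt_le_trans t0).
  have := mvt_le ty (fun s h => d1 s (sub s h)) (fun s h => d2 s (sub s h))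
    (fun s h => le s (sub s h)).
  have gt0 : 0 <= g t by apply: g0; rewrite t0.
  have := ler_normD (phi y - phi t) (phi t); rewrite subrK; lra.
by move=> /filter_ex[].
Unshelve. all: by end_near. Qed.

Section PowJets.
Variables (R : realType) (n : nat).
Local Notation V := ('rV[R]_n * R)%type.
Local Notation ex := (@ex R n).
Local Notation ey := (@ey R n).
Implicit Types (p q : V) (W : V -> R) (ws : seq 'I_n) (i : 'I_n) (r : R) (j k : nat).

Lemma closed_cont_boundary W x : {within @closed_half_space R n, continuous W} ->
  W (x, t) @[t --> (0 : R)^'+] --> W (x, 0).
Proof.
move=> /closed_contP c; apply/cvgrPdist_lt => e e0.
have := c (x, 0) (lexx 0) e e0 => H.
have cl : (fun t : R => (x, t) : V) @ (0 : R) --> (x, 0 : R).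
  by apply: (@cvg_pair _ _ _ _ (nbhs x) (nbhs (0 : R))); [exact: cvg_cst|exact: cvg_id].
have {}H : \forall t \near (0 : R), 0 <= t -> `|W (x, 0) - W (x, t)| < e := cl _ H.
by rewrite near_withinE; apply: filterS H => t H t0; exact: (H (ltW t0)).
Qed.

(** Powers of y^-1 d/dy applied to the product of a power [y^r] with the
   function whose own such derivatives are [J]. *)
Fixpoint pow_jet r (J : nat -> V -> R) j p : R :=
  match j with
  | 0 => p.2 `^ r * J 0 p
  | j1.+1 => pow_jet r (fun k => J k.+1) j1 p + r * pow_jet (r - 2) J j1 p
  end.

Lemma pow_jet_cont r J j p : 0 < p.2 -> (forall k, {for p, continuous (J k)}) ->
  {for p, continuous (pow_jet r J j)}.
Proof.
move=> p0; elim: j r J => [|j ih] r J Jc.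
  apply: continuousM (Jc 0).
  apply: (@continuous_comp _ _ _ snd (fun t : R => t `^ r)); first exact: cvg_snd.
  exact: isd_cont (isd_powR r p0).
have cc : {for p, continuous (fun=> r : R^o)} by exact: cst_continuous.
apply: (continuousD (ih r _ (fun k => Jc k.+1))).
exact: (continuousM cc (ih (r - 2) J Jc)).
Qed.

Lemma isd_pow_jet_x r (J J' : nat -> V -> R) j p i : 0 < p.2 ->
  (forall k, is_derive p (ex i) (J k) (J' k p)) ->
  is_derive p (ex i) (pow_jet r J j) (pow_jet r J' j p).
Proof.
move=> p0; elim: j r J J' => [|j ih] r J J' d.
  apply: isd_eq (isdM (isd_snd_comp (ex i) (isd_powR r p0)) (d 0)) _.
  by rewrite /= mulr0 mulr0 addr0.
exact: (isdD (ih r _ _ (fun k => d k.+1)) (isdZ r (ih (r - 2) _ _ d))).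
Qed.

Lemma isd_pow_jet_y r (J : nat -> V -> R) j p : 0 < p.2 ->
  (forall k, is_derive p ey (J k) (p.2 * J k.+1 p)) ->
  is_derive p ey (pow_jet r J j) (p.2 * pow_jet r J j.+1 p).
Proof.
move=> p0; elim: j r J => [|j ih] r J d.
  apply: isd_eq (isdM (isd_snd_comp ey (isd_powR r p0)) (d 0)) _.
  rewrite /= mulr1 (powR_step (r - 1) p0) (_ : r - 1 - 1 = r - 2); last by ring.
  by ring.
apply: isd_eq (isdD (ih r _ (fun k => d k.+1)) (isdZ r (ih (r - 2) _ d))) _.
by rewrite [in RHS]/=; rewrite [in LHS]/=; ring.
Qed.

Lemma mul_pow_jet r J : interior_jet J ->
  @interior_jet R n (fun ws => pow_jet r (J ws)).
Proof.
move=> hJ ws j p p0; split.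
- by apply: pow_jet_cont => // k; have [] := hJ ws k p p0.
- by move=> i; apply: isd_pow_jet_x => // k; have [_ + _] := hJ ws k p p0.
- by apply: isd_pow_jet_y => // k; have [] := hJ ws k p p0.
Qed.

Lemma interior_jetB J J' : @interior_jet R n J -> interior_jet J' ->
  interior_jet (fun ws j p => J ws j p - J' ws j p).
Proof.
move=> h h' ws j p p0; have [c dx dy] := h ws j p p0; have [c' dx' dy'] := h' ws j p p0.
split; first exact: (continuousB c c').
  by move=> i; exact: isdB.
by apply: isd_eq (isdB dy dy') _; rewrite mulrBr.
Qed.

Lemma interior_jetD J J' : @interior_jet R n J -> interior_jet J' ->
  interior_jet (fun ws j p => J ws j p + J' ws j p).
Proof.
move=> h h' ws j p p0; have [c dx dy] := h ws j p p0; have [c' dx' dy'] := h' ws j p p0.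
split; first exact: (continuousD c c').
  by move=> i; exact: isdD.
by apply: isd_eq (isdD dy dy') _; rewrite mulrDr.
Qed.

Local Notation strip p := (0 < p.2 <= 1).

(** Bounds for the derivatives are integrated from the boundary, one power of y
   at a time. *)
Lemma flat_decay J : interior_jet J ->
  (forall ws j, {within @closed_half_space R n, continuous (J ws j)}) ->
  (forall ws j x, J ws j (x, 0) = 0) ->
  (forall ws j, exists C, forall p, strip p -> `|J ws j p| <= C) ->
  forall N ws j, exists C, 0 <= C /\ forall p, strip p -> `|J ws j p| <= C * p.2 ^+ N.
Proof.
move=> hJ cJ zJ bJ; elim=> [|N ih] ws j.
  have [C bC] := bJ ws j; exists `|C|; split=> // p sp.
  by rewrite expr0 mulr1 (le_trans (bC p sp)) // ler_norm.
have [C [C0 bC]] := ih ws j.+1; exists C; split=> // -[x y] /= /andP[y0 y1].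
apply: (bound_from_zero (phi := fun t => J ws j (x, t)) (g := fun t => C * t ^+ N.+1)
   (dphi := fun t => t * J ws j.+1 (x, t)) (dg := fun t => C * (N.+1%:R * t ^+ N)) y0)
   => [t /andP[t0 ty]|t /andP[t0 ty]|t /andP[t0 ty]|t /andP[t0 ty]|].
- by apply/isd_ey; have [_ _] := hJ ws j (x, t) t0.
- exact: (isdZ C (isd_exprn N.+1 t)).
- have t1 : t <= 1 by apply: le_trans y1.
  rewrite normrM gtr0_norm //; apply: (@le_trans _ _ (C * t ^+ N)).
    apply: (@le_trans _ _ `|J ws j.+1 (x, t)|); first by rewrite ler_piMl.
    by apply: bC; rewrite /= t0.
  by rewrite ler_wpM2l // ler_peMl ?ler1n // exprn_ge0 // ltW.
- by rewrite mulr_ge0 // exprn_ge0 // ltW.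
- by have := @closed_cont_boundary _ x (cJ ws j); rewrite zJ.
Qed.

Lemma flat_pow_bounded r (J : nat -> V -> R) j :
  (forall N k, exists C, 0 <= C /\ forall p, strip p -> `|J k p| <= C * p.2 ^+ N) ->
  exists C, forall p, strip p -> `|pow_jet r J j p| <= C.
Proof.
elim: j r J => [|j ih] r J H.
  have [C [C0 bC]] := H (Num.truncn `|r|).+1 0; exists C => p sp.
  have /andP[p0 p1] := sp.
  rewrite normrM ger0_norm ?powR_ge0 //.
  apply: le_trans (ler_wpM2l (powR_ge0 _ _) (bC p sp)) _.
  rewrite mulrCA ler_piMr // -powR_mulrn ?(ltW p0) // -powRD ?(gt_eqF p0) ?implybT //.
  rewrite -[leRHS](powRr0 p.2); apply: ger_powR; first by rewrite p0.
  have /ltW := real_truncnS_gt (num_real `|r|); have := lerNnormlW (lexx `|r|).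
  by lra.
have [C1 b1] := ih r (fun k => J k.+1) (fun N k => H N k.+1).
have [C2 b2] := ih (r - 2) J H.
exists (C1 + `|r| * C2) => p sp; apply: le_trans (ler_normD _ _) _.
by rewrite lerD ?b1 // normrM ler_wpM2l // b2.
Qed.

(** A bound for the next derivative makes each member of the jet Lipschitz in y,
   uniformly in x. *)
Lemma jet_extend J : interior_jet J ->
  (forall ws j, exists C, forall p, strip p -> `|J ws j p| <= C) ->
  exists J', [/\ interior_jet J',
    forall ws j, {within @closed_half_space R n, continuous (J' ws j)}
    & forall ws j p, 0 < p.2 -> J' ws j p = J ws j p].
Proof.
move=> hJ bJ.
have lip ws j : exists C, 0 <= C /\ forall x s t, 0 < s <= 1 -> 0 < t <= 1 ->
    `|J ws j (x, t) - J ws j (x, s)| <= C * `|t - s|.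
  have [C bC] := bJ ws j.+1; exists `|C|; split=> // x s t /andP[s0 s1] /andP[t0 t1].
  have sub z : Num.min s t <= z <= Num.max s t -> 0 < z <= 1.
    by case: (leP s t) => _ /andP[z1 z2]; rewrite (lt_le_trans _ z1) // (le_trans z2).
  apply: (mvt_dist (f := fun z => J ws j (x, z)) (df := fun z => z * J ws j.+1 (x, z))).
    move=> z /sub/andP[z0 _]; apply/isd_ey.
    by have [_ _] := hJ ws j (x, z) z0.
  move=> z /sub/andP[z0 z1]; rewrite normrM gtr0_norm //.
  apply: (@le_trans _ _ `|J ws j.+1 (x, z)|); first by rewrite ler_piMl.
  by apply: le_trans (ler_norm C); apply: bC; rewrite /= z0.
pose bd ws j x : R := lim (J ws j (x, t) @[t --> (0 : R)^'+]).
have bdP ws j x : J ws j (x, t) @[t --> (0 : R)^'+] --> bd ws j x.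
  have [C [C0 L]] := lip ws j.
  apply: cauchy_cvg; apply/cauchy_ballP => e e0; rewrite /= near_map2.
  pose d := Num.min 1 (e / (C + 1)).
  have d0 : 0 < d by rewrite lt_min ltr01 divr_gt0 // ltr_wpDl.
  exists ((fun t : R => is_true (0 < t <= d)), (fun t : R => is_true (0 < t <= d))) => /=.
    by split; near=> t; (apply/andP; split; near: t; [exact: nbhs_right_gt|exact: nbhs_right_le]).
  move=> [s t] /= [/andP[s0 sd] /andP[t0 td]]; rewrite /ball /= distrC.
  have dd : d <= 1 by rewrite ge_min lexx.
  have de : d <= e / (C + 1) by rewrite ge_min lexx orbT.
  apply: le_lt_trans (L x s t _ _) _; rewrite ?s0 ?t0 /= ?(le_trans sd) ?(le_trans td) //.
  have : `|t - s| <= d by rewrite ler_norml; lra.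
  move=> ts; apply: le_lt_trans (ler_wpM2l C0 (le_trans ts de)) _.
  by rewrite mulrCA gtr_pMr // ltr_pdivrMr ?mul1r ?ltrDl // ltr_wpDl.
pose J' ws j (p : V) := if 0 < p.2 then J ws j p else bd ws j p.1.
have E ws j p : 0 < p.2 -> J' ws j p = J ws j p by rewrite /J' => ->.
exists J'; split=> //.
  move=> ws j p p0; have [c dx dy] := hJ ws j p p0.
  have E' ws' j' q : 0 < q.2 -> J ws' j' q = J' ws' j' q by move=> /E ->.
  split.
  - exact: (cont_half_space_eq (E' ws j) p0 c).
  - by move=> i; rewrite E //; exact: (isd_half_space_eq (E' ws j) p0 (dx i)).
  - by rewrite E //; exact: (isd_half_space_eq (E' ws j) p0 dy).
move=> ws j; apply/closed_contP => p; rewrite le_eqVlt => /predU1P[p0|p0] e e0; last first.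
  have [c _ _] := hJ ws j p p0; move/cvgrPdist_lt : c => /(_ e e0) c.
  near=> q => q0; rewrite !E //; first by near: q.
  by near: q; exact: near_half_space.
have [C [C0 L]] := lip ws j.
pose d := Num.min 1 (e / (4 * (C + 1))).
have d0 : 0 < d by rewrite lt_min ltr01 divr_gt0 // mulr_gt0 // ltr_wpDl.
have dd : d <= 1 by rewrite ge_min lexx.
have Cd : C * d <= e / 4.
  have de : d <= e / (4 * (C + 1)) by rewrite ge_min lexx orbT.
  apply: le_trans (ler_wpM2l C0 de) _.
  have -> : C * (e / (4 * (C + 1))) = e / 4 * (C / (C + 1)).
    by field; rewrite gt_eqF // ltr_wpDl.
  by rewrite ger_pMr ?divr_gt0 // ler_pdivrMr ?mul1r ?lerDl // ltr_wpDl.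
have close (q : V) : 0 <= q.2 < d -> `|J' ws j q - J ws j (q.1, d)| <= e / 4.
  case: q => x y /= /andP[]; rewrite le_eqVlt => /predU1P[<- _|y0 yd].
    rewrite /J' /= ltxx.
    have cl : `|J ws j (x, t) - J ws j (x, d)| @[t --> (0 : R)^'+] -->
        `|bd ws j x - J ws j (x, d)|.
      by apply: cvg_norm; apply: cvgB; [exact: bdP|exact: cvg_cst].
    apply: (cvgr_to_le cl); near=> t.
    have t0 : 0 < t by near: t; exact: nbhs_right_gt.
    have td : t <= d by near: t; exact: nbhs_right_le.
    apply: le_trans (L x d t _ _) _; rewrite ?d0 ?t0 //= ?(le_trans td) //.
    apply: le_trans Cd; rewrite ler_wpM2l // distrC ger0_norm ?subr_ge0 //; lra.
  rewrite E //; apply: le_trans (L x d y _ _) _; rewrite ?d0 ?y0 //= ?(le_trans (ltW yd)) //.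
  apply: le_trans Cd; rewrite ler_wpM2l // distrC ger0_norm ?subr_ge0 ?(ltW yd) //; lra.
have [c _ _] := hJ ws j (p.1, d) d0.
have c1 : {for p, continuous (fun q : V => J ws j (q.1, d))}.
  apply: (@continuous_comp _ _ _ (fun q : V => (q.1, d) : V) (J ws j)); last exact: c.
  by apply: (@cvg_pair _ _ _ _ (nbhs p.1) (nbhs d)); [exact: cvg_fst|exact: cvg_cst].
have e4 : 0 < e / 4 by rewrite divr_gt0.
near=> q => q0.
have h1 : `|J' ws j p - J ws j (p.1, d)| <= e / 4 by apply: close; rewrite -p0 lexx.
have h2 : `|J' ws j q - J ws j (q.1, d)| <= e / 4.
  apply: close; rewrite q0 /=; near: q.
  have c2 : (fun q : V => q.2) @ p --> p.2 by exact: cvg_snd.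
  by move/cvgr_lt : c2; apply; rewrite -p0.
have h3 : `|J ws j (p.1, d) - J ws j (q.1, d)| < e / 4.
  by near: q; move/cvgrPdist_lt : c1; apply.
have -> : J' ws j p - J' ws j q = (J' ws j p - J ws j (p.1, d)) +
  (J ws j (p.1, d) - J ws j (q.1, d)) - (J' ws j q - J ws j (q.1, d)) by ring.
apply: le_lt_trans (ler_normB _ _) _.
apply: le_lt_trans (lerD (ler_normD _ _) (lexx _)) _; lra.
Unshelve. all: by end_near. Qed.

End PowJets.

(** * The second term of the expansion *)

Section SecondTerm.
Variables (R : realType) (n : nat) (gamma : R).
Local Notation V := ('rV[R]_n * R)%type.
Local Notation ex := (@ex R n).
Local Notation ey := (@ey R n).
Local Notation strip p := (0 < p.2 <= 1).
Implicit Types (p q : V) (W : V -> R) (ws : seq 'I_n) (i : 'I_n) (j k : nat).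
Hypotheses (gamma_gt0 : 0 < gamma) (gamma_nat : forall k, gamma != k%:R).

Variables (E P : seq 'I_n -> nat -> V -> R).
Hypotheses (jE : interior_jet E) (jP : interior_jet P)
  (P_flat : forall N ws j, exists C, 0 <= C /\
     forall p, strip p -> `|P ws j p| <= C * p.2 ^+ N)
  (E_ode : forall ws j p, 0 < p.2 -> p.2 ^+ 2 * E ws j.+2 p +
     (2 - 2 * gamma + 2 * j%:R) * E ws j.+1 p =
     - \sum_i E (ws ++ [:: i; i]) j p - P ws j p)
  (E_lim : forall ws x, E ws 0 (x, t) @[t --> (0 : R)^'+] --> (0 : R))
  (E_bounded : forall ws, exists C, forall p, strip p -> `|E ws 0 p| <= C)
  (E1_bounded : forall ws, exists C, forall x, `|E ws 1 (x, 1)| <= C).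

(** If the right-hand side is of order [2k], the solution is of order [2k+2],
   up to the homogeneous solution y^(2 gamma): integrate the equation, in the
   form d/dy (y^(2-2 gamma) E_1) = y^(1-2 gamma) w, from height one to y, then
   the resulting bound for the derivative from the boundary. *)
Lemma growth_step k ws :
  (forall ws, exists C, 0 <= C /\ forall p, strip p -> `|E ws 0 p| <= C * p.2 ^+ (2 * k)) ->
  exists C, 0 <= C /\ forall p, strip p ->
    `|E ws 0 p| <= C * (p.2 `^ (2 * gamma) + p.2 ^+ (2 * k.+1)) /\
    `|p.2 ^+ 2 * E ws 1 p| <= C * (p.2 `^ (2 * gamma) + p.2 ^+ (2 * k.+1)).
Proof.
move=> Ek.
have /choice[CE CEP] := fun i => Ek (ws ++ [:: i; i]).
have [CP [CP0 CPP]] := P_flat (2 * k) ws 0.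
have [C1 C1P] := E1_bounded ws.
pose C := \sum_i CE i + CP.
have S0 : 0 <= \sum_i CE i by apply: sumr_ge0 => i _; case: (CEP i).
have C0 : 0 <= C by rewrite addr_ge0.
pose w p := - \sum_i E (ws ++ [:: i; i]) 0 p - P ws 0 p.
have wb p : strip p -> `|w p| <= C * p.2 ^+ (2 * k).
  move=> sp; apply: le_trans (ler_normB _ _) _; rewrite normrN mulrDl lerD ?CPP //.
  apply: le_trans (ler_norm_sum _ _ _) _; rewrite mulr_suml.
  by apply: ler_sum => i _; case: (CEP i) => _; apply.
pose b := 2 * k%:R + 2 - 2 * gamma.
have b0 : b != 0.
  have -> : b = 2 * (k.+1%:R - gamma) by rewrite /b -natr1; ring.
  by rewrite mulf_neq0 // subr_eq0 eq_sym gamma_nat.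
pose q := 2 - 2 * gamma.
pose K := `|C1| + C / `|b|.
have K0 : 0 <= K by rewrite addr_ge0 // divr_ge0.
have E1b p : strip p ->
    `|p.2 ^+ 2 * E ws 1 p| <= K * (p.2 `^ (2 * gamma) + p.2 ^+ (2 * k.+1)).
  case: p => x y /= /andP[y0 y1].
  have M := @mvt_le R (fun t => t `^ q * E ws 1 (x, t)) (fun t => C / b * t `^ b)
    (fun t => t `^ (q - 1) * w (x, t)) (fun t => C / b * (b * t `^ (b - 1))) y 1 y1.
  have {}M : `|1 `^ q * E ws 1 (x, 1) - y `^ q * E ws 1 (x, y)| <=
      C / b * 1 `^ b - C / b * y `^ b.
    apply: M => t /andP[yt t1]; have t0 : 0 < t by exact: lt_le_trans yt.
    - have [_ _ /isd_ey d] := jE ws 1 (p := (x, t)) t0.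
      apply: isd_eq (isdM (isd_powR q t0) d) _.
      rewrite (powR_step q t0) /w -(E_ode ws 0 (p := (x, t)) t0) /= -/q.
      by ring.
    - by apply: isdZ; exact: isd_powR.
    - rewrite normrM ger0_norm ?powR_ge0 //.
      apply: le_trans (ler_wpM2l (powR_ge0 _ _) (wb (x, t) _)) _; first by rewrite /= t0.
      rewrite /= mulrCA -powR_mulrn ?(ltW t0) // -powRD ?(gt_eqF t0) ?implybT //.
      rewrite mulrA divfK // ler_wpM2l // natrM /b /q.
      by rewrite (_ : 2 - 2 * gamma - 1 + 2 * k%:R = 2 * k%:R + 2 - 2 * gamma - 1) //; ring.
  rewrite !powR1 mul1r mulr1 in M.
  have yb0 : 0 <= y `^ b by exact: powR_ge0.
  have Cb : C / b - C / b * y `^ b <= C / `|b| * (1 + y `^ b).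
    have h : `|C / b| = C / `|b| by rewrite normrM normfV ger0_norm.
    rewrite -h; have := ler_norm (C / b); have := ler_norm (- (C / b)).
    by rewrite normrN; nra.
  have yq : `|y `^ q * E ws 1 (x, y)| <= K * (1 + y `^ b).
    have := le_trans (C1P x) (ler_norm C1).
    have := ler_normB (E ws 1 (x, 1)) (E ws 1 (x, 1) - y `^ q * E ws 1 (x, y)).
    rewrite opprB addrC subrK /K mulrDl => h1 h2.
    have h3 : 0 <= `|C1| * y `^ b by rewrite mulr_ge0.
    by move: M Cb h1 h2 h3; rewrite mulrDr mulr1; lra.
  have e1 : y ^+ 2 * E ws 1 (x, y) = y `^ (2 * gamma) * (y `^ q * E ws 1 (x, y)).
    rewrite mulrA -powRD ?(gt_eqF y0) ?implybT // -powR_mulrn ?(ltW y0) //.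
    by congr (powR _ _ * _); rewrite /q; ring.
  rewrite e1 normrM ger0_norm ?powR_ge0 //.
  apply: le_trans (ler_wpM2l (powR_ge0 _ _) yq) _.
  rewrite mulrCA mulrDr mulr1 -powRD ?(gt_eqF y0) ?implybT // -powR_mulrn ?(ltW y0) //.
  rewrite (_ : 2 * gamma + b = (2 * k.+1)%:R) //.
  by rewrite natrM -natr1 /b; ring.
exists (K * (1 + (2 * gamma)^-1)); split.
  by rewrite mulr_ge0 // addr_ge0 // invr_ge0 mulr_ge0 // ltW.
move=> p sp; have /andP[p0 p1] := sp.
have g0 : 0 < 2 * gamma by rewrite mulr_gt0.
have gi0 : 0 <= (2 * gamma)^-1 by rewrite invr_ge0 ltW.
have A0 : 0 <= p.2 `^ (2 * gamma) by exact: powR_ge0.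
have B0 : 0 <= p.2 ^+ (2 * k.+1) by rewrite exprn_ge0 // ltW.
split; last first.
  apply: le_trans (E1b p sp) _; apply: ler_wpM2r; first by rewrite addr_ge0.
  by rewrite ler_peMr // lerDl.
have : `|E ws 0 p| <= K * ((2 * gamma)^-1 * p.2 `^ (2 * gamma) + p.2 ^+ (2 * k.+1)).
  case: p {A0 B0} sp p0 p1 => x y /= sp y0 y1.
  apply: (bound_from_zero (phi := fun t => E ws 0 (x, t)) (dphi := fun t => t * E ws 1 (x, t))
    (g := fun t => K * ((2 * gamma)^-1 * t `^ (2 * gamma) + t ^+ (2 * k.+1)))
    (dg := fun t => K * ((2 * gamma)^-1 * (2 * gamma * t `^ (2 * gamma - 1)) +
       (2 * k.+1)%:R * t ^+ (2 * k.+1).-1)) y0)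
    => [t /andP[t0 ty]|t /andP[t0 ty]|t /andP[t0 ty]|t /andP[t0 ty]|].
  - by apply/isd_ey; have [_ _] := jE ws 0 (p := (x, t)) t0.
  - apply: isdZ; apply: isdD; last exact: isd_exprn.
    by apply: isdZ; exact: isd_powR.
  - have := E1b (x, t); rewrite /= t0 (le_trans ty) // => /(_ isT).
    rewrite mulKf ?gt_eqF // expr2 -mulrA normrM gtr0_norm // (powR_step _ t0).
    have -> : t ^+ (2 * k.+1) = t * t ^+ (2 * k.+1).-1 by rewrite -exprS.
    rewrite -mulrDr mulrCA ler_pM2l // => h; apply: le_trans h _.
    rewrite ler_wpM2l // lerD2l ler_peMl ?exprn_ge0 ?(ltW t0) //.
    by rewrite ler1n.
  - by rewrite mulr_ge0 // addr_ge0 ?exprn_ge0 ?(ltW t0) // mulr_ge0 ?powR_ge0.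
  - exact: E_lim.
move=> h; apply: le_trans h _; rewrite -mulrA; apply: ler_wpM2l => //.
move: (_^-1) (_ `^ _) (_ ^+ _) gi0 A0 B0 => x A B x0 A0 B0.
by rewrite mulrDl mul1r mulrDr; have := mulr_ge0 x0 B0; lra.
Qed.

(** Each step gains two powers of y as long as y^(2 gamma) is the smaller term. *)
Lemma growth k : k%:R < gamma -> forall ws, exists C, 0 <= C /\
  forall p, strip p -> `|E ws 0 p| <= C * p.2 ^+ (2 * k).
Proof.
elim: k => [|k ih] kg ws.
  have [C bC] := E_bounded ws; exists `|C|; split=> // p sp.
  by rewrite muln0 expr0 mulr1 (le_trans (bC p sp)) // ler_norm.
have kg' : k%:R < gamma by apply: le_lt_trans kg; rewrite ler_nat.
have [C [C0 bC]] := growth_step ws (ih kg').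
exists (2 * C); split=> [|p sp]; first by rewrite mulr_ge0.
have [b _] := bC p sp; apply: le_trans b _.
have /andP[p0 p1] := sp.
have : p.2 `^ (2 * gamma) <= p.2 ^+ (2 * k.+1).
  rewrite -powR_mulrn ?(ltW p0) //; apply: ger_powR; first by rewrite p0.
  by rewrite natrM ler_wpM2l // ltW.
by move=> h; rewrite mulrAC -[2 * _]/((1 + 1) * _) mulrC; nra.
Qed.

(** At k = [truncn gamma] the term y^(2 gamma) becomes the larger one. *)
Lemma sharp_growth ws : exists C, 0 <= C /\ forall p, strip p ->
  `|E ws 0 p| <= C * p.2 `^ (2 * gamma) /\
  `|p.2 ^+ 2 * E ws 1 p| <= C * p.2 `^ (2 * gamma).
Proof.
have [m1 m2] : (Num.truncn gamma)%:R < gamma /\ gamma < (Num.truncn gamma).+1%:R.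
  have /andP[h1 h2] := Num.Theory.truncn_itv (ltW gamma_gt0).
  by split=> //; rewrite lt_neqAle h1 eq_sym gamma_nat.
have [C [C0 bC]] := growth_step ws (growth m1).
exists (2 * C); split=> [|p sp]; first by rewrite mulr_ge0.
have /andP[p0 p1] := sp.
have h : p.2 ^+ (2 * (Num.truncn gamma).+1) <= p.2 `^ (2 * gamma).
  rewrite -powR_mulrn ?(ltW p0) //; apply: ger_powR; first by rewrite p0.
  by rewrite natrM ler_wpM2l // ltW.
have [b1 b2] := bC p sp.
by split; [apply: le_trans b1 _|apply: le_trans b2 _]; nra.
Qed.

(** All derivatives of y^(-2 gamma) E. *)
Definition second_jet ws := pow_jet (- (2 * gamma)) (E ws).

Lemma second_jetP : interior_jet second_jet.
Proof. exact: mul_pow_jet. Qed.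

Lemma second_jet_ode ws j p : 0 < p.2 ->
  p.2 ^+ 2 * second_jet ws j.+2 p + (2 + 2 * gamma + 2 * j%:R) * second_jet ws j.+1 p =
  - \sum_i second_jet (ws ++ [:: i; i]) j p - pow_jet (- (2 * gamma)) (P ws) j p.
Proof.
elim: j ws p => [|j ih] ws p p0.
  have e0 := E_ode ws 0 p0.
  rewrite /second_jet /= -mulr_sumr.
  have p1 : p.2 `^ (- (2 * gamma)) = p.2 ^+ 2 * p.2 `^ (- (2 * gamma) - 2).
    rewrite (powR_step _ p0) (powR_step (_ - 1) p0) mulrA; congr (_ * powR _ _); ring.
  have p2 : p.2 `^ (- (2 * gamma) - 2) = p.2 ^+ 2 * p.2 `^ (- (2 * gamma) - 2 - 2).
    rewrite (powR_step _ p0) (powR_step (_ - 1) p0) mulrA; congr (_ * powR _ _); ring.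
  transitivity (p.2 `^ (- (2 * gamma)) * (p.2 ^+ 2 * E ws 2 p +
     (2 - 2 * gamma + 2 * 0%:R) * E ws 1 p)).
    by rewrite p1 p2; ring.
  by rewrite e0; ring.
have hH ws' k := second_jetP ws' k p0.
have hB := mul_pow_jet (- (2 * gamma)) jP ws j p0.
have d1 : is_derive p ey (fun q => q.2 ^+ 2 * second_jet ws j.+2 q +
    (2 + 2 * gamma + 2 * j%:R) * second_jet ws j.+1 q)
    (p.2 * (p.2 ^+ 2 * second_jet ws j.+3 p +
       (2 + 2 * gamma + 2 * j.+1%:R) * second_jet ws j.+2 p)).
  have [_ _ h2] := hH ws j.+2; have [_ _ h1] := hH ws j.+1.
  apply: isd_eq (isdD (isdM (isd_snd_comp ey (isd_exprn 2 p.2)) h2) (isdZ _ h1)) _.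
  by rewrite /= expr1 mulr1 -[j.+1]addn1 natrD; ring.
have d2 : is_derive p ey (fun q => - \sum_i second_jet (ws ++ [:: i; i]) j q -
     pow_jet (- (2 * gamma)) (P ws) j q)
    (p.2 * (- \sum_i second_jet (ws ++ [:: i; i]) j.+1 p -
     pow_jet (- (2 * gamma)) (P ws) j.+1 p)).
  have [_ _ h0] := hB.
  have hS i : is_derive p ey (second_jet (ws ++ [:: i; i]) j)
     (p.2 * second_jet (ws ++ [:: i; i]) j.+1 p).
    by have [_ _] := hH (ws ++ [:: i; i]) j.
  apply: isd_eq (isdB (isdN (isd_sum (index_enum _) hS)) h0) _.
  by rewrite -mulr_sumr; ring.
have /mulfI := lt0r_neq0 p0; apply.
by apply: (isd_uniq _ d2); apply: (isd_half_space_eq _ p0 d1) => q q0; exact: ih.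
Qed.

(** The equation of [second_jet], in the form
   d/dy (y^q H_(j+1)) = y^(q-1) W_j with [q = 2 + 2 gamma + 2 j] positive, gains
   one normal derivative; the integration constant vanishes by the second
   clause, which is propagated along. *)
Lemma second_jet_bounds j :
  (forall ws, exists C, forall p, strip p -> `|second_jet ws j p| <= C) /\
  (forall ws, exists K, forall p, strip p ->
    `|p.2 `^ (2 + 2 * gamma + 2 * j%:R) * second_jet ws j.+1 p| <= K * p.2 `^ (2 * gamma)).
Proof.
elim: j => [|j [ih ih1]].
  split=> ws; have [C [C0 bC]] := sharp_growth ws.
    exists C => p sp; have [b _] := bC p sp; have /andP[p0 _] := sp.
    by rewrite /second_jet /= normrM ger0_norm ?powR_ge0 // powRN mulrC ler_pdivrMr ?powR_gt0.
  exists (C + 2 * gamma * C) => p sp; have [b0 b1] := bC p sp; have /andP[p0 _] := sp.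
  have -> : p.2 `^ (2 + 2 * gamma + 2 * 0) * second_jet ws 1 p =
      p.2 ^+ 2 * E ws 1 p - 2 * gamma * E ws 0 p.
    have h1 : p.2 `^ (2 + 2 * gamma) * p.2 `^ (- (2 * gamma)) = p.2 ^+ 2.
      rewrite -powRD ?(gt_eqF p0) ?implybT // -powR_mulrn ?(ltW p0) //.
      by congr powR; ring.
    have h2 : p.2 `^ (2 + 2 * gamma) * p.2 `^ (- (2 * gamma) - 2) = 1.
      rewrite -powRD ?(gt_eqF p0) ?implybT // -[RHS](powRr0 p.2).
      by congr powR; ring.
    rewrite /second_jet /= mulr0 addr0.
    transitivity (p.2 `^ (2 + 2 * gamma) * p.2 `^ (- (2 * gamma)) * E ws 1 p -
       p.2 `^ (2 + 2 * gamma) * p.2 `^ (- (2 * gamma) - 2) * (2 * gamma * E ws 0 p)).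
      by ring.
    by rewrite h1 h2 mul1r.
  apply: le_trans (ler_normB _ _) _; rewrite [leRHS]mulrDl; apply: lerD => //.
  have g0 : 0 <= 2 * gamma by rewrite mulr_ge0 // ltW.
  by rewrite normrM ger0_norm // -[leRHS]mulrA ler_wpM2l.
pose q := 2 + 2 * gamma + 2 * j%:R.
have q0 : 0 < q by rewrite /q ltr_wpDr ?mulr_ge0 // addr_gt0 // mulr_gt0.
pose W ws p := - \sum_i second_jet (ws ++ [:: i; i]) j p -
  pow_jet (- (2 * gamma)) (P ws) j p.
have Wb ws : exists C, 0 <= C /\ forall p, strip p -> `|W ws p| <= C.
  have [CP bP] := flat_pow_bounded (- (2 * gamma)) (J := P ws) j (fun N k => P_flat N ws k).
  have /choice[CS bS] := fun i => ih (ws ++ [:: i; i]).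
  exists (`|\sum_i CS i| + `|CP|); split=> [|p sp]; first by rewrite addr_ge0.
  apply: le_trans (ler_normB _ _) _; rewrite normrN; apply: lerD.
    apply: le_trans (ler_norm _); apply: le_trans (ler_norm_sum _ _ _) _.
    by apply: ler_sum => i _; exact: bS.
  by apply: le_trans (ler_norm _); exact: bP.
have B ws : exists C, forall p, strip p -> `|second_jet ws j.+1 p| <= C.
  have [C [C0 bC]] := Wb ws; have [K bK] := ih1 ws.
  exists (C / q) => -[x y] /= /andP[y0 y1].
  have : `|y `^ q * second_jet ws j.+1 (x, y)| <= C * (q^-1 * y `^ q).
    apply: (bound_from_zero (phi := fun t => t `^ q * second_jet ws j.+1 (x, t))
      (dphi := fun t => t `^ (q - 1) * W ws (x, t)) (g := fun t => C * (q^-1 * t `^ q))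
      (dg := fun t => C * (q^-1 * (q * t `^ (q - 1)))) y0)
      => [t /andP[t0 ty]|t /andP[t0 ty]|t /andP[t0 ty]|t /andP[t0 ty]|].
    - have [_ _ /isd_ey d] := second_jetP ws j.+1 (p := (x, t)) t0.
      apply: isd_eq (isdM (isd_powR q t0) d) _.
      rewrite (powR_step q t0) /W -(second_jet_ode ws j (p := (x, t)) t0) /= -/q.
      by ring.
    - by apply: isdZ; apply: isdZ; exact: isd_powR.
    - rewrite normrM ger0_norm ?powR_ge0 // mulKf ?gt_eqF // mulrC ler_wpM2r ?powR_ge0 //.
      by apply: bC; rewrite /= t0 (le_trans ty).
    - by rewrite mulr_ge0 // mulr_ge0 ?invr_ge0 ?powR_ge0 // ltW.
    - have Kl : K * t `^ (2 * gamma) @[t --> (0 : R)^'+] --> K * 0.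
        by apply: cvgM; [exact: cvg_cst|apply: powR_cvg0; rewrite mulr_gt0].
      apply/cvgr0Pnorm_le => e e0; move: Kl; rewrite mulr0 => /cvgr0Pnorm_le /(_ _ e0) Kl.
      near=> t; have t0 : 0 < t by near: t; exact: nbhs_right_gt.
      have t1 : t <= 1 by near: t; exact: nbhs_right_le.
      have := bK (x, t); rewrite /= t0 t1 => /(_ isT) h; apply: le_trans h _.
      by apply: le_trans (ler_norm _) _; near: t.
  rewrite normrM ger0_norm ?powR_ge0 // mulrA mulrC ler_pM2r ?powR_gt0 //.
split=> // ws.
have [C [C0 bC]] := Wb ws; have [C' bC'] := B ws.
exists (C + q * C') => p sp; have /andP[p0 p1] := sp.
have -> : p.2 `^ (2 + 2 * gamma + 2 * j.+1%:R) * second_jet ws j.+2 p =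
    p.2 `^ q * (p.2 ^+ 2 * second_jet ws j.+2 p).
  rewrite mulrA -powR_mulrn ?(ltW p0) // -powRD ?(gt_eqF p0) ?implybT //.
  by congr (powR _ _ * _); rewrite /q -natr1; ring.
have -> : p.2 ^+ 2 * second_jet ws j.+2 p = W ws p - q * second_jet ws j.+1 p.
  by rewrite /W -(second_jet_ode ws j p0) -/q; ring.
rewrite normrM ger0_norm ?powR_ge0 // mulrC.
apply: ler_pM => //; first exact: powR_ge0.
  apply: le_trans (ler_normB _ _) _; apply: lerD; first exact: bC.
  by rewrite normrM gtr0_norm // ler_wpM2l ?(ltW q0) // bC'.
apply: ger_powR; first by rewrite p0.
have : 0 <= 2 * (j%:R : R) by rewrite mulr_ge0.
by rewrite /q; lra.
Unshelve. all: by end_near. Qed.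

End SecondTerm.

(** * Jets and smoothness up to the boundary *)

Section Smooth.
Variables (R : realType) (n : nat).
Local Notation V := ('rV[R]_n * R)%type.
Local Notation ex := (@ex R n).
Local Notation ey := (@ey R n).
Implicit Types (p q v : V) (G : V -> R) (ws : seq 'I_n) (i : 'I_n) (j k : nat).

Definition closed_jet (F : seq 'I_n -> nat -> V -> R) : Prop :=
  interior_jet F /\
  forall ws j, {within @closed_half_space R n, continuous (F ws j)}.

Variable F : seq 'I_n -> nat -> V -> R.
Hypothesis jF : closed_jet F.

(** Combinations of members of the jet with coefficients c y^k. The predicate
   [P] restricts the exponents: parity of [k] gives parity in y, since the
   members of the jet are even in y. *)
Inductive comb (P : pred nat) : (V -> R) -> Prop :=
| comb_term (c : R) k ws j of P k : comb P (fun p => c * p.2 ^+ k * F ws j p)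
| comb_add G1 G2 of comb P G1 & comb P G2 : comb P (fun p => G1 p + G2 p).

Lemma comb_cont P G : comb P G -> {within @closed_half_space R n, continuous G}.
Proof.
elim=> [c k ws j _|G1 G2 _ c1 _ c2]; last exact: closed_contD.
apply: closed_contM; last exact: jF.2.
by apply: closed_contZ; apply: cont_closed; exact: cont_snd_exp.
Qed.

Lemma comb_scale P G (c : R) : comb P G -> comb P (fun p => c * G p).
Proof.
elim=> [c' k ws j Pk|G1 G2 _ c1 _ c2].
  have -> : (fun p : V => c * (c' * p.2 ^+ k * F ws j p)) =
    (fun p => (c * c') * p.2 ^+ k * F ws j p) by apply/funext => p; ring.
  exact: comb_term.
have -> : (fun p : V => c * (G1 p + G2 p)) = (fun p => c * G1 p + c * G2 p).
  by apply/funext => p; ring.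
exact: comb_add.
Qed.

Lemma comb_isd_x P G i : comb P G -> exists2 G', comb P G' &
  forall p, 0 < p.2 -> is_derive p (ex i) G (G' p).
Proof.
elim=> [c k ws j Pk|G1 G2 _ [G1' c1 d1] _ [G2' c2 d2]].
  exists (fun p => c * p.2 ^+ k * F (i :: ws) j p); first exact: comb_term.
  move=> p p0; have [_ dx _] := jF.1 ws j p p0.
  apply: isd_eq (isdM (isdZ c (isd_snd_comp (ex i) (isd_exprn k p.2))) (dx i)) _.
  by rewrite /= !mulr0 addr0.
exists (fun p => G1' p + G2' p); first exact: comb_add.
by move=> p p0; apply: isdD; [exact: d1|exact: d2].
Qed.

Lemma comb_isd_y (P Q : pred nat) G :
  (forall k, P k -> Q k.+1 /\ ((0 < k)%N -> Q k.-1)) -> comb P G ->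
  exists2 G', comb Q G' & forall p, 0 < p.2 -> is_derive p ey G (G' p).
Proof.
move=> PQ; elim=> [c k ws j Pk|G1 G2 _ [G1' c1 d1] _ [G2' c2 d2]]; last first.
  exists (fun p => G1' p + G2' p); first exact: comb_add.
  by move=> p p0; apply: isdD; [exact: d1|exact: d2].
have [Qk1 Qk] := PQ k Pk.
have D p : 0 < p.2 -> is_derive p ey (fun p => c * p.2 ^+ k * F ws j p)
    (c * p.2 ^+ k.+1 * F ws j.+1 p + (c * k%:R) * p.2 ^+ k.-1 * F ws j p).
  move=> p0; have [_ _ dy] := jF.1 ws j p p0.
  apply: isd_eq (isdM (isdZ c (isd_snd_comp ey (isd_exprn k p.2))) dy) _.
  by rewrite /= mulr1 exprS; ring.
case: k Pk Qk1 Qk D => [|k] Pk Qk1 Qk D.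
  exists (fun p => c * p.2 ^+ 1 * F ws j.+1 p); first exact: comb_term.
  by move=> p p0; apply: isd_eq (D p p0) _; rewrite mulr0 !mul0r addr0.
exists (fun p => c * p.2 ^+ k.+2 * F ws j.+1 p + (c * k.+1%:R) * p.2 ^+ k * F ws j p).
  by apply: comb_add; apply: comb_term => //; exact: Qk.
exact: D.
Qed.

Lemma comb_isd G v : comb predT G -> exists2 G', comb predT G' &
  forall p, 0 < p.2 -> is_derive p v G (G' p).
Proof.
move=> cG.
have /choice[Gx Gxd] : forall i, exists G', comb predT G' /\
    forall p, 0 < p.2 -> is_derive p (ex i) G (G' p).
  by move=> i; have [G' c d] := comb_isd_x i cG; exists G'.
have [//|Gy cy dy] := @comb_isd_y predT predT G _ cG.
exists (fun p => \sum_i v.1 ord0 i * Gx i p + v.2 * Gy p).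
  apply: comb_add; last exact: comb_scale.
  elim: (index_enum _) => [|i r ih].
    have -> : (fun p : V => \sum_(i <- [::]) v.1 ord0 i * Gx i p) =
        (fun p => 0 * p.2 ^+ 0 * F [::] 0 p).
      by apply/funext => p; rewrite big_nil !mul0r.
    exact: comb_term.
  have -> : (fun p : V => \sum_(i <- i :: r) v.1 ord0 i * Gx i p) =
      (fun p => v.1 ord0 i * Gx i p + \sum_(i <- r) v.1 ord0 i * Gx i p).
    by apply/funext => p; rewrite big_cons.
  by apply: comb_add => //; apply: comb_scale; case: (Gxd i).
move=> p p0; apply: isd_all_dir => //; first by move=> i q q0; have [_] := Gxd i; apply.
move=> i q q0; have [c _] := Gxd i; exact: closed_cont_interior (comb_cont c) q0.
Qed.

Lemma comb_iter_derive G (vs : seq V) : comb predT G -> exists2 G', comb predT G' &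
  forall p, 0 < p.2 -> iter_derive vs G p = G' p.
Proof.
move=> cG; elim: vs => [|v vs [G' cG' e]]; first by exists G.
have [G'' cG'' d] := comb_isd v cG'; exists G'' => // p p0.
rewrite /= -(isd_val (d p p0)); apply: near_eq_derive.
by apply: filterS (near_half_space p0) => q; exact: e.
Qed.

Lemma comb_iter_ey k : exists2 G', comb (fun l : nat => odd l == odd k) G' &
  forall p, 0 < p.2 -> iter_derive (nseq k ey) (F [::] 0) p = G' p.
Proof.
elim: k => [|k [G' cG' e]].
  exists (fun p => 1 * p.2 ^+ 0 * F [::] 0 p); first exact: comb_term.
  by move=> p _; rewrite expr0 !mul1r.
have [|G'' cG'' d] := @comb_isd_y _ (fun l : nat => odd l == odd k.+1) _ _ cG'.
  move=> l /eqP lk; split; first by rewrite /= lk.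
  by case: l lk => //= l lk _; rewrite -lk negbK.
exists G'' => // p p0.
rewrite /= -(isd_val (d p p0)); apply: near_eq_derive.
by apply: filterS (near_half_space p0) => q; exact: e.
Qed.

Theorem jet_smooth : smooth_up_to_boundary (F [::] 0).
Proof.
have cF : comb predT (F [::] 0).
  have -> : F [::] 0 = (fun p => 1 * p.2 ^+ 0 * F [::] 0 p).
    by apply/funext => p; rewrite expr0 !mul1r.
  exact: comb_term.
split; last 2 first.
- exact: jF.2.
- move=> vs; have [G cG e] := comb_iter_derive vs cF; exists G; first exact: comb_cont cG.
  by move=> p p0; rewrite e.
move=> k vs p _ p0; have [G cG e] := comb_iter_derive vs cF.
split.
  apply: (cont_half_space_eq _ p0 (closed_cont_interior (comb_cont cG) p0)).
  by move=> q q0; rewrite e.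
move=> _ v; have [G' _ d] := comb_isd v cG.
apply: isd_derivable; apply: (isd_half_space_eq _ p0 (d p p0)).
by move=> q q0; rewrite e.
Qed.

Theorem jet_even : even_in_y (F [::] 0).
Proof.
move=> x k; have [G cG e] := comb_iter_ey k.*2.+1.
have G0 : G (x, 0) = 0.
  elim: cG {e} => [c l ws j|G1 G2 _ e1 _ e2]; last by rewrite e1 e2 addr0.
  rewrite /= odd_double; case: l => //= l _.
  by rewrite expr0n /= mulr0 mul0r.
have := @closed_cont_boundary R n G x (comb_cont cG); rewrite G0 => Gl.
apply: cvg_trans Gl; apply: near_eq_cvg; near=> t.
by rewrite e //=; near: t; exact: nbhs_right_gt.
Unshelve. all: by end_near. Qed.

End Smooth.

Section Expansion.
Variables (R : realType) (n : nat) (gamma : R).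
Local Notation V := ('rV[R]_n * R)%type.
Local Notation ex := (@ex R n).
Local Notation ey := (@ey R n).
Implicit Types (p q : V) (ws : seq 'I_n) (i : 'I_n) (j k : nat).
Hypotheses (gamma_gt0 : 0 < gamma) (gamma_nat : forall k, gamma != k%:R).

Section Coefficients.
Variable X : seq 'I_n -> 'rV[R]_n -> R.
Hypothesis jX : x_jet X.

(** The Taylor coefficients which the equation imposes on the even part. *)
Fixpoint taylor_coef j ws x : R :=
  match j with
  | 0 => X ws x
  | j1.+1 => - (2 - 2 * gamma + 2 * j1%:R)^-1 *
      \sum_i taylor_coef j1 (ws ++ [:: i; i]) x
  end.

Lemma taylor_coef_jet j : x_jet (taylor_coef j).
Proof.
elim: j => [|j [d b c]] //; split=> [ws i x|ws|ws x].
- by apply: isdZ; apply: isd_sum => l; exact: d.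
- have /choice[M bM] := fun i => b (ws ++ [:: i; i]).
  exists (`|- (2 - 2 * gamma + 2 * j%:R)^-1| * \sum_i M i) => x.
  rewrite /= normrM ler_wpM2l // (le_trans (ler_norm_sum _ _ _)) //.
  by apply: ler_sum => i _; exact: bM.
- have cs : {for x, continuous (fun x => \sum_i taylor_coef j (ws ++ [:: i; i]) x)}.
    by apply: (@cvg_sumr _ _ _ _ (nbhs_filter x)) => i; exact: c.
  have cc : {for x, continuous (fun=> - (2 - 2 * gamma + 2 * j%:R)^-1 : R^o)}.
    exact: cst_continuous.
  exact: (continuousM cc cs).
Qed.

Lemma taylor_coefS j ws x :
  (2 - 2 * gamma + 2 * j%:R) * taylor_coef j.+1 ws x +
  \sum_i taylor_coef j (ws ++ [:: i; i]) x = 0.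
Proof.
have b0 : 2 - 2 * gamma + 2 * j%:R != 0.
  have -> : 2 - 2 * gamma + 2 * j%:R = 2 * (j.+1%:R - gamma) by rewrite -natr1; ring.
  by rewrite mulf_neq0 // subr_eq0 eq_sym gamma_nat.
by rewrite /= mulNr mulrN mulVKf // addNr.
Qed.

End Coefficients.

(** Borel's theorem with the coefficients [taylor_coef] provides [F]; then
   y^(-2 gamma) (U - F) has bounded derivatives, and [H] is its extension to the
   boundary. *)
Theorem expansion (f : 'rV[R]_n -> R) (U : V -> R) : schwartz f ->
  bounded_bvp_solution (1 - 2 * gamma) f U ->
  exists F H, [/\ closed_jet F, closed_jet H,
    forall x, F [::] 0 (x, 0) = f x
  & forall p, 0 < p.2 -> U p = F [::] 0 p + p.2 `^ (2 * gamma) * H [::] 0 p].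
Proof.
move=> sf U_sol.
have gamma_neq1 : gamma != 1 by have := gamma_nat 1.
pose X ws := iter_derive (map (delta_mx 0) ws) f.
have jX : x_jet X by exact: schwartz_x_jet.
have [F [jF cF bF F0]] := borel (taylor_coef_jet jX).
have cjF : closed_jet F by [].
pose u := solution_jet gamma U.
have ju : interior_jet u := solution_jetP gamma_gt0 gamma_neq1 jX U_sol.
pose Q ws j (p : V) := p.2 ^+ 2 * F ws j.+2 p +
  (2 - 2 * gamma + 2 * j%:R) * F ws j.+1 p + \sum_i F (ws ++ [:: i; i]) j p.
have cQ ws j : {within @closed_half_space R n, continuous (Q ws j)}.
  apply: closed_contD; first apply: closed_contD.
  - by apply: closed_contM; [apply: cont_closed; exact: cont_snd_exp|exact: cF].
  - by apply: closed_contZ; exact: cF.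
  - elim: (index_enum _) => [|i r ih].
      have -> : (fun q : V => \sum_(i <- [::]) F (ws ++ [:: i; i]) j q) = cst 0.
        by apply/funext => q; rewrite big_nil.
      by apply: cont_closed; exact: cst_continuous.
    have -> : (fun q : V => \sum_(i <- i :: r) F (ws ++ [:: i; i]) j q) =
        (fun q => F (ws ++ [:: i; i]) j q + \sum_(i <- r) F (ws ++ [:: i; i]) j q).
      by apply/funext => q; rewrite big_cons.
    by apply: closed_contD => //; exact: cF.
have jQ : interior_jet Q.
  move=> ws j p p0; split.
  - exact: (closed_cont_interior (cQ ws j) p0).
  - move=> l; have [_ d2 _] := jF ws j.+2 p p0; have [_ d1 _] := jF ws j.+1 p p0.
    have d0 i : is_derive p (ex l) (F (ws ++ [:: i; i]) j) (F (l :: ws ++ [:: i; i]) j p).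
      by have [_ + _] := jF (ws ++ [:: i; i]) j p p0; apply.
    apply: isd_eq (isdD (isdD (isdM (isd_snd_comp (ex l) (isd_exprn 2 p.2)) (d2 l))
      (isdZ (2 - 2 * gamma + 2 * j%:R) (d1 l))) (isd_sum (index_enum _) d0)) _.
    by rewrite /= mulr0 mulr0 addr0.
  - have [_ _ d2] := jF ws j.+2 p p0; have [_ _ d1] := jF ws j.+1 p p0.
    have d0 i : is_derive p ey (F (ws ++ [:: i; i]) j) (p.2 * F (ws ++ [:: i; i]) j.+1 p).
      by have [_ _] := jF (ws ++ [:: i; i]) j p p0.
    apply: isd_eq (isdD (isdD (isdM (isd_snd_comp ey (isd_exprn 2 p.2)) d2)
      (isdZ (2 - 2 * gamma + 2 * j%:R) d1)) (isd_sum (index_enum _) d0)) _.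
    rewrite /Q /= expr1 mulr1 -[in j.+1%:R]addn1 natrD -mulr_sumr.
    by move: (\sum_i _) => S; ring.
have zQ ws j x : Q ws j (x, 0) = 0.
  rewrite /Q /= expr0n mul0r add0r F0 -[RHS](taylor_coefS X j ws x).
  by congr (_ + _); apply: eq_bigr => i _; rewrite F0.
have bQ ws j : exists C, forall p, 0 < p.2 <= 1 -> `|Q ws j p| <= C.
  have [C2 b2] := bF ws j.+2; have [C1 b1] := bF ws j.+1.
  have /choice[C0 b0] := fun i => bF (ws ++ [:: i; i]) j.
  exists (C2 + `|2 - 2 * gamma + 2 * j%:R| * C1 + \sum_i C0 i) => p /andP[p0 p1].
  have sp : 0 <= p.2 <= 1 by rewrite ltW.
  apply: le_trans (ler_normD _ _) _; apply: lerD; last first.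
    by apply: le_trans (ler_norm_sum _ _ _) _; apply: ler_sum => i _; exact: b0.
  apply: le_trans (ler_normD _ _) _; apply: lerD; last first.
    by rewrite normrM ler_wpM2l // b1.
  rewrite normrM; apply: le_trans (b2 p sp); rewrite ler_piMl // ger0_norm ?exprn_ge0 ?(ltW p0) //.
  by rewrite exprn_ile1 // ltW.
have fQ := flat_decay jQ cQ zQ bQ.
pose E ws j (p : V) := u ws j p - F ws j p.
have jE : interior_jet E by exact: interior_jetB.
have odeE ws j p : 0 < p.2 -> p.2 ^+ 2 * E ws j.+2 p +
     (2 - 2 * gamma + 2 * j%:R) * E ws j.+1 p =
     - \sum_i E (ws ++ [:: i; i]) j p - Q ws j p.
  move=> p0; have := solution_jet_ode gamma U ws j p0; rewrite -/u => e.
  rewrite /E sumrB opprB /Q; move: e.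
  move: (u ws j.+2 p) (u ws j.+1 p) (\sum_i u _ _ _) => a b c e.
  have -> : c = - (p.2 ^+ 2 * a + (2 - 2 * gamma + 2 * j%:R) * b).
    by rewrite e opprK.
  by ring.
have limE ws x : E ws 0 (x, t) @[t --> (0 : R)^'+] --> (0 : R).
  have := @closed_cont_boundary R n _ x (@solution_jet_cont R n gamma gamma_gt0 gamma_neq1 U X jX U_sol ws).
  rewrite (solution_jet_boundary gamma_gt0 gamma_neq1 jX U_sol) => l1.
  have := @closed_cont_boundary R n _ x (cF ws 0); rewrite F0 [taylor_coef _ _ _ _]/= => l2.
  have l3 := cvgB l1 l2; rewrite subrr in l3; exact: l3.
have bE ws : exists C, forall p, 0 < p.2 <= 1 -> `|E ws 0 p| <= C.
  have [C1 b1] := solution_jet_bounded gamma_gt0 gamma_neq1 jX U_sol ws.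
  have [C2 b2] := bF ws 0; exists (C1 + C2) => p /andP[p0 p1].
  apply: le_trans (ler_normB _ _) _; apply: lerD; first exact: b1 (ltW p0).
  by apply: b2; rewrite ltW.
have bE1 ws : exists C, forall x, `|E ws 1 (x, 1)| <= C.
  have [C1 b1] := solution_jet1_bounded gamma_gt0 gamma_neq1 jX U_sol ws.
  have [C2 b2] := bF ws 1; exists (C1 + C2) => x.
  apply: le_trans (ler_normB _ _) _; apply: lerD; first exact: b1.
  by apply: b2; rewrite /= ler01 lexx.
have [H [jH cH eH]] := jet_extend (second_jetP gamma jE)
  (fun ws j => (second_jet_bounds gamma_gt0 gamma_nat jE jQ fQ odeE limE bE bE1 j).1 ws).
exists F, H; split=> // p p0.
rewrite eH // /second_jet /= mulrA -powRD ?(gt_eqF p0) ?implybT // subrr powRr0 mul1r.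
by rewrite /E addrC subrK.
Qed.

End Expansion.

(** * The hyperbolic Laplacian *)

Section CkClosure.
Variables (R : realType) (V : normedModType R) (D : set V).
Hypothesis openD : open D.
Implicit Types (f g : V -> R) (k : nat).

Lemma iter_derive_rcons (vs : seq V) v f :
  iter_derive (rcons vs v) f = iter_derive vs ('D_v f).
Proof. by rewrite /iter_derive foldr_rcons. Qed.

Lemma Ck_on0 f : Ck_on 0 D f <-> forall p, D p -> {for p, continuous f}.
Proof.
split; first by move=> c p Dp; have [] := c [::] p isT Dp.
by move=> c [|//] p _ Dp; split=> //; exact: c.
Qed.

Lemma Ck_onS k f : Ck_on k.+1 D f <->
  (forall p, D p -> {for p, continuous f} /\ forall v, derivable f p v) /\
  forall v, Ck_on k D ('D_v f).
Proof.
split=> [c|[c cD]].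
  split=> [p Dp|v vs p vsk Dp].
    by have [c0 d] := c [::] p isT Dp; split=> //; exact: d.
  by have := c (rcons vs v) p; rewrite size_rcons iter_derive_rcons; exact.
move=> vs p; case/lastP: vs => [|vs v].
  by move=> _ Dp; have [c0 d] := c p Dp; split.
by rewrite size_rcons iter_derive_rcons; exact: cD.
Qed.

Lemma near_open p : D p -> \forall q \near p, D q.
Proof. by move=> Dp; exact: open_nbhs_nbhs. Qed.

Lemma Ck_on_eq k f g : (forall p, D p -> f p = g p) -> Ck_on k D f -> Ck_on k D g.
Proof.
have cont_eq f' g' : (forall p, D p -> f' p = g' p) ->
    forall p, D p -> {for p, continuous f'} -> {for p, continuous g'}.
  move=> e p Dp; rewrite /prop_for /continuous_at -(e p Dp) => c.
  by apply: cvg_trans c; apply: near_eq_cvg; apply: filterS (near_open Dp) => q /e ->.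
elim: k f g => [|k ih] f g e.
  by move=> /Ck_on0 c; apply/Ck_on0 => p Dp; apply: (cont_eq f) => //; exact: c.
move=> /Ck_onS[c cD]; apply/Ck_onS; split=> [p Dp|v].
  have [c0 d] := c p Dp; split; first exact: (cont_eq f).
  move=> v; apply: (near_eq_derivable _ (d v)).
  by apply: filterS (near_open Dp) => q; exact: e.
apply: ih (cD v) => p Dp; apply: near_eq_derive.
by apply: filterS (near_open Dp) => q; exact: e.
Qed.

Lemma Ck_on_pred k f : Ck_on k.+1 D f -> Ck_on k D f.
Proof.
move=> c vs p vsk Dp; have [c0 d] := c vs p (leqW vsk) Dp.
by split=> // vsk'; apply: d; exact: ltnW.
Qed.

Lemma Ck_onD k f g : Ck_on k D f -> Ck_on k D g -> Ck_on k D (fun p => f p + g p).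
Proof.
elim: k f g => [|k ih] f g.
  move=> /Ck_on0 cf /Ck_on0 cg; apply/Ck_on0 => p Dp.
  exact: (continuousD (cf p Dp) (cg p Dp)).
move=> /Ck_onS[cf cDf] /Ck_onS[cg cDg]; apply/Ck_onS; split=> [p Dp|v].
  have [c d] := cf p Dp; have [c' d'] := cg p Dp.
  split; first exact: (continuousD c c').
  by move=> v; exact: isd_derivable (isdD (derivableP (d v)) (derivableP (d' v))).
apply: Ck_on_eq (ih _ _ (cDf v) (cDg v)) => p Dp.
have [_ d] := cf p Dp; have [_ d'] := cg p Dp.
by rewrite (isd_val (isdD (derivableP (d v)) (derivableP (d' v)))).
Qed.

Lemma Ck_onM k f g : Ck_on k D f -> Ck_on k D g -> Ck_on k D (fun p => f p * g p).
Proof.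
elim: k f g => [|k ih] f g.
  move=> /Ck_on0 cf /Ck_on0 cg; apply/Ck_on0 => p Dp.
  exact: (continuousM (cf p Dp) (cg p Dp)).
move=> cf1 cg1; have cf0 := Ck_on_pred cf1; have cg0 := Ck_on_pred cg1.
move/Ck_onS : cf1 => [cf cDf]; move/Ck_onS : cg1 => [cg cDg].
apply/Ck_onS; split=> [p Dp|v].
  have [c d] := cf p Dp; have [c' d'] := cg p Dp.
  split; first exact: (continuousM c c').
  by move=> v; exact: isd_derivable (isdM (derivableP (d v)) (derivableP (d' v))).
apply: Ck_on_eq (Ck_onD (ih _ _ cf0 (cDg v)) (ih _ _ cg0 (cDf v))) => p Dp.
have [_ d] := cf p Dp; have [_ d'] := cg p Dp.
by rewrite (isd_val (isdM (derivableP (d v)) (derivableP (d' v)))).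
Qed.

Lemma Ck_on_cst k (c : R) : Ck_on k D (fun=> c).
Proof.
elim: k c => [|k ih] c.
  by apply/Ck_on0 => p _; exact: cst_continuous.
apply/Ck_onS; split=> [p Dp|v].
  split; first exact: cst_continuous.
  by move=> v; exact: isd_derivable (isd_cst p v c).
by apply: Ck_on_eq (ih 0) => p Dp; rewrite (isd_val (isd_cst p v c)).
Qed.

End CkClosure.

Section Hyperbolic.
Variables (R : realType) (n : nat).
Local Notation V := ('rV[R]_n * R)%type.
Local Notation ex := (@ex R n).
Local Notation ey := (@ey R n).
Implicit Types (p q : V) (u W : V -> R) (i : 'I_n).

Lemma open_half_space : open (@half_space R n).
Proof. by rewrite openE => p p0; exact: near_half_space. Qed.

Lemma Ck_on_powR k (r : R) : Ck_on k (@half_space R n) (fun p => p.2 `^ r).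
Proof.
elim: k r => [|k ih] r.
  apply/Ck_on0 => p p0.
  apply: (@continuous_comp _ _ _ snd (fun t : R => t `^ r)); first exact: cvg_snd.
  exact: isd_cont (isd_powR r p0).
have d p v : half_space p -> is_derive p v (fun p : V => p.2 `^ r)
    (r * p.2 `^ (r - 1) * v.2).
  by move=> p0; exact: (isd_snd_comp v (isd_powR r p0)).
apply/Ck_onS; split=> [p p0|v].
  split; last by move=> v; exact: isd_derivable (d p v p0).
  apply: (@continuous_comp _ _ _ snd (fun t : R => t `^ r)); first exact: cvg_snd.
  exact: isd_cont (isd_powR r p0).
apply: (Ck_on_eq open_half_space (f := fun p => r * v.2 * p.2 `^ (r - 1))).
  by move=> p p0; rewrite (isd_val (d p v p0)); ring.
by apply: (Ck_onM open_half_space); [exact: (Ck_on_cst open_half_space)|exact: ih].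
Qed.

Lemma laplace_hyperbolic_eq u u' p : (forall q, 0 < q.2 -> u q = u' q) -> 0 < p.2 ->
  laplace_hyperbolic u p = laplace_hyperbolic u' p.
Proof.
move=> e p0; rewrite /laplace_hyperbolic /laplace_beltrami; apply: (congr1 ( *%R _)).
apply: eq_bigr => i _; apply: near_eq_derive.
apply: filterS (near_half_space p0) => q q0; congr (_ * _).
apply: eq_bigr => j _; congr (_ * _); apply: near_eq_derive.
by apply: filterS (near_half_space q0) => z; exact: e.
Qed.

Lemma laplace_hyperbolicE u p : Ck_on 2 (@half_space R n) u -> 0 < p.2 ->
  laplace_hyperbolic u p = p.2 ^+ 2 * (laplace_x u p + dy (dy u) p) +
    (1 - n%:R) * p.2 * dy u p.
Proof.
move=> cu p0.
have det q : 0 < q.2 -> Num.sqrt (\det (hyperbolic_metric q)) = q.2 ^- n.+1.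
  move=> q0; rewrite /hyperbolic_metric det_scalar addn1.
  by rewrite -exprVn -exprM mulnC exprM exprVn sqrtr_sqr gtr0_norm // invr_gt0 exprn_gt0.
have inner (l : 'I_(n + 1)) q : 0 < q.2 ->
    Num.sqrt (\det (hyperbolic_metric q)) *
    (\sum_j invmx (hyperbolic_metric q) l j * 'D_(coord_dir R j) u q) =
    q.2 ^- n.+1 * q.2 ^+ 2 * 'D_(coord_dir R l) u q.
  move=> q0; rewrite det // -mulrA; congr (_ * _).
  rewrite /hyperbolic_metric invmx_scalar invrK (bigD1 l) //= big1 => [|j jl].
    by rewrite mxE eqxx mulr1n addr0.
  by rewrite mxE eq_sym (negbTE jl) mulr0n mul0r.
have d2 v w : is_derive p w ('D_v u) ('D_w ('D_v u) p).
  by apply: derivableP; have [_ d] := cu [:: v] p isT p0; exact: d.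
rewrite /laplace_hyperbolic /laplace_beltrami.
have E (l : 'I_(n + 1)) : 'D_(coord_dir R l) (fun q => Num.sqrt (\det (hyperbolic_metric q)) *
    (\sum_j invmx (hyperbolic_metric q) l j * 'D_(coord_dir R j) u q)) p =
    'D_(coord_dir R l) (fun q => q.2 ^- n.+1 * q.2 ^+ 2 * 'D_(coord_dir R l) u q) p.
  by apply: near_eq_derive; apply: filterS (near_half_space p0) => q; exact: inner.
under eq_bigr do rewrite E.
rewrite big_split_ord /= big_ord1 det //.
have cl i : coord_dir R (lshift 1 i) = ex i.
  by rewrite /coord_dir -[lshift 1 i]/(unsplit (inl i)) unsplitK.
have cr : coord_dir R (rshift n ord0) = ey.
  by rewrite /coord_dir -[rshift n ord0]/(unsplit (inr ord0)) unsplitK.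
rewrite cr; have pn0 : p.2 != 0 by rewrite gt_eqF.
have pk0 : p.2 ^+ n.+1 != 0 by rewrite expf_neq0.
have dx i : 'D_(coord_dir R (lshift 1 i))
    (fun q => q.2 ^- n.+1 * q.2 ^+ 2 * 'D_(coord_dir R (lshift 1 i)) u q) p =
    p.2 ^- n.+1 * p.2 ^+ 2 * 'D_(ex i) ('D_(ex i) u) p.
  rewrite cl; have dI := isd_snd_comp (ex i)
    (@is_deriveV R (fun t => t ^+ n.+1) p.2 _ 1 pk0 (isd_exprn n.+1 p.2)).
  have dS := isd_snd_comp (ex i) (isd_exprn 2 p.2).
  rewrite (isd_val (isdM (isdM dI dS) (d2 (ex i) (ex i)))).
  by rewrite /= !mulr0 addr0 mulr0 addr0.
under eq_bigr do rewrite dx.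
have dS := isd_snd_comp ey (isd_exprn 2 p.2).
rewrite (isd_val (isdM (isdM (isd_inv_snd n.+1 p0) dS) (d2 ey ey))).
rewrite -mulr_sumr /laplace_x /dy /= expr1 mulr1 -[n.+1]addn1 -[(n + 1).+1]addn1 !exprD natrD.
move: (\sum_i _) ('D_ey ('D_ey u) p) ('D_ey u p) => A B C.
move: (p.2 ^+ n) (expf_neq0 n pn0) => z z0.
by field; rewrite pn0 z0.
Qed.

Variable gamma : R.
Local Notation s := (n%:R / 2 + gamma).

(** The exponent n - s is a root of the indicial equation of the hyperbolic
   operator: terms of order zero cancel, and the cross term changes the
   coefficient of the first normal derivative to 1 - 2 gamma. *)
Lemma hyperbolic_conjugation W p : Ck_on 2 (@half_space R n) W -> 0 < p.2 ->
  - laplace_hyperbolic (fun q => q.2 `^ (n%:R - s) * W q) p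
  - s * (n%:R - s) * (p.2 `^ (n%:R - s) * W p) =
  - (p.2 `^ (n%:R - s) * p.2 ^+ 2 *
     (laplace_x W p + (1 - 2 * gamma) / p.2 * dy W p + dy (dy W) p)).
Proof.
move=> cW p0; set r := n%:R - s.
have cu : Ck_on 2 (@half_space R n) (fun q => q.2 `^ r * W q).
  by apply: (Ck_onM open_half_space); [exact: Ck_on_powR|exact: cW].
rewrite (laplace_hyperbolicE cu p0).
have d1 v q : 0 < q.2 -> is_derive q v W ('D_v W q).
  by move=> q0; apply: derivableP; have [_ d] := cW [::] q isT q0; exact: d.
have d2 v w : is_derive p w ('D_v W) ('D_w ('D_v W) p).
  by apply: derivableP; have [_ d] := cW [:: v] p isT p0; exact: d.
have dux i : 'D_(ex i) ('D_(ex i) (fun q : V => q.2 `^ r * W q)) p =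
    p.2 `^ r * 'D_(ex i) ('D_(ex i) W) p.
  transitivity ('D_(ex i) (fun q : V => q.2 `^ r * 'D_(ex i) W q) p).
    apply: near_eq_derive; apply: filterS (near_half_space p0) => q q0.
    rewrite (isd_val (isdM (isd_snd_comp (ex i) (isd_powR r q0)) (d1 (ex i) q q0))).
    by rewrite /= mulr0 mulr0 addr0.
  rewrite (isd_val (isdM (isd_snd_comp (ex i) (isd_powR r p0)) (d2 (ex i) (ex i)))).
  by rewrite /= mulr0 mulr0 addr0.
have duy q : 0 < q.2 -> 'D_ey (fun q : V => q.2 `^ r * W q) q =
    q.2 `^ r * 'D_ey W q + W q * (r * q.2 `^ (r - 1)).
  move=> q0; rewrite (isd_val (isdM (isd_snd_comp ey (isd_powR r q0)) (d1 ey q q0))).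
  by rewrite /= mulr1.
have duyy : 'D_ey ('D_ey (fun q : V => q.2 `^ r * W q)) p =
    p.2 `^ r * 'D_ey ('D_ey W) p + 'D_ey W p * (r * p.2 `^ (r - 1)) +
    (W p * (r * ((r - 1) * p.2 `^ (r - 1 - 1))) + r * p.2 `^ (r - 1) * 'D_ey W p).
  transitivity ('D_ey (fun q : V => q.2 `^ r * 'D_ey W q + W q * (r * q.2 `^ (r - 1))) p).
    by apply: near_eq_derive; apply: filterS (near_half_space p0) => q; exact: duy.
  rewrite (isd_val (isdD (isdM (isd_snd_comp ey (isd_powR r p0)) (d2 ey ey))
    (isdM (d1 ey p p0) (isdZ r (isd_snd_comp ey (isd_powR (r - 1) p0)))))).
  by rewrite /= !mulr1.
have dxx : laplace_x (fun q : V => q.2 `^ r * W q) p = p.2 `^ r * laplace_x W p.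
  by rewrite /laplace_x mulr_sumr; apply: eq_bigr => i _; exact: dux.
rewrite dxx /dy duyy duy // (powR_step r p0) (powR_step (r - 1) p0).
have pn0 : p.2 != 0 by rewrite gt_eqF.
move: (laplace_x W p) ('D_ey ('D_ey W) p) ('D_ey W p) (W p) (p.2 `^ _) => A B C w z.
by rewrite /r; field.
Qed.

End Hyperbolic.

(** * Boundary asymptotics *)

Section PowLimit.
Variable R : realType.
Implicit Types (sigma r t : R) (eta : nat -> R -> R) (j k : nat).

(** The [j]-th derivative of [t^r eta 0], for a derivation sending [t^r] to
   [r t^(r - sigma)] and [eta k] to [eta (k + 1)]. *)
Fixpoint pow_rec sigma r eta j t : R :=
  match j with
  | 0 => t `^ r * eta 0 t
  | j1.+1 => pow_rec sigma r (fun k => eta k.+1) j1 t + r * pow_rec sigma (r - sigma) eta j1 t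
  end.

Lemma powR_cvg0M r (g : R -> R) (l : R) : 0 < r -> g t @[t --> (0 : R)^'+] --> l ->
  t `^ r * g t @[t --> (0 : R)^'+] --> (0 : R).
Proof.
by move=> r0 gl; rewrite -[X in _ --> X](mul0r l); apply: cvgM => //; exact: powR_cvg0.
Qed.

(** In the leading term all derivatives fall on the power. *)
Lemma pow_rec_lim sigma r eta (l : nat -> R) j : 0 < sigma ->
  (forall k, eta k t @[t --> (0 : R)^'+] --> l k) ->
  t `^ (sigma * j%:R - r) * pow_rec sigma r eta j t @[t --> (0 : R)^'+] -->
  \prod_(i < j) (r - sigma * i%:R) * l 0.
Proof.
move=> s0; elim: j r eta l => [|j ih] r eta l el.
  rewrite big_ord0 mul1r; apply: cvg_trans (el 0); apply: near_eq_cvg; near=> t.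
  have t0 : 0 < t by near: t; exact: nbhs_right_gt.
  rewrite /= mulrA -powRD ?(gt_eqF t0) ?implybT //.
  by rewrite mulr0 sub0r addNr powRr0 mul1r.
have h1 := ih r _ _ (fun k => el k.+1).
have h2 := ih (r - sigma) _ _ el.
have -> : \prod_(i < j.+1) (r - sigma * i%:R) =
    r * \prod_(i < j) (r - sigma - sigma * i%:R).
  rewrite big_ord_recl mulr0 subr0; congr (_ * _); apply: eq_bigr => i _.
  by rewrite lift0 -natr1; ring.
have ff : Filter ((0 : R)^'+) by exact: _.
have L := cvgD (powR_cvg0M s0 h1) (cvgM (cvg_cst r) h2).
have {}L := L ff ff ff.
rewrite add0r [X in _ --> X]mulrA in L; apply: cvg_trans L.
apply: near_eq_cvg; near=> t.
have t0 : 0 < t by near: t; exact: nbhs_right_gt.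
rewrite fctE /= mulrA -powRD ?(gt_eqF t0) ?implybT //.
have -> : sigma + (sigma * j%:R - r) = sigma * j.+1%:R - r by rewrite -natr1; ring.
have -> : sigma * j%:R - (r - sigma) = sigma * j.+1%:R - r by rewrite -natr1; ring.
by ring.
Unshelve. all: by end_near. Qed.

Lemma isd_pow_rec r eta j t : 0 < t ->
  (forall k, is_derive t (1 : R) (eta k) (eta k.+1 t)) ->
  is_derive t (1 : R) (pow_rec 1 r eta j) (pow_rec 1 r eta j.+1 t).
Proof.
move=> t0; elim: j r eta => [|j ih] r eta d.
  apply: isd_eq (isdM (isd_powR r t0) (d 0)) _.
  by rewrite /=; ring.
exact: (isdD (ih r _ (fun k => d k.+1)) (isdZ r (ih (r - 1) _ d))).
Qed.

(** For an integer N above [2 gamma], t^(N - 2 gamma) times the N-th derivative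
   of the right-hand side tends to a nonzero multiple of [le 0], and the N-th
   derivative of the left-hand side is bounded. If [2 gamma] is an odd integer,
   N = 2 gamma is taken instead, and the derivative of odd order of the even
   left-hand side tends to 0. *)
Lemma even_pow_leading0 (gamma : R) (phi eta : nat -> R -> R) (lp le : nat -> R) :
  0 < gamma -> (forall k, gamma != k%:R) ->
  (forall k t, 0 < t -> is_derive t (1 : R) (phi k) (phi k.+1 t)) ->
  (forall k t, 0 < t -> is_derive t (1 : R) (eta k) (eta k.+1 t)) ->
  (forall k, phi k t @[t --> (0 : R)^'+] --> lp k) ->
  (forall k, eta k t @[t --> (0 : R)^'+] --> le k) ->
  (forall k, lp k.*2.+1 = 0) ->
  (forall t, 0 < t -> phi 0 t = t `^ (2 * gamma) * eta 0 t) ->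
  le 0 = 0.
Proof.
move=> g0 gnat dp de lpP leP odd0 e.
have eP k t : 0 < t -> phi k t = pow_rec 1 (2 * gamma) eta k t.
  elim: k t => [|k ih] t t0; first exact: e.
  apply: (isd_uniq (dp k t t0)).
  apply: isd_near (isd_pow_rec (2 * gamma) k t0 (fun k => de k t t0)).
  have : \forall s \near t, 0 < s by exact: lt_nbhsr.
  by apply: filterS => s s0; rewrite ih.
pose m := Num.truncn gamma.
have /andP[m1 m2] := truncn_itv (ltW g0); rewrite -/m in m1 m2.
have key N : (forall i, (i < N)%N -> 2 * gamma != i%:R) ->
    2 * gamma < N%:R \/ (2 * gamma = N%:R /\ lp N = 0) -> le 0 = 0.
  move=> ne cas.
  have L := @pow_rec_lim 1 (2 * gamma) eta le N ltr01 leP; rewrite mul1r in L.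
  have {}L : t `^ (N%:R - 2 * gamma) * phi N t @[t --> (0 : R)^'+] -->
     \prod_(i < N) (2 * gamma - 1 * i%:R) * le 0.
    apply: cvg_trans L; apply: near_eq_cvg; near=> t.
    by rewrite eP //; near: t; exact: nbhs_right_gt.
  have L0 : t `^ (N%:R - 2 * gamma) * phi N t @[t --> (0 : R)^'+] --> (0 : R).
    case: cas => [lt|[eq lp0]].
      have gN : 0 < N%:R - 2 * gamma by rewrite subr_gt0.
      exact: powR_cvg0M (lpP N).
    rewrite -[X in _ --> X]lp0; apply: cvg_trans (lpP N); apply: near_eq_cvg.
    by near=> t; rewrite eq subrr powRr0 mul1r.
  have /eqP : \prod_(i < N) (2 * gamma - 1 * i%:R) * le 0 = 0.
    exact: (cvg_unique (@norm_hausdorff _ R^o) L L0).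
  rewrite mulf_eq0 => /orP[|/eqP //].
  move=> /prodf_eq0[i _]; rewrite mul1r subr_eq0.
  by rewrite (negbTE (ne i (ltn_ord i))).
have even_ne i : 2 * gamma != i.*2%:R.
  by rewrite -muln2 natrM mulrC (inj_eq (mulIf _)) ?gnat.
have [eqm|neqm] := eqVneq (2 * gamma) m.*2.+1%:R.
  by apply: (key m.*2.+1); [move=> i im; rewrite eqm eqr_nat gtn_eqF|right].
apply: (key m.*2.+2).
  move=> i; rewrite -(odd_double_half i); case: (odd i); rewrite ?add0n ?even_ne //.
  rewrite add1n !ltnS; have [->|ne le'] := eqVneq i./2 m; first by rewrite neqm.
  have lt : (i./2 < m)%N by rewrite ltn_neqAle ne -leq_double.
  rewrite gt_eqF // (@lt_le_trans _ _ m.*2%:R) //.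
    by rewrite ltr_nat -doubleS leq_double.
  by rewrite -mul2n natrM ler_pM2l.
by left; rewrite -doubleS -mul2n natrM ltr_pM2l.
Unshelve. all: by end_near. Qed.

End PowLimit.

Section Uniqueness.
Variables (R : realType) (n : nat) (gamma : R).
Local Notation V := ('rV[R]_n * R)%type.
Local Notation ex := (@ex R n).
Local Notation ey := (@ey R n).
Local Notation s := (n%:R / 2 + gamma).
Implicit Types (p q : V) (ws : seq 'I_n) (i : 'I_n) (j k : nat) (F H u v : V -> R).
Hypotheses (gamma_gt0 : 0 < gamma) (gamma_nat : forall k, gamma != k%:R).

Lemma bvp_unique (f : 'rV[R]_n -> R) (M : R) (U1 U2 : V -> R) :
  (forall x, `|f x| <= M) -> bounded_bvp_solution (1 - 2 * gamma) f U1 ->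
  bounded_bvp_solution (1 - 2 * gamma) f U2 -> forall p, 0 <= p.2 -> U1 p = U2 p.
Proof.
move=> bf s1 s2 p p0.
have b1 := bvp_bounded_solution bf s1; have b2 := bvp_bounded_solution bf s2.
have [_ _ _ e1 _] := s1; have [_ _ _ e2 _] := s2.
have gamma_neq1 : gamma != 1 by have := gamma_nat 1.
have bd x : `|-1 * U2 (x, 0) + U1 (x, 0)| <= 0 by rewrite e1 e2 mulN1r addNr normr0.
have := maximum_principle gamma_gt0 gamma_neq1 (bounded_solution_lin (- 1) b2 b1) bd p0.
by rewrite normr_le0 mulN1r addrC subr_eq0 => /eqP.
Qed.

Lemma shift_exponent (y : R) : 0 < y ->
  y `^ (n%:R - s) * y `^ (2 * gamma) = y `^ s.
Proof. by move=> y0; rewrite -powRD ?(gt_eqF y0) ?implybT //; congr powR; field. Qed.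

Lemma cancel_exponent (y : R) : 0 < y -> y `^ (s - n%:R) * y `^ (n%:R - s) = 1.
Proof.
move=> y0; rewrite -powRD ?(gt_eqF y0) ?implybT // -[RHS](powRr0 y).
by congr powR; ring.
Qed.

(** The expansion divided by y^(n-s) is continuous up to the boundary, because
   y^(2 gamma) is; the conjugation identity gives its equation. *)
Lemma poisson_bvp (f : 'rV[R]_n -> R) v F H : poisson_solution s f v F H ->
  bounded_bvp_solution (1 - 2 * gamma) f (fun p => F p + p.2 `^ (2 * gamma) * H p) /\
  forall p, 0 < p.2 -> v p = p.2 `^ (n%:R - s) * (F p + p.2 `^ (2 * gamma) * H p).
Proof.
move=> [[cv eqv] ev [[sF cF _] [sH cH _] _ _] Ff [M bM]].
have g2 : 0 < 2 * gamma by rewrite mulr_gt0.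
have vE p : 0 < p.2 -> v p = p.2 `^ (n%:R - s) * (F p + p.2 `^ (2 * gamma) * H p).
  by move=> p0; rewrite ev // mulrDr mulrA shift_exponent // mulrC [H p * _]mulrC.
split=> //.
have cW : Ck_on 2 (@half_space R n) (fun p => F p + p.2 `^ (2 * gamma) * H p).
  apply: (Ck_onD (@open_half_space R n)); first exact: sF.
  by apply: (Ck_onM (@open_half_space R n)); [exact: Ck_on_powR|exact: sH].
split=> //.
- move=> p p0; have := eqv p p0; rewrite vE // (laplace_hyperbolic_eq vE p0).
  rewrite (hyperbolic_conjugation gamma cW p0) => /eqP.
  rewrite oppr_eq0 !mulf_eq0 (gt_eqF p0) (gt_eqF (powR_gt0 _ p0)) /= => /eqP E; exact: E.
- exact: (closed_contD cF (closed_contM (closed_cont_powR g2) cH)).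
- by move=> x; rewrite /= powR0 ?mul0r ?addr0 ?gt_eqF.
- exists M => p p0; have := bM p p0.
  by rewrite vE // mulrA cancel_exponent // mul1r.
Qed.

Lemma poisson_of_jets (f : 'rV[R]_n -> R) (U : V -> R)
    (F H : seq 'I_n -> nat -> V -> R) :
  bounded_bvp_solution (1 - 2 * gamma) f U -> closed_jet F -> closed_jet H ->
  (forall x, F [::] 0 (x, 0) = f x) ->
  (forall p, 0 < p.2 -> U p = F [::] 0 p + p.2 `^ (2 * gamma) * H [::] 0 p) ->
  poisson_solution s f (fun p => p.2 `^ (n%:R - s) * U p) (F [::] 0) (H [::] 0).
Proof.
move=> [cU eqU _ _ [M bM]] jF jH F0 e; split=> //.
- split.
    by apply: (Ck_onM (@open_half_space R n)); [exact: Ck_on_powR|exact: cU].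
  move=> p p0; rewrite (hyperbolic_conjugation gamma cU p0) eqU //.
  by rewrite mulr0 oppr0.
- by move=> p p0; rewrite e // mulrDr mulrA shift_exponent // mulrC [H _ _ p * _]mulrC.
- by split; [exact: jet_smooth|exact: jet_smooth|exact: jet_even|exact: jet_even].
- by exists M => p p0; rewrite mulrA cancel_exponent // mul1r; exact: bM.
Qed.

Lemma smooth_normal_derivs F x : smooth_up_to_boundary F ->
  exists l : nat -> R,
  [/\ forall k (t : R), 0 < t -> is_derive t (1 : R)
        (fun y => iter_derive (nseq k ey) F (x, y)) (iter_derive (nseq k.+1 ey) F (x, t)),
      forall k, iter_derive (nseq k ey) F (x, y) @[y --> (0 : R)^'+] --> l k
    & l 0 = F (x, 0)].
Proof.
move=> [sF cF eF].
have /choice[l lP] : forall k, exists l : R,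
    iter_derive (nseq k ey) F (x, y) @[y --> (0 : R)^'+] --> l.
  move=> k; have [G cG e] := eF (nseq k ey); exists (G (x, 0)).
  apply: cvg_trans (@closed_cont_boundary R n G x cG); apply: near_eq_cvg; near=> t.
  by rewrite e //=; near: t; exact: nbhs_right_gt.
exists l; split; [|exact: lP|].
  move=> k t t0; apply: (iffRL (isd_ey _ x t _)); apply: derivableP.
  have [_ d] := sF k.+1 (nseq k ey) (x, t) (leqW (eq_leq (size_nseq _ _))) t0.
  by apply: d; rewrite size_nseq.
exact: (cvg_unique (@norm_hausdorff _ R^o) (lP 0) (@closed_cont_boundary R n F x cF)).
Unshelve. all: by end_near. Qed.

(** On a normal line the difference of the even parts is y^(2 gamma) times a
   smooth function, which vanishes at the boundary by evenness. *)
Lemma boundary_term_unique F H F' H' x :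
  smooth_up_to_boundary F -> smooth_up_to_boundary H -> even_in_y F ->
  smooth_up_to_boundary F' -> smooth_up_to_boundary H' -> even_in_y F' ->
  (forall p, 0 < p.2 -> F p + p.2 `^ (2 * gamma) * H p =
     F' p + p.2 `^ (2 * gamma) * H' p) ->
  H (x, 0) = H' (x, 0).
Proof.
move=> sF sH eF sF' sH' eF' e.
have [lF [dF cF _]] := smooth_normal_derivs x sF.
have [lF' [dF' cF' _]] := smooth_normal_derivs x sF'.
have [lH [dH cH lH0]] := smooth_normal_derivs x sH.
have [lH' [dH' cH' lH'0]] := smooth_normal_derivs x sH'.
apply/eqP; rewrite -lH0 -lH'0 -subr_eq0; apply/eqP.
apply: (@even_pow_leading0 R gamma
  (fun k t => iter_derive (nseq k ey) F' (x, t) - iter_derive (nseq k ey) F (x, t))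
  (fun k t => iter_derive (nseq k ey) H (x, t) - iter_derive (nseq k ey) H' (x, t))
  (fun k => lF' k - lF k) (fun k => lH k - lH' k)) => //.
- by move=> k t t0; apply: isdB; [exact: dF'|exact: dF].
- by move=> k t t0; apply: isdB; [exact: dH|exact: dH'].
- by move=> k; apply: cvgB.
- by move=> k; apply: cvgB.
- move=> k; rewrite (cvg_unique (@norm_hausdorff _ R^o) (cF' k.*2.+1) (eF' x k)).
  by rewrite (cvg_unique (@norm_hausdorff _ R^o) (cF k.*2.+1) (eF x k)) // subrr.
- by move=> t t0; have := e (x, t) t0; rewrite /= mulrBr; lra.
Qed.

Lemma weighted_dy_jet (U : V -> R) (J : seq 'I_n -> nat -> V -> R) m p :
  interior_jet J -> (forall q, 0 < q.2 -> U q = J [::] 0 q) -> 0 < p.2 ->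
  weighted_dy m U p = J [::] m p.
Proof.
move=> jJ e; elim: m p => [|m ih] p p0; first exact: e.
rewrite /weighted_dy iterS -/(weighted_dy m U) /dy.
have [_ _ d] := jJ [::] m p p0.
have -> : 'D_ey (weighted_dy m U) p = p.2 * J [::] m.+1 p.
  rewrite -(isd_val d); apply: near_eq_derive.
  by apply: filterS (near_half_space p0) => q; exact: ih.
by rewrite mulKf // gt_eqF.
Qed.

Lemma pow_jet_rec r (J : nat -> V -> R) j x t :
  pow_jet r J j (x, t) = pow_rec 2 r (fun k s => J k (x, s)) j t.
Proof. by elim: j r J => [|j ih] r J //=; rewrite !ih. Qed.

(** The weighted normal derivative of order [m + 1] kills the even part in the
   limit and reads off the boundary value of [H]. *)
Lemma weighted_limit (U : V -> R) (F H : seq 'I_n -> nat -> V -> R) x :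
  closed_jet F -> closed_jet H ->
  (forall p, 0 < p.2 -> U p = F [::] 0 p + p.2 `^ (2 * gamma) * H [::] 0 p) ->
  let m := Num.truncn gamma in
  y `^ (1 - 2 * (gamma - m%:R)) * dy (weighted_dy m U) (x, y) @[y --> (0 : R)^'+] -->
  2 * (gamma - m%:R) * A_const gamma m * H [::] 0 (x, 0).
Proof.
move=> [jF cF] [jH cH] e m.
have /andP[m1 m2] := truncn_itv (ltW gamma_gt0); rewrite -/m in m1 m2.
pose B ws := pow_jet (2 * gamma) (H ws).
have jB : interior_jet B by exact: mul_pow_jet.
have jJ := interior_jetD jF jB.
have lF := @closed_cont_boundary R n _ x (cF [::] m.+1).
have lH := @pow_rec_lim R 2 (2 * gamma) _ _ m.+1 (ltr0n R 2)
  (fun k => @closed_cont_boundary R n _ x (cH [::] k)).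
have b0 : 0 < 2 * m.+1%:R - 2 * gamma by rewrite subr_gt0 ltr_pM2l.
have L := cvgD (powR_cvg0M b0 lF) lH.
have ff : Filter ((0 : R)^'+) by exact: _.
have {}L := L ff; rewrite add0r in L; move: L.
have -> : \prod_(i < m.+1) (2 * gamma - 2 * i%:R) = 2 * (gamma - m%:R) * A_const gamma m.
  rewrite big_ord_recr /= mulrC -mulrBr; congr (_ * _).
  rewrite /A_const; under eq_bigr do rewrite -mulrBr.
  by rewrite big_split /= prodr_const card_ord.
move=> L; apply: cvg_trans L; apply: near_eq_cvg; near=> t.
have t0 : 0 < t by near: t; exact: nbhs_right_gt.
have [_ _ d] := jJ [::] m (x, t) t0.
have -> : dy (weighted_dy m U) (x, t) = t * (F [::] m.+1 (x, t) + B [::] m.+1 (x, t)).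
  rewrite /dy -(isd_val d); apply: near_eq_derive.
  apply: filterS (near_half_space (p := (x, t)) t0) => q q0.
  exact: (weighted_dy_jet _ jJ).
rewrite /B pow_jet_rec mulrA -[X in _ * X * _](powRr1 (ltW t0)).
rewrite -powRD ?(gt_eqF t0) ?implybT //= -mulrDr; congr (powR _ _ * _).
by rewrite -natr1; ring.
Unshelve. all: by end_near. Qed.

End Uniqueness.

Theorem theorem3p3 (R : realType) (n : nat) (gamma : R)
    (f : 'rV[R]_n -> R) (U : 'rV[R]_n * R -> R)
    (gamma_gt0 : 0 < gamma) (gamma_lt : gamma < n%:R / 2)
    (gamma_nat : gamma \isn't a Num.nat)
    (f_schwartz : schwartz f)
    (U_sol : bounded_bvp_solution (1 - 2 * gamma) f U) :
  let s := n%:R / 2 + gamma in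
  let m := Num.truncn gamma in
  let gamma0 := gamma - m%:R in
  let a0 := 1 - 2 * gamma0 in
  let u := fun p : 'rV[R]_n * R => p.2 `^ (n%:R - s) * U p in
  [/\ exists F H, poisson_solution s f u F H,
      forall v F H, poisson_solution s f v F H ->
        forall p, 0 < p.2 -> v p = u p
    & forall x : 'rV[R]_n,
        let G := fun y : R => y `^ a0 * dy (weighted_dy m U) (x, y) in
        cvg (G y @[y --> 0^'+]) /\
        P_op gamma f x =
          d_const gamma / (2 * gamma0) * (A_const gamma m)^-1 *
          lim (G y @[y --> 0^'+])].
Proof.
move=> s m gamma0 a0 u.
have gnat k : gamma != k%:R.
  by apply: contraNneq gamma_nat => ->; exact: natr_nat.
have [F [H [jF jH F0 e]]] := expansion gamma_gt0 gnat f_schwartz U_sol.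
have su := poisson_of_jets U_sol jF jH F0 e.
have [M bf] : exists M, forall x, `|f x| <= M.
  by have [_ b _] := schwartz_x_jet f_schwartz; exact: b [::].
have uniq v F' H' : poisson_solution s f v F' H' -> forall p, 0 < p.2 ->
    F' p + p.2 `^ (2 * gamma) * H' p = U p /\ v p = u p.
  move=> sv p p0; have [sW ev] := poisson_bvp gamma_gt0 sv.
  have eU := bvp_unique gamma_gt0 gnat bf sW U_sol (ltW p0).
  by split; [exact: eU|rewrite ev // eU].
split.
- by exists (F [::] 0), (H [::] 0).
- by move=> v F' H' sv p p0; case: (uniq v F' H' sv p p0).
move=> x G.
have GL := weighted_limit gamma_gt0 (x := x) jF jH e.
split; first by apply/cvg_ex; eexists; exact: GL.
rewrite (cvg_lim _ GL) //.
have /andP[m1 m2] := truncn_itv (ltW gamma_gt0); rewrite -/m in m1 m2.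
have g0 : gamma0 != 0 by rewrite subr_eq0 gnat.
have A0 : A_const gamma m != 0.
  rewrite mulf_neq0 ?expf_neq0 //; apply/prodf_neq0 => i _.
  by rewrite subr_eq0 gnat.
rewrite /P_op -/s.
have -> : scattering s f x = H [::] 0 (x, 0).
  have [v [F' [H' [sv ->]]]] : exists v F' H', poisson_solution s f v F' H' /\
      scattering s f = (fun x => H' (x, 0)).
    apply: (getPex (P := [set h | exists v F H, poisson_solution s f v F H /\
      h = (fun x => H (x, 0))])).
    by exists (fun x => H [::] 0 (x, 0)), u, (F [::] 0), (H [::] 0).
  have [_ _ [sF' sH' eF' _] _ _] := sv; have [_ _ [sF sH eF _] _ _] := su.
  apply: (boundary_term_unique gamma_gt0 gnat x sF' sH' eF' sF sH eF) => p p0.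
  by rewrite (uniq _ _ _ sv p p0).1 e.
by rewrite -/m -/gamma0; field; rewrite A0 g0.
Qed.
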